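(* Let $\mathcal A=\{A_1,\dots,A_m\}$ be an irreducible finite family of real $d\times d$ matrices that has a unique dominant product with a unique and simple leading eigenvalue $\lambda$, and let $\mathcal A^*=\{A_1^T,\dots,A_m^T\}$ be the transpose family. (i) If $\lambda$ is real, then $\mathcal A$ has a unique Barabanov norm (up to multiplication by a positive constant). This norm is piecewise-linear and is given by $$f(x)=\max_{v^*}\,|(v^*,x)|,$$ where the maximum is taken over all vertices $v^*$ of the invariant polytope $G^*$ of the transpose family $\mathcal A^*$. (ii) If $\lambda$ is complex (non-real), then $\mathcal A$ has a piecewise-quadratic Barabanov norm given by $$f(x)=\max_{E^*}\ \max_{z^*\in E^*}\ |(z^*,x)|,$$ where the maximum is taken over all ellipses $E^*$ of a finite collection of ellipses centered at the origin whose convex hull is an invariant body of the transpose family $\mathcal A^*$. (iii) If $\lambda$ is complex and its argument is irrational $\mathrm{mod}\ \pi$, then the Barabanov norm in (ii) is the unique Barabanov norm of $\mathcal A$ (up to multiplication by a positive constant).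
   Context: Family: $\mathcal A=\{A_1,\dots,A_m\}$, $m\ge 1$, is irreducible if the matrices $A_i$ share no common invariant linear subspace other than $\{0\}$ and $\mathbb R^d$. $\mathcal A^k$ is the set of all products of $k$ matrices from $\mathcal A$ (repetitions permitted), $\mathcal A^{\mathbb N}=\bigcup_{k\ge1}\mathcal A^k$; products are regarded as words, $|\Pi|$ is the length of the product $\Pi$. $\rho(S)$ is the spectral radius of a matrix $S$; the joint spectral radius is $\rho(\mathcal A)=\lim_{n\to\infty}\max_{\Pi\in\mathcal A^n}\|\Pi\|^{1/n}$. Put $\nu(\Pi)=\rho(\Pi)^{1/|\Pi|}$. $(\cdot,\cdot)$ is the standard inner product. A Barabanov norm of $\mathcal A$ is a norm $f$ on $\mathbb R^d$ with $\max_{i=1,\dots,m}f(A_ix)=\rho(\mathcal A)f(x)$ for every $x\in\mathbb R^d$. A convex body is a convex compact set with nonempty interior; convex bodies and polytopes are assumed symmetric about the origin (an ellipse is a set $\{a\cos t+b\sin t: t\in\mathbb R\}$ with $a,b\in\mathbb R^d$). A convex body $G\subset\mathbb R^d$ is invariant for $\mathcal A$ if $\mathrm{co}\bigl(\bigcup_{i=1}^m A_iG\bigr)=\rho(\mathcal A)\,G$; an invariant polytope is an invariant body that is a polytope. (If the leading eigenvalue is real, $\mathcal A^*$ has, up to a positive factor, exactly one invariant body, and it is a polytope; if it is non-real, $\mathcal A^*$ has an invariant body that is a convex hull of finitely many ellipses.) A product is primitive if it is not a power of a shorter product. A set $\mathcal P\subset\mathcal A^{\mathbb N}$ is a set of dominant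 products if: (1) all its elements are primitive and none is a cyclic permutation of another; (2) there is $q$ with $\nu(\Pi)=q$ for all $\Pi\in\mathcal P$; (3) there is $\varepsilon>0$ such that every $S\in\mathcal A^{\mathbb N}$ satisfies $\nu(S)\le(1-\varepsilon)^{1/|S|}q$ unless $S$ is a power of some product from $\mathcal P$ or of one of its cyclic permutations. $\mathcal A$ has a unique dominant product $\Pi$ if $\mathcal P=\{\Pi\}$ is a set of dominant products. A leading eigenvalue of a matrix is an eigenvalue of largest modulus. It is unique and simple if $\lambda$ is not multiple and all other eigenvalues, except for $\bar\lambda$ when $\lambda\notin\mathbb R$, are strictly smaller in modulus. For $\lambda=|\lambda|e^{i\varphi}$ the argument is irrational $\mathrm{mod}\ \pi$ if $\varphi/\pi\notin\mathbb Q$. *)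

(* Defs.v *)
From HB Require Import structures.
From mathcomp Require Import all_boot all_order all_algebra.
From mathcomp Require Import complex.
From mathcomp Require Import all_classical all_reals all_analysis.

Set Implicit Arguments.
Unset Strict Implicit.
Unset Printing Implicit Defensive.

Import Order.TTheory GRing.Theory Num.Theory.
Import numFieldNormedType.Exports.

Local Open Scope classical_set_scope.
Local Open Scope ring_scope.

Definition is_max (R : realType) (S : set R) (r : R) : Prop :=
  S r /\ ubound S r.

Definition dot (R : realType) (d : nat) (u v : 'cV[R]_d) : R :=
  \sum_(i < d) u i ord0 * v i ord0.

Section Spectrum.
Variables (R : realType) (d : nat).
Implicit Types (S : 'M[R]_d) (lambda mu : R[i]).

Definition complexify S : 'M[R[i]]_d := map_mx (real_complex R) S.

(* [eigenvalue] is the library's left-eigenvector version; the spectrum of a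
   square matrix is the same on either side. *)
Definition spectral_radius S : R :=
  sup [set complex.Re `|mu| | mu in [set mu | eigenvalue (complexify S) mu]].

Definition leading_eigenvalue S lambda : Prop :=
  eigenvalue (complexify S) lambda /\
  forall mu, eigenvalue (complexify S) mu -> `|mu| <= `|lambda|.

Definition unique_simple_leading_eigenvalue S lambda : Prop :=
  [/\ leading_eigenvalue S lambda,
      mup lambda (char_poly (complexify S)) = 1%N
    & forall mu, eigenvalue (complexify S) mu ->
        mu != lambda -> mu != (lambda^*)%C -> `|mu| < `|lambda| ].

End Spectrum.

Definition argument_irrational_mod_pi (R : realType) (lambda : R[i]) : Prop :=
  exists phi : R,
    lambda = `|lambda| * (cos phi +i* sin phi)%C /\
    (phi / pi : R) \in @irrational R.

Section Words.
Variable I : eqType.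
Implicit Types (u w : seq I) (P : set (seq I)).

Definition word_power w (k : nat) : seq I := flatten (nseq k w).

Definition primitive w : Prop :=
  ~ exists u k, (size u < size w)%N /\ w = word_power u k.

Definition cyclic_permutation u w : Prop := exists k, w = rot k u.

End Words.

Section Families.
Variables (R : realType) (d m : nat).
Implicit Types (A : 'I_m -> 'M[R]_d) (w : seq 'I_m).

Definition transpose_family A : 'I_m -> 'M[R]_d := fun i => (A i)^T.

Definition irreducible_family A : Prop :=
  forall V : {vspace 'cV[R]_d},
    (forall i x, x \in V -> A i *m x \in V) -> V = 0%VS \/ V = fullv.

Definition product A w : 'M[R]_d := \prod_(i <- w) A i.

(* The norm is the library's entrywise maximum; as all norms on a
   finite-dimensional space are equivalent, the limit does not depend on this
   choice. *)
Definition joint_spectral_radius A : R :=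
  lim ((fun n : nat =>
    \big[Num.max/0]_(w : n.-tuple 'I_m) `|product A w| `^ (n%:R^-1)) @ \oo).

Definition nu A w : R := spectral_radius (product A w) `^ ((size w)%:R^-1).

(* Words are sequences of indices, so that equal matrices with different
   indices are different letters.  The bound eps < 1, harmless since the
   condition weakens as eps decreases, is needed because [powR] is not
   meaningful at a negative base. *)
Definition dominant_products A (P : set (seq 'I_m)) : Prop :=
  [/\ forall w, P w -> w <> [::] /\ primitive w,
      forall u w, P u -> P w -> u <> w -> ~ cyclic_permutation u w
    & exists q : R, (forall w, P w -> nu A w = q) /\
        exists eps : R, [/\ 0 < eps, eps < 1
          & forall s : seq 'I_m, s <> [::] ->
              ~ (exists u w k, [/\ P u, cyclic_permutation u w
                                 & s = word_power w k]) ->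
              nu A s <= (1 - eps) `^ ((size s)%:R^-1) * q] ].

Definition unique_dominant_product A w : Prop :=
  dominant_products A [set w].

End Families.

Section Norms.
Variables (R : realType) (d m : nat).
Implicit Types (A : 'I_m -> 'M[R]_d) (f : 'cV[R]_d -> R).

Definition is_norm f : Prop :=
  [/\ forall x, f x = 0 -> x = 0,
      forall (c : R) x, f (c *: x) = `|c| * f x
    & forall x y, f (x + y) <= f x + f y].

Definition barabanov_norm A f : Prop :=
  is_norm f /\
  forall x, \big[Num.max/0]_(i < m) f (A i *m x) =
            joint_spectral_radius A * f x.

Definition unique_barabanov_norm A f : Prop :=
  barabanov_norm A f /\
  forall g, barabanov_norm A g ->
    exists2 c : R, 0 < c & forall x, g x = c * f x.

Definition polyhedral_cone (s : seq 'cV[R]_d) : set 'cV[R]_d :=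
  [set x | forall a, a \in s -> 0 <= dot a x].

(* For a norm, which is positively homogeneous, the linearity pieces can be
   taken to be cones. *)
Definition piecewise_linear f : Prop :=
  exists pieces : seq (seq 'cV[R]_d * 'cV[R]_d),
    (forall x, exists2 p, p \in pieces & polyhedral_cone p.1 x) /\
    forall p, p \in pieces ->
      forall x, polyhedral_cone p.1 x -> f x = dot p.2 x.

Definition quadratic_form (Q : 'M[R]_d) (x : 'cV[R]_d) : R := dot x (Q *m x).

Definition quadratic_cone (s : seq 'M[R]_d) : set 'cV[R]_d :=
  [set x | forall Q, Q \in s -> 0 <= quadratic_form Q x].

(* A norm is piecewise-quadratic when its unit sphere is made of finitely many
   pieces of quadrics, i.e. when f ^+ 2 is a quadratic form on each piece. *)
Definition piecewise_quadratic f : Prop :=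
  exists pieces : seq (seq 'M[R]_d * 'M[R]_d),
    (forall x, exists2 p, p \in pieces & quadratic_cone p.1 x) /\
    forall p, p \in pieces ->
      forall x, quadratic_cone p.1 x -> f x ^+ 2 = quadratic_form p.2 x.

End Norms.

Section Bodies.
Variables (R : realType) (d m : nat).
Implicit Types (A : 'I_m -> 'M[R]_d) (G S : set 'cV[R]_d).

Definition convex_hull S : set 'cV[R]_d :=
  smallest (@convex_set R 'cV[R]_d) S.

Definition convex_body G : Prop :=
  [/\ @convex_set R 'cV[R]_d G, compact G, interior G !=set0
    & forall x, G x -> G (- x)].

Definition invariant_body A G : Prop :=
  convex_body G /\
  convex_hull (\bigcup_(i in [set: 'I_m]) [set A i *m x | x in G]) =
    [set joint_spectral_radius A *: x | x in G].

Definition polytope G : Prop :=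
  exists s : seq 'cV[R]_d, G = convex_hull [set` s].

Definition invariant_polytope A G : Prop := invariant_body A G /\ polytope G.

Definition vertices G : set 'cV[R]_d :=
  [set v | G v /\ forall x y (t : R), G x -> G y -> 0 < t -> t < 1 ->
     v = t *: x + (1 - t) *: y -> x = v /\ y = v].

Definition ellipse (E : 'cV[R]_d * 'cV[R]_d) : set 'cV[R]_d :=
  [set cos t *: E.1 + sin t *: E.2 | t in [set: R]].

Definition ellipses_hull (Es : seq ('cV[R]_d * 'cV[R]_d)) : set 'cV[R]_d :=
  convex_hull (\bigcup_(E in [set` Es]) ellipse E).

Definition given_by_vertices G (f : 'cV[R]_d -> R) : Prop :=
  forall x, is_max [set `|dot v x| | v in vertices G] (f x).

Definition given_by_ellipses (Es : seq ('cV[R]_d * 'cV[R]_d))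
    (f : 'cV[R]_d -> R) : Prop :=
  forall x, is_max
    [set r | exists2 E, E \in Es & is_max [set `|dot z x| | z in ellipse E] r]
    (f x).

End Bodies.

(* Main.v *)
(* Normalise the family by q = nu(w), w the dominant product. Irreducibility and
   compactness show that the products of the normalised family are bounded: an
   exponential rate above q would produce almost fixed vectors of products whose
   eigenvalues stay away from 1. By dominance the same holds for all products
   other than powers of rotations of w, so along a recurrent trajectory only w
   can recur. Hence, up to boundedly many letters, every extremal trajectory is
   attracted by the leading eigenspace of w, on which w acts as a dilated
   reflection or rotation. An extremal norm is therefore determined by its
   restriction to that eigenspace, where invariance under a reflection, or under
   a rotation by an irrational angle, leaves no freedom but a scalar: this is
   uniqueness. Conversely, the supremum along all products of the modulus of the
   leading coordinate (in the rational case, of a suitable finite maximum of such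
   forms) is an extremal norm, attained on finitely many products; it is thus a
   finite maximum of functions |(v, x)|, or of sqrt((a, x)^2 + (b, x)^2), that is,
   the support function of the symmetric hull of finitely many points or
   ellipses. Finally, the support function of a convex body G is a Barabanov norm
   of the family exactly when G is invariant for the transposes. *)
Require Import Defs.
From mathcomp Require Import all_boot all_order all_algebra.
From mathcomp Require Import perm complex ring lra zify.
From mathcomp Require Import all_classical all_reals all_analysis.

Set Implicit Arguments.
Unset Strict Implicit.
Unset Printing Implicit Defensive.

Import Order.TTheory GRing.Theory Num.Theory.
Import numFieldNormedType.Exports.
Local Open Scope classical_set_scope.
Local Open Scope ring_scope.

(** Two uniform facts carry the compactness arguments. Matrices of bounded norm with spectra in a
    fixed disc of radius below 1 move every vector by a definite fraction of its length; the
    pigeonhole principle yields blocks of a long trajectory that almost fix a vector. Powers of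
    rotations of [w] escape the first fact, and the remaining words are not closed under
    concatenation. The way out is a marker: words [w s] with [s] not a power of [w]. Primitivity
    keeps them closed under concatenation, and the marker costs nothing, because [w] preserves the
    modulus of the leading coordinate.

    The other obstacle is to replace suprema by maxima over finitely many matrices. For this every
    single word other than a power of [w] has to lose a factor, while compactness only makes long
    chains of such words contract. Weights [a ^+ n], [a > 1], on chains of [n] marked words produce
    a seminorm with the stronger property. Near the leading eigenspace its supremum over all
    products is attained at the empty word, and extremal trajectories get there in boundedly many
    steps. The rate 0 cannot be normalised and is treated apart. *)

Local Notation rc R := (real_complex R).

(** * Norms and words *)

Section MatrixNorm.
Variable R : realType.

Lemma entry_le_norm (a b : nat) (x : 'M[R]_(a, b)) i j : `|x i j| <= `|x|.
Proof.
rewrite [leRHS]/Num.norm /= mx_normrE; apply/bigmax_geP; right => /=.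
by exists (i, j).
Qed.

Lemma norm_le_entries (a b : nat) (x : 'M[R]_(a, b)) (c : R) :
  0 <= c -> (forall i j, `|x i j| <= c) -> `|x| <= c.
Proof.
move=> c0 xc; rewrite [leLHS]/Num.norm /= mx_normrE; apply/bigmax_leP.
by split => // -[i j] _ /=.
Qed.

Lemma norm_lt_entries (a b : nat) (x : 'M[R]_(a, b)) (c : R) :
  0 < c -> (forall i j, `|x i j| < c) -> `|x| < c.
Proof.
move=> c0 xc; rewrite [ltLHS]/Num.norm /= mx_normrE; apply/bigmax_ltP.
by split => // -[i j] _ /=.
Qed.

Lemma norm_trmx (a b : nat) (x : 'M[R]_(a, b)) : `|x^T| = `|x|.
Proof.
by apply/eqP; rewrite eq_le; apply/andP; split; apply: norm_le_entries => // i j;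
  [rewrite mxE|rewrite -[x]trmxK mxE trmxK]; apply: entry_le_norm.
Qed.

Lemma norm_mulmx_le (a b c : nat) (x : 'M[R]_(a, b)) (y : 'M[R]_(b, c)) :
  `|x *m y| <= b%:R * `|x| * `|y|.
Proof.
apply: norm_le_entries => [|i j]; first by rewrite !mulr_ge0.
rewrite mxE; apply: le_trans (ler_norm_sum _ _ _) _.
apply: (@le_trans _ _ (\sum_(k < b) `|x| * `|y|)).
  by apply: ler_sum => k _; rewrite normrM ler_pM // entry_le_norm.
by rewrite sumr_const card_ord -mulrA mulr_natl.
Qed.

(** A grid of mesh [delta]: a cell records the truncations of [(x i j + M) / delta]. The default of
    [inord] can only occur for entries exceeding [M]. *)
Lemma finite_cells (a b : nat) (M delta : R) : 0 < delta ->
  exists (N : nat) (cell : 'M[R]_(a, b) -> 'I_N), forall x y,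
    `|x| <= M -> `|y| <= M -> cell x = cell y -> `|x - y| < delta.
Proof.
move=> d0; pose N := (Num.truncn ((M + M) / delta)).+1.
pose code (x : 'M[R]_(a, b)) : {ffun 'I_a * 'I_b -> 'I_N} :=
  [ffun ij => inord (Num.truncn ((x ij.1 ij.2 + M) / delta))].
exists #|{: {ffun 'I_a * 'I_b -> 'I_N}}|, (fun x => enum_rank (code x)).
move=> x y xM yM /enum_rank_inj e; apply: norm_lt_entries => // i j.
have lb (z : 'M[R]_(a, b)) : `|z| <= M -> 0 <= (z i j + M) / delta.
  move=> zM; apply: divr_ge0; last exact: ltW.
  have := le_trans (entry_le_norm z i j) zM; rewrite ler_norml => /andP[]; lra.
have ub (z : 'M[R]_(a, b)) : `|z| <= M -> (z i j + M) / delta <= (M + M) / delta.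
  move=> zM; rewrite ler_pM2r ?invr_gt0 //.
  have := le_trans (entry_le_norm z i j) zM; rewrite ler_norml => /andP[]; lra.
have tN (z : 'M[R]_(a, b)) : `|z| <= M -> (Num.truncn ((z i j + M) / delta) < N)%N.
  by move=> zM; rewrite ltnS; apply: le_truncn; apply: ub.
have := congr1 (fun f : {ffun _ -> _} => val (f (i, j))) e.
rewrite !ffunE /= !inordK ?tN // => et.
have /andP[x1 x2] := truncn_itv (lb _ xM).
have /andP[y1 y2] := truncn_itv (lb _ yM).
rewrite et in x1 x2; rewrite !mxE.
set t := Num.truncn _ in x1 x2 y1 y2.
have hx : x i j + M = delta * ((x i j + M) / delta) by rewrite mulrC divfK // gt_eqF.
have hy : y i j + M = delta * ((y i j + M) / delta) by rewrite mulrC divfK // gt_eqF.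
move: x1 x2 y1 y2 hx hy; set X := _ / _; set Y := _ / _; rewrite -natr1 => x1 x2 y1 y2 hx hy.
have : `|X - Y| < 1 by rewrite ltr_norml; lra.
move=> XY; have -> : x i j - y i j = delta * (X - Y) by rewrite mulrBr -hx -hy; lra.
by rewrite normrM gtr0_norm // -[ltRHS]mulr1 ltr_pM2l.
Qed.

(** [K] does not depend on the sequence; this uniformity later bounds the lengths of words. *)
Lemma pigeonhole (a b : nat) (M delta : R) : 0 < delta ->
  exists K : nat, forall u : nat -> 'M[R]_(a, b),
    (forall k, (k <= K)%N -> `|u k| <= M) ->
    exists i j, [/\ (i < j)%N, (j <= K)%N & `|u j - u i| < delta].
Proof.
move=> /(@finite_cells a b M)[N [cell cellP]]; exists N => u uM.
have /injectivePn[i [j ij e]] : ~~ injectiveb (fun k : 'I_N.+1 => cell (u k)).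
  by apply/negP => /injectiveP /leq_card; rewrite !card_ord ltnn.
have near (k l : 'I_N.+1) : (k < l)%N -> cell (u k) = cell (u l) ->
    exists i j, [/\ (i < j)%N, (j <= N)%N & `|u j - u i| < delta].
  move=> kl e'; exists k, l; split => //; first by rewrite -ltnS.
  by apply: cellP => //; apply: uM; rewrite -ltnS.
by case: (ltngtP i j) => [h|h|/val_inj h];
  [apply: near h e | apply: near h (esym e) | rewrite h eqxx in ij].
Qed.

Lemma bounded_cluster (d : nat) (M : R) (u : nat -> 'cV[R]_d) :
  (forall n, `|u n| <= M) ->
  exists x, forall e : R, 0 < e -> forall N, exists2 n, (N <= n)%N & `|u n - x| < e.
Proof.
move=> uM; pose A := [set v : 'rV[R]_d | `|v| <= M].
have cA : compact A.
  apply: bounded_closed_compact.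
    by exists M; split; [exact: num_real|move=> x Mx y /= /le_trans; apply; apply: ltW].
  have -> : A = closed_ball_ (fun v : 'rV[R]_d => `|v|) 0 M.
    by apply/seteqP; split=> v; rewrite /closed_ball_ /A /= sub0r normrN.
  exact: closed_closed_ball_.
pose v n := (u n)^T.
have FA : (v @ \oo) A by exists 0%N => // n _ /=; rewrite /A /= norm_trmx.
have [p [Ap clp]] := cA (v @ \oo) _ FA.
exists p^T => e e0 N.
have h1 : (v @ \oo) [set v n | n in [set n | (N <= n)%N]].
  by exists N => // n /= Nn; exists n.
have [_ [[n /= Nn <-]]] := clp _ _ h1 (nbhsx_ballx p e e0).
rewrite -ball_normE /= /v => h; exists n => //.
by rewrite distrC -norm_trmx linearB /= trmxK.
Qed.

End MatrixNorm.

Section Words.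
Variable I : eqType.
Implicit Types u w s : seq I.

Lemma word_powerS w k : word_power w k.+1 = w ++ word_power w k.
Proof. by []. Qed.

Lemma word_powerD w a b : word_power w (a + b) = word_power w a ++ word_power w b.
Proof. by rewrite /word_power nseqD flatten_cat. Qed.

Lemma size_word_power w k : size (word_power w k) = (k * size w)%N.
Proof. by elim: k => // k IH; rewrite word_powerS size_cat IH mulSn. Qed.

Lemma nth_word_power x0 w k i : (i < k * size w)%N ->
  nth x0 (word_power w k) i = nth x0 w (i %% size w).
Proof.
elim: k i => [|k IH] i; first by rewrite mul0n.
rewrite mulSn word_powerS nth_cat; case: (ltnP i (size w)) => [iw _|wi ik].
  by rewrite modn_small.
by rewrite IH ?ltn_subLR // -{2}(subnK wi) modnDr.
Qed.

Lemma word_powerP x0 w s : (size w %| size s)%N ->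
  (forall i, (i < size s)%N -> nth x0 s i = nth x0 w (i %% size w)) ->
  s = word_power w (size s %/ size w).
Proof.
move=> /divnK sz h; apply: (@eq_from_nth _ x0); first by rewrite size_word_power sz.
by move=> i si; rewrite nth_word_power ?sz // h.
Qed.

(** The shifts that preserve the cyclic word form a subgroup of the integers mod [l], so
    [g = gcdn c l] is one of them by Bezout; [g < l] would make [w] a power of its prefix of length
    [g]. *)
Lemma primitive_period x0 w c : primitive w -> (0 < size w)%N ->
  (forall j, (j < size w)%N -> nth x0 w j = nth x0 w ((c + j) %% size w)) ->
  (size w %| c)%N.
Proof.
move=> prim w0 per; set l := size w in w0 per *.
have perk k j : (j < l)%N -> nth x0 w j = nth x0 w ((k * c + j) %% l).
  elim: k j => [|k IH] j jl; first by rewrite mul0n modn_small.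
  rewrite IH // per ?ltn_pmod // modnDmr; congr (nth x0 w (_ %% l)).
  by rewrite mulSn addnA.
case: (posnP c) => [->//|c0]; pose g := gcdn c l.
have g0 : (0 < g)%N by rewrite gcdn_gt0 c0.
have gl : (g %| l)%N by apply: dvdn_gcdr.
have perg i j : (j < l)%N -> nth x0 w j = nth x0 w ((i * g + j) %% l).
  move=> jl; case: (egcdnP l c0) => km kn e _.
  by rewrite (perk (i * km)%N j jl) -mulnA e mulnDr mulnA -addnA modnMDl.
case: (ltngtP g l) (dvdn_leq w0 gl) => // [gltl _|<- _]; last exact: dvdn_gcdl.
case: prim; exists (take g w), (l %/ g)%N; split.
  by rewrite size_take -/l gltl.
have sg : size (take g w) = g by rewrite size_take -/l gltl.
rewrite -{2}sg; apply: (@word_powerP x0); rewrite sg // => i il.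
rewrite nth_take ?ltn_pmod // (perg (i %/ g)%N (i %% g)%N).
  by rewrite -divn_eq modn_small.
by apply: leq_ltn_trans (leq_mod _ _) il.
Qed.

(** An occurrence of [w] inside a power of [w] makes its offset a shift preserving the cyclic word
    [w], so primitivity aligns it. *)
Lemma primitive_occurrence w s1 s2 p : primitive w -> w <> [::] ->
  s1 ++ w ++ s2 = word_power w p -> exists i, s1 = word_power w i.
Proof.
move=> prim /eqP; rewrite -size_eq0 -lt0n => w0 e.
have x0 : I by case: w w0 {prim e}.
 have sz := congr1 size e; rewrite !size_cat size_word_power in sz.
have dl : (size w %| size s1)%N.
  apply: (@primitive_period x0) => // j jl.
  rewrite -(@nth_word_power x0 w p) -?e; last first.
    rewrite -sz ltn_add2l; apply: leq_trans jl _; exact: leq_addr.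
  by rewrite nth_cat ltnNge leq_addr /= addKn nth_cat jl.
exists (size s1 %/ size w)%N; apply: (@word_powerP x0) => // i il.
rewrite -(@nth_word_power x0 w p) -?e; first by rewrite nth_cat il.
by rewrite -sz; apply: leq_trans il _; apply: leq_addr.
Qed.

Definition power_of w s := exists k, s = word_power w k.

(** The exponent 0 is allowed, so a word that is not of this form is nonempty, as the spectral
    bounds on its product require. *)
Definition rotated_power_of w s := exists k p, s = word_power (rot k w) p.

(* Words [w ++ s] with [s] not a power of [w]: they are closed under
   concatenation and none of them is a power of a rotation of [w]. *)
Definition deviating w s := exists s', s = w ++ s' /\ ~ power_of w s'.

(** The inner [w] is the marker: were [a' ++ w ++ b'] a power of [w], its alignment would make [a']
    one as well. *)
Lemma deviating_cat w a b : primitive w -> w <> [::] ->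
  deviating w a -> deviating w b -> deviating w (a ++ b).
Proof.
move=> prim w0 [a' [-> na]] [b' [-> nb]]; exists (a' ++ w ++ b'); split.
  by rewrite -!catA.
by move=> [k]; move/(primitive_occurrence prim w0).
Qed.

Lemma deviating_catw w a : primitive w -> w <> [::] ->
  deviating w a -> deviating w (a ++ w).
Proof.
move=> prim w0 [a' [-> na]]; exists (a' ++ w); rewrite catA; split => // -[k].
by rewrite -{1}[w]cats0 => /(primitive_occurrence prim w0).
Qed.

(** Since the word begins with [w], comparing the first [size w] letters shows that the rotation is
    [w] itself; cancelling them leaves a power of [w]. *)
Lemma deviating_not_rotated w a : w <> [::] -> deviating w a ->
  ~ rotated_power_of w a.
Proof.
move=> w0 [a' [-> na]] [k [p e]]; apply: na.
case: p e => [|p] e; first by case: w w0 e.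
have ek : rot k w = w.
  have := congr1 (take (size w)) e; rewrite word_powerS take_size_cat //.
  by rewrite take_size_cat ?size_rot.
by exists p; move/eqP: e; rewrite ek word_powerS eqseq_cat // eqxx => /eqP.
Qed.

Lemma deviating_flatten w (zs : seq (seq I)) : primitive w -> w <> [::] ->
  zs <> [::] -> (forall z, z \in zs -> deviating w z) -> deviating w (flatten zs).
Proof.
move=> prim w0; elim: zs => // z [|z' zs] IH _ h /=.
  by rewrite cats0; apply: h; rewrite inE.
apply: deviating_cat => //; first by apply: h; rewrite inE eqxx.
by apply: IH => // t tz; apply: h; rewrite inE tz orbT.
Qed.

(** With [w = uv] this is [(vu)^(p+1) = v (uv)^p u]: passing from a rotation to [w] costs one
    factor. *)
Lemma rotated_power_split w k p : exists y1 y2,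
  word_power (rot k w) p.+1 = y2 ++ word_power w p ++ y1 /\ (size y1 <= size w)%N.
Proof.
exists (take k w), (drop k w); split; last by rewrite size_take; case: ltnP => // /ltnW.
elim: p => [|p IH]; first by rewrite /word_power /= cats0.
rewrite word_powerS IH (word_powerS w) /rot -!catA.
by rewrite (catA (take k w) (drop k w)) cat_take_drop.
Qed.


End Words.

Section Dot.
Variables (R : realType) (d : nat).
Implicit Types x y u v : 'cV[R]_d.

Lemma dotC u v : dot u v = dot v u.
Proof. by apply: eq_bigr => i _; rewrite mulrC. Qed.

Lemma dotDl u v x : dot (u + v) x = dot u x + dot v x.
Proof. by rewrite -big_split; apply: eq_bigr => i _; rewrite mxE mulrDl. Qed.

Lemma dotZl (c : R) u x : dot (c *: u) x = c * dot u x.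
Proof. by rewrite mulr_sumr; apply: eq_bigr => i _; rewrite mxE mulrA. Qed.

Lemma dotDr u x y : dot u (x + y) = dot u x + dot u y.
Proof. by rewrite dotC dotDl !(dotC u). Qed.

Lemma dotZr (c : R) u x : dot u (c *: x) = c * dot u x.
Proof. by rewrite dotC dotZl dotC. Qed.

Lemma dotNl u x : dot (- u) x = - dot u x.
Proof. by rewrite -scaleN1r dotZl mulN1r. Qed.

Lemma dotNr u x : dot u (- x) = - dot u x.
Proof. by rewrite dotC dotNl dotC. Qed.

Lemma dotBl u v x : dot (u - v) x = dot u x - dot v x.
Proof. by rewrite dotDl dotNl. Qed.

Lemma dotBr u x y : dot u (x - y) = dot u x - dot u y.
Proof. by rewrite dotDr dotNr. Qed.

Lemma dot0l x : dot 0 x = 0.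
Proof. by rewrite -(scale0r (0 : 'cV[R]_d)) dotZl mul0r. Qed.

Lemma dotE u x : dot u x = (u^T *m x) ord0 ord0.
Proof. by rewrite mxE; apply: eq_bigr => i _; rewrite mxE. Qed.

Lemma dot_tr (M : 'M[R]_d) u x : dot (M^T *m u) x = dot u (M *m x).
Proof. by rewrite !dotE trmx_mul trmxK mulmxA. Qed.

Lemma dot_ge0 x : 0 <= dot x x.
Proof. by apply: sumr_ge0 => i _; rewrite -expr2 sqr_ge0. Qed.

Lemma dot_eq0 x : dot x x = 0 -> x = 0.
Proof.
move=> h; apply/matrixP => i j; rewrite mxE (ord1 j).
have /eqP : x i ord0 * x i ord0 == 0.
  move/eqP: h; rewrite psumr_eq0 => [/allP/(_ i)|k _].
    by rewrite mem_index_enum => /(_ isT).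
  by rewrite -expr2 sqr_ge0.
by move/eqP; rewrite mulf_eq0 => /orP[] /eqP.
Qed.

Lemma dot_gt0 x : x != 0 -> 0 < dot x x.
Proof.
by move=> x0; rewrite lt_def dot_ge0 andbT; apply: contraNneq x0 => /dot_eq0 ->.
Qed.

Lemma norm_dot_le u x : `|dot u x| <= d%:R * `|u| * `|x|.
Proof.
rewrite dotE; apply: le_trans (entry_le_norm _ _ _) _.
by apply: le_trans (norm_mulmx_le _ _) _; rewrite norm_trmx.
Qed.

End Dot.

Section Seminorms.
Variables (R : realType) (d : nat).
Implicit Types (x y : 'cV[R]_d) (f : 'cV[R]_d -> R).

Definition seminorm f :=
  (forall (c : R) x, f (c *: x) = `|c| * f x) /\
  (forall x y, f (x + y) <= f x + f y).

Section OneSeminorm.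
Variables (f : 'cV[R]_d -> R) (sf : seminorm f).

Lemma seminormZ (c : R) x : f (c *: x) = `|c| * f x.
Proof. by case: sf. Qed.

Lemma seminormD x y : f (x + y) <= f x + f y.
Proof. by case: sf. Qed.

Lemma seminorm0 : f 0 = 0.
Proof. by rewrite -(scale0r (0 : 'cV[R]_d)) seminormZ normr0 mul0r. Qed.

Lemma seminormN x : f (- x) = f x.
Proof. by rewrite -scaleN1r seminormZ normrN normr1 mul1r. Qed.

Lemma seminorm_ge0 x : 0 <= f x.
Proof. by have := seminormD x (- x); rewrite subrr seminorm0 seminormN; lra. Qed.

Lemma seminorm_leB x y : f x <= f y + f (x - y).
Proof. by rewrite -{1}(subrK y x) addrC; apply: seminormD. Qed.

Lemma seminorm_comp (M : 'M[R]_d) : seminorm (fun x => f (M *m x)).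
Proof.
split=> [c x|x y]; first by rewrite -scalemxAr seminormZ.
by rewrite mulmxDr seminormD.
Qed.

Lemma seminorm_scale (a : R) : 0 <= a -> seminorm (fun x => a * f x).
Proof.
move=> a0; split=> [c x|x y]; first by rewrite seminormZ mulrCA.
by rewrite -mulrDr ler_wpM2l // seminormD.
Qed.

Lemma seminorm_sum (J : Type) (r : seq J) (F : J -> 'cV[R]_d) :
  f (\sum_(j <- r) F j) <= \sum_(j <- r) f (F j).
Proof.
elim: r => [|j r IH]; first by rewrite !big_nil seminorm0.
by rewrite !big_cons; apply: le_trans (seminormD _ _) _; rewrite lerD2l.
Qed.

Lemma seminorm_bounded : exists2 C : R, 0 < C & forall x, f x <= C * `|x|.
Proof.
exists (1 + \sum_(i < d) f (delta_mx i ord0)).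
  by rewrite ltr_pwDl // sumr_ge0 // => i _; apply: seminorm_ge0.
move=> x; have e : x = \sum_(i < d) x i ord0 *: delta_mx i ord0.
  by rewrite {1}[x]matrix_sum_delta; apply: eq_bigr => i _; rewrite big_ord1.
rewrite {1}e; apply: le_trans (seminorm_sum _ _) _.
rewrite mulrDl mul1r mulr_suml ler_wpDl //; apply: ler_sum => i _.
by rewrite seminormZ mulrC ler_wpM2l ?seminorm_ge0 // entry_le_norm.
Qed.

Lemma seminorm_continuous e : 0 < e -> exists2 delta : R, 0 < delta &
  forall x y, `|x - y| <= delta -> f x <= f y + e.
Proof.
move=> e0; have [C C0 fC] := seminorm_bounded.
exists (e / C) => [|x y xy]; first by rewrite divr_gt0.
apply: le_trans (seminorm_leB x y) _; rewrite lerD2l.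
by apply: le_trans (fC _) _; rewrite mulrC -ler_pdivlMr.
Qed.

End OneSeminorm.

Lemma is_norm_seminorm f : is_norm f -> seminorm f.
Proof. by case. Qed.

(** Otherwise unit vectors on which [f] tends to 0 have a cluster point where [f] vanishes; this is
    the zero vector, at distance 1 from all of them. *)
Lemma is_norm_bounded_below f : is_norm f ->
  exists2 c : R, 0 < c & forall x, c * `|x| <= f x.
Proof.
move=> nf; have sf := is_norm_seminorm nf; case: (nf) => f0 _ _.
apply: contrapT => h.
have h1 n : exists x, `|x| = 1 /\ f x < n.+1%:R^-1.
  apply: contrapT => hn; apply: h; exists n.+1%:R^-1 => [|x]; first by rewrite invr_gt0.
  have [->|x0] := eqVneq x 0; first by rewrite normr0 mulr0 seminorm_ge0.
  have nx : 0 < `|x| by rewrite normr_gt0.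
  rewrite leNgt; apply/negP => hx; apply: hn; exists (`|x|^-1 *: x).
  rewrite normrZ normfV normr_id mulVf ?gt_eqF //; split => //.
  by rewrite (seminormZ sf) normfV normr_id mulrC ltr_pdivrMr.
case: (choice h1) => u hu.
have [|x hx] := @bounded_cluster R d 1 u; first by move=> n; case: (hu n) => ->.
have x0 : x = 0.
  apply: f0; apply/eqP; rewrite eq_le seminorm_ge0 // andbT.
  apply/ler_addgt0Pr => e e0; rewrite add0r.
  have e2 : 0 < e / 2 by rewrite divr_gt0.
  have [delta de fd] := seminorm_continuous sf e2.
  pose N := Num.truncn (e / 2)^-1.
  have [n Nn xn] := hx _ de N.
  have := fd x (u n); rewrite distrC ltW // => /(_ isT) /le_trans; apply.
  rewrite [leRHS]splitr lerD2r; apply: ltW; apply: lt_le_trans (hu n).2 _.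
  rewrite -[leRHS]invrK lef_pV2 ?posrE ?invr_gt0 //.
  have e3 : 0 <= (e / 2)^-1 by rewrite invr_ge0 ltW.
  by have /andP[_ /ltW h3] := truncn_itv e3; apply: le_trans h3 _; rewrite ler_nat.
have [n _] := hx 1 ltr01 0%N.
by rewrite x0 subr0; case: (hu n) => -> _; rewrite ltxx.
Qed.

End Seminorms.

Section ComplexNorm.
Local Open Scope complex_scope.
Variable R : realType.
Implicit Types z : R[i].

(** The norm of [R[i]] takes its values in [R[i]]; this is the modulus as a real number. *)
Definition cmod z : R := complex.Re `|z|.

Lemma cmodE z : `|z| = (cmod z)%:C.
Proof. by rewrite /cmod normc_def. Qed.

Lemma cmod_sqrt z : cmod z = Num.sqrt (complex.Re z ^+ 2 + complex.Im z ^+ 2).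
Proof. by rewrite /cmod normc_def. Qed.

Lemma cmod_ge0 z : 0 <= cmod z.
Proof. by rewrite cmod_sqrt sqrtr_ge0. Qed.

Lemma cmodM z1 z2 : cmod (z1 * z2) = cmod z1 * cmod z2.
Proof. by apply: complexI; rewrite -cmodE normrM !cmodE rmorphM. Qed.

Lemma cmodX z n : cmod (z ^+ n) = cmod z ^+ n.
Proof. by apply: complexI; rewrite -cmodE normrX cmodE rmorphXn. Qed.

Lemma cmod_real (x : R) : cmod x%:C = `|x|.
Proof. by rewrite cmod_sqrt /= expr0n addr0 sqrtr_sqr. Qed.

Lemma le_cmod z1 z2 : (`|z1| <= `|z2|) = (cmod z1 <= cmod z2).
Proof. by rewrite !cmodE lecR. Qed.

Lemma lt_cmod z1 z2 : (`|z1| < `|z2|) = (cmod z1 < cmod z2).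
Proof. by rewrite !cmodE ltcR. Qed.

Lemma cmod_eq0 z : cmod z = 0 -> z = 0.
Proof. by move=> h; apply/eqP; rewrite -normr_eq0 cmodE h. Qed.

Lemma ler_cmodD z1 z2 : cmod (z1 + z2) <= cmod z1 + cmod z2.
Proof. by rewrite -lecR rmorphD /= -!cmodE ler_normD. Qed.

Lemma cmodN z : cmod (- z) = cmod z.
Proof. by rewrite /cmod normrN. Qed.

Lemma norm_Im_le z : `|complex.Im z| <= cmod z.
Proof.
rewrite cmod_sqrt -sqrtr_sqr ler_sqrt ?lerDr ?sqr_ge0 //.
by rewrite addr_ge0 ?sqr_ge0.
Qed.

End ComplexNorm.

(** * Eigenvalues and a uniform lower bound for [M - 1] *)

Section Gap.
Local Open Scope complex_scope.
Variables (R : realType) (d : nat).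

Lemma char_poly_roots (M : 'M[R]_d) : exists r : seq R[i],
  [/\ char_poly (complexify M) = \prod_(mu <- r) ('X - mu%:P), size r = d &
  forall mu, (mu \in r) = eigenvalue (complexify M) mu].
Proof.
have [r Dr] := closed_field_poly_normal (char_poly (complexify M)).
rewrite (monicP (char_poly_monic _)) scale1r in Dr.
exists r; split=> // [|mu]; last by rewrite eigenvalue_root_char Dr root_prod_XsubC.
by have := size_char_poly (complexify M); rewrite Dr size_prod_XsubC => -[].
Qed.

Lemma eigenvalue_le_spectral_radius (M : 'M[R]_d) mu :
  eigenvalue (complexify M) mu -> cmod mu <= spectral_radius M.
Proof.
move=> emu; have [r [_ _ hr]] := char_poly_roots M.
apply: sup_upper_bound; last by exists mu.
split; first by exists (cmod mu), mu.
exists (\sum_(z <- r) cmod z) => _ [z /= ez <-]; move: ez; rewrite -hr.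
elim: (r) => // y s IH; rewrite inE big_cons => /orP[/eqP ->|/IH h].
  by rewrite lerDl sumr_ge0 // => *; apply: cmod_ge0.
by apply: le_trans h _; rewrite lerDr cmod_ge0.
Qed.

Lemma norm_det_ge (M : 'M[R]_d) (b : R) : b <= 1 ->
  (forall mu, eigenvalue (complexify M) mu -> cmod mu <= b) ->
  (1 - b) ^+ d <= `|\det (1%:M - M)|.
Proof.
move=> b1 hM; have [r [Dr sr hr]] := char_poly_roots M.
have e : (\det (1%:M - M))%:C = \prod_(mu <- r) (1 - mu).
  have -> : \prod_(mu <- r) (1 - mu) = (char_poly (complexify M)).[1].
    by rewrite Dr horner_prod; apply: eq_bigr => mu _; rewrite hornerXsubC.
  rewrite -[1 in RHS](rmorph1 (real_complex R)).
  rewrite -[char_poly _]map_char_poly horner_map /=; congr (_%:C).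
  rewrite /char_poly -horner_evalE -det_map_mx; congr (\det _).
  apply/matrixP => i j; rewrite !mxE /= horner_evalE !(hornerE, hornerMn).
  by case: (i == j); rewrite ?mulr1n ?mulr0n ?hornerE.
rewrite -cmod_real e; have {hr} hr mu : mu \in r -> 1 - b <= cmod (1 - mu).
  rewrite hr => /hM mub; have := ler_cmodD (1 - mu) mu.
  by rewrite subrK -(rmorph1 (real_complex R)) cmod_real normr1; lra.
clear e Dr hM; rewrite -sr; elim: r hr {sr} => [|mu r IH] hr.
  by rewrite big_nil expr0 -(rmorph1 (real_complex R)) cmod_real normr1.
rewrite big_cons /= exprS cmodM ler_pM ?exprn_ge0 ?subr_ge0 //.
  by rewrite hr // inE eqxx.
by apply: IH => z zr; rewrite hr // inE zr orbT.
Qed.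

Lemma det_bounded n (b : R) : 0 <= b ->
  exists B, forall N : 'M[R]_n, (forall i j, `|N i j| <= b) -> `|\det N| <= B.
Proof.
move=> b0; exists (\sum_(s : {perm 'I_n}) b ^+ n) => N hN.
apply: le_trans (ler_norm_sum _ _ _) _; apply: ler_sum => s _.
rewrite normrM normrX normrN1 expr1n mul1r normr_prod.
rewrite -[X in b ^+ X](card_ord n) -prodr_const.
by apply: ler_prod => i _; rewrite normr_ge0 hN.
Qed.

(* The adjugate bounds the inverse of [1 - M], since [\det (1 - M)] is the
   product of the [1 - mu] over the eigenvalues [mu] of [M]. *)
Lemma gap (C b : R) : b < 1 -> exists2 gamma : R, 0 < gamma &
  forall M : 'M[R]_d, `|M| <= C ->
    (forall mu, eigenvalue (complexify M) mu -> cmod mu <= b) ->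
    forall x : 'cV[R]_d, gamma * `|x| <= `|M *m x - x|.
Proof.
move=> b1; have C0 : 0 <= 1 + `|C| by rewrite addr_ge0.
have [B hB] := @det_bounded d.-1 (1 + `|C|) C0.
(* The adjugate has entries at most [|B|], hence multiplies norms by at most [d * |B|]; the added 1
   keeps the constant positive. *)
pose B' := d%:R * `|B| + 1.
have B'0 : 0 < B' by rewrite ltr_wpDl // mulr_ge0.
exists ((1 - b) ^+ d / B'); first by rewrite divr_gt0 ?exprn_gt0 ?subr_gt0.
move=> M MC hM x; set N := 1%:M - M.
have -> : `|M *m x - x| = `|N *m x| by rewrite mulmxBl mul1mx distrC.
have adjN : `|\adj N| <= `|B|.
  apply: norm_le_entries => // i j; rewrite mxE /cofactor normrM normrX normrN1.
  rewrite expr1n mul1r; apply: le_trans (hB _ _) (ler_norm _) => k l.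
  rewrite !mxE; apply: le_trans (ler_normB _ _) _; apply: lerD.
    by case: (_ == _); rewrite ?normr1 ?normr0.
  by apply: le_trans (entry_le_norm _ _ _) (le_trans MC (ler_norm _)).
have h1 : (1 - b) ^+ d * `|x| <= `|\adj N *m (N *m x)|.
  rewrite mulmxA mul_adj_mx mul_scalar_mx normrZ ler_wpM2r //.
  by apply: norm_det_ge => //; apply: ltW.
rewrite mulrAC ler_pdivrMr //; apply: le_trans h1 _.
apply: le_trans (norm_mulmx_le _ _) _; rewrite [leRHS]mulrC ler_wpM2r //.
by rewrite /B' -[leLHS]addr0 lerD // ler_wpM2l.
Qed.

Lemma eigenvalue_scale (c : R) (M : 'M[R]_d) mu : c != 0 ->
  eigenvalue (complexify (c *: M)) mu -> eigenvalue (complexify M) (mu / c%:C).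
Proof.
move=> c0 /eigenvalueP[v hv v0]; apply/eigenvalueP; exists v => //.
have cC : c%:C != 0 :> R[i] by rewrite fmorph_eq0.
move: hv; rewrite /complexify map_mxZ /= -scalemxAr => h.
by rewrite mulrC -scalerA -h scalerA mulVf // scale1r.
Qed.

End Gap.

Section Subspace.
Variables (R : realType) (d : nat).

(** Among the subspaces contained in [S] take one of largest dimension: adjoining another vector of
    [S] cannot enlarge it. This makes irreducibility applicable to subspaces given as predicates. *)
Lemma vspace_of_pred (S : 'cV[R]_d -> Prop) : S 0 ->
  (forall (c : R) x y, S x -> S y -> S (c *: x + y)) ->
  exists V : {vspace 'cV[R]_d}, forall x, x \in V <-> S x.
Proof.
move=> S0 SD; pose ok n := exists V : {vspace 'cV[R]_d},
  (\dim V = n) /\ forall x, x \in V -> S x.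
have ex : exists n, `[< ok n >].
  exists 0%N; apply/asboolP; exists 0%VS; split; first exact: dimv0.
  by move=> x; rewrite memv0 => /eqP ->.
have ub n : `[< ok n >] -> (n <= \dim {:'cV[R]_d})%N.
  by move=> /asboolP[V [<- _]]; apply: dimvS; apply: subvf.
case: (ex_maxnP ex ub) => n /asboolP[V [dV VS]] nmax.
exists V => x; split=> [/VS//|Sx].
have : `[< ok (\dim (V + <[x]>)%VS) >].
  apply/asboolP; exists (V + <[x]>)%VS; split => // y /memv_addP[v /VS Sv [z]].
  by move=> /vlineP[k ->] ->; rewrite addrC; apply: SD.
move=> /nmax; rewrite -dV => h.
have /eqP -> : V == (V + <[x]>)%VS by rewrite eqEdim addvSl.
by apply: (subvP (addvSr V <[x]>%VS)); apply: memv_line.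
Qed.

End Subspace.

Section Products.
Variables (R : realType) (d m : nat).
Implicit Types (A : 'I_m -> 'M[R]_d) (s : seq 'I_m) (x y : 'cV[R]_d).

Lemma product_nil A : product A [::] = 1%:M.
Proof. by rewrite /product big_nil. Qed.

Lemma product_cons A i s : product A (i :: s) = A i *m product A s.
Proof. by rewrite /product big_cons. Qed.

Lemma product_cat A s t : product A (s ++ t) = product A s *m product A t.
Proof. by rewrite /product big_cat. Qed.

Lemma product_seq1 A i : product A [:: i] = A i.
Proof. by rewrite product_cons product_nil mulmx1. Qed.

Lemma product_scale A (c : R) s :
  product (fun i => c *: A i) s = c ^+ size s *: product A s.
Proof.
elim: s => [|i s IH]; first by rewrite !product_nil scale1r.
by rewrite !product_cons IH -scalemxAl -scalemxAr scalerA exprS.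
Qed.

Lemma product_power A w k : product A (word_power w k) = product A w ^+ k.
Proof.
elim: k => [|k IH]; first by rewrite product_nil.
by rewrite word_powerS product_cat IH exprS.
Qed.

Lemma product_transpose A s : product (transpose_family A) s = (product A (rev s))^T.
Proof.
elim: s => [|i s IH]; first by rewrite !product_nil trmx1.
by rewrite product_cons IH rev_cons -cats1 product_cat product_seq1 trmx_mul.
Qed.

Definition bounded_products A (C : R) :=
  forall s x, `|product A s *m x| <= C * `|x|.

(* Pigeonhole on the images of [x] under the suffixes of [zs]: if [x] is not
   contracted, some block of [zs] almost fixes a vector of its trajectory. *)
Lemma recurrence A (C c gamma : R) : bounded_products A C -> 0 < c -> 0 < gamma ->
  exists K : nat, forall (zs : seq (seq 'I_m)) x, (K <= size zs)%N -> x != 0 ->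
    c * `|x| <= `|product A (flatten zs) *m x| ->
    exists zs1 zs2 zs3, [/\ zs = zs3 ++ zs2 ++ zs1, zs2 <> [::] &
      let y := product A (flatten zs1) *m x in
      y != 0 /\ `|product A (flatten zs2) *m y - y| < gamma * `|y|].
Proof.
move=> bA c0 g0; pose C' : R := 1 + `|C|.
have C'0 : 0 < C' by rewrite ltr_pwDl.
have bA' s x : `|product A s *m x| <= C' * `|x|.
  apply: le_trans (bA s x) _; rewrite ler_wpM2r // /C'.
  by have := ler_norm C; lra.
have delta0 : 0 < gamma * (c / C') by rewrite mulr_gt0 ?divr_gt0.
have [K hK] := @pigeonhole R d 1 C' _ delta0.
exists K => zs x Kzs x0 hx.
have nx : 0 < `|x| by rewrite normr_gt0.
(* The rightmost factor acts first, so the trajectory after [k] blocks comes from the last [k]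
   blocks of [zs]. *)
pose suff k := drop (size zs - k) zs.
pose u k := `|x|^-1 *: (product A (flatten (suff k)) *m x).
have [i [j [ij jK uij]]] : exists i j, [/\ (i < j)%N, (j <= K)%N &
    `|u j - u i| < gamma * (c / C')].
  apply: hK => k _; rewrite /u normrZ normfV normr_id mulrC ler_pdivrMr //.
have jz := leq_trans jK Kzs.
have suffE : suff j = take (j - i) (suff j) ++ suff i.
  rewrite -{1}(cat_take_drop (j - i) (suff j)) /suff drop_drop.
  by congr (_ ++ drop _ _); lia.
exists (suff i), (take (j - i) (suff j)), (take (size zs - j) zs); split.
- by rewrite -suffE /suff cat_take_drop.
- move=> /(congr1 size); rewrite size_take size_drop subKn //=.
  by case: ltnP; lia.
set y := product A (flatten (suff i)) *m x => /=.
(* The remaining blocks map [y] to a vector of norm at least [c * |x|] and expand it at most by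
   [C']. This turns an error relative to [|x|] into one relative to [|y|]. *)
have hy : (c / C') * `|x| <= `|y|.
  rewrite mulrAC ler_pdivrMr // [leRHS]mulrC; apply: le_trans hx _; rewrite ?mulrA.
  rewrite -{1}(cat_take_drop (size zs - i) zs) flatten_cat product_cat -mulmxA.
  exact: bA'.
have y0 : 0 < `|y| by apply: lt_le_trans hy; rewrite mulr_gt0 ?divr_gt0.
split; first by rewrite -normr_gt0.
have e : product A (flatten (take (j - i) (suff j))) *m y - y = `|x| *: (u j - u i).
  rewrite /u -scalerBr scalerA mulfV ?gt_eqF // scale1r.
  by rewrite [in RHS]suffE flatten_cat product_cat -mulmxA.
rewrite e normrZ normr_id; apply: (@lt_le_trans _ _ (`|x| * (gamma * (c / C')))).
  by rewrite ltr_pM2l.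
by rewrite mulrCA ler_pM2l // mulrC.
Qed.

(** The kernel of [f] is a common invariant subspace. *)
Lemma irreducible_seminorm A f : irreducible_family A -> seminorm f ->
  (forall i x, f x = 0 -> f (A i *m x) = 0) -> (exists x, f x <> 0) -> is_norm f.
Proof.
move=> irr sf inv [x0 fx0].
have [||V hV] := @vspace_of_pred R d (fun x => f x = 0).
- exact: seminorm0.
- move=> c x y fx fy; apply/eqP; rewrite eq_le seminorm_ge0 // andbT.
  by apply: le_trans (seminormD sf _ _) _; rewrite seminormZ // fx fy mulr0 addr0.
have [|V0|V1] := irr V.
- by move=> i x /hV /(inv i) /hV.
- split; [|by case: sf..].
  by move=> x /hV; rewrite V0 memv0 => /eqP.
- by exfalso; apply: fx0; apply/hV; rewrite V1 memvf.
Qed.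

End Products.

(** * Boundedness of the normalised products *)

Section RealPowers.
Variable R : realType.

Lemma bernoulli_le (h : R) n : -1 <= h -> 1 + n%:R * h <= (1 + h) ^+ n.
Proof.
move=> h1; elim: n => [|n IH]; first by rewrite mul0r addr0 expr0.
have p : 0 <= 1 + h by lra.
rewrite exprS; apply: le_trans (ler_wpM2l p IH).
have : 0 <= n%:R * (h * h) by rewrite mulr_ge0 // -expr2 sqr_ge0.
rewrite -natr1; nra.
Qed.

Lemma root_near1 (a : R) n : a < 1 -> exists tau : R, [/\ 0 < tau, tau < 1 & a <= tau ^+ n].
Proof.
wlog a0 : a / 0 <= a.
  move=> H a1; case: (leP 0 a) => [a0|a0]; first exact: H.
  have [//||tau [t0 t1 ht]] := H 0; first exact: ltr01.
  by exists tau; split=> //; apply: le_trans (ltW a0) ht.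
(* Dividing by [n + 2] gives both [h < 1] and [n h <= 1 - a]; Bernoulli's inequality then yields
   [a <= (1 - h)^n]. *)
move=> a1; pose h := (1 - a) / n.+2%:R.
have n0 : 0 < n.+2%:R :> R by rewrite ltr0n.
have h0 : 0 < h by rewrite divr_gt0 // subr_gt0.
have nh : n.+2%:R * h = 1 - a by rewrite mulrC divfK // gt_eqF.
have h1 : h < 1.
  have : 2 * h <= n.+2%:R * h by rewrite ler_wpM2r ?(ltW h0) // ler_nat.
  by lra.
exists (1 - h); split; [lra|lra|].
have := @bernoulli_le (- h) n; have : n%:R * h <= n.+2%:R * h.
  by rewrite ler_wpM2r ?(ltW h0) // ler_nat; lia.
rewrite nh mulrN => *; lra.
Qed.

Lemma geometric_unbounded (a C : R) : 1 < a -> exists n, C < a ^+ n.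
Proof.
move=> a1; pose h := a - 1; have h0 : 0 < h by rewrite subr_gt0.
exists (Num.truncn (`|C| / h)).+1.
have := @bernoulli_le h (Num.truncn (`|C| / h)).+1.
have -> : 1 + h = a by rewrite /h; lra.
have c0 : 0 <= `|C| / h by rewrite divr_ge0 // ltW.
have /andP[_] := truncn_itv c0; rewrite ltr_pdivrMr //.
by have := ler_norm C; set n := _.+1%:R; lra.
Qed.

Lemma geometric_small (a e : R) : 0 < a -> a < 1 -> 0 < e -> exists n, a ^+ n < e.
Proof.
move=> a0 a1 e0; have [|n hn] := @geometric_unbounded a^-1 e^-1.
  by rewrite invf_gt1.
exists n; move: hn; rewrite exprVn ltf_pV2 ?posrE ?exprn_gt0 //.
Qed.

Lemma le_of_tail (a b c : R) : 0 <= c ->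
  (forall e, 0 < e -> a <= b + c * e) -> a <= b.
Proof.
move=> c0 h; apply/ler_addgt0Pr => e e0.
have := h (e / (c + 1)); rewrite divr_gt0 ?ltr_wpDl // => /(_ isT) /le_trans; apply.
rewrite lerD2l mulrA ler_pdivrMr ?ltr_wpDl // mulrC ler_pM2l //; lra.
Qed.

End RealPowers.

Section Boundedness.
Variables (R : realType) (d m : nat) (A : 'I_m -> 'M[R]_d).
Implicit Types (s : seq 'I_m) (x : 'cV[R]_d) (theta : R).

(** The infimum of the positive tempered rates is the joint spectral radius, here approached without
    taking a limit. *)
Definition tempered theta := exists C : R, forall s x,
  `|product A s *m x| <= C * theta ^+ size s * `|x|.

Lemma tempered_mono theta theta' : 0 < theta -> theta <= theta' ->
  tempered theta -> tempered theta'.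
Proof.
move=> t0 tt' [C hC]; exists `|C| => s x; apply: le_trans (hC s x) _.
rewrite ler_wpM2r //; apply: (@le_trans _ _ (`|C| * theta ^+ size s)).
  by rewrite ler_wpM2r ?exprn_ge0 ?ler_norm // ltW.
by rewrite ler_wpM2l // lerXn2r // nnegrE ltW // (lt_le_trans t0).
Qed.

Lemma tempered_large : exists2 theta : R, 0 < theta & tempered theta.
Proof.
pose t : R := 1 + \sum_(i < m) d%:R * `|A i|.
have t0 : 0 < t by rewrite ltr_pwDl // sumr_ge0 // => i _; rewrite mulr_ge0.
exists t => //; exists 1; elim=> [|i s IH] x.
  by rewrite product_nil mul1mx expr0 !mul1r.
rewrite product_cons -mulmxA; apply: le_trans (norm_mulmx_le _ _) _.
apply: (@le_trans _ _ (t * `|product A s *m x|)).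
  rewrite ler_wpM2r // /t (bigD1 i) //= addrCA lerDl addr_ge0 //.
  by rewrite sumr_ge0 // => j _; rewrite mulr_ge0.
by rewrite exprS mul1r -mulrA ler_pM2l // -[_ ^+ _]mul1r.
Qed.

(* The vectors whose orbit grows at most like [theta ^+ n] form an invariant
   subspace, here trivial; by compactness every orbit then outgrows
   [2 * theta ^+ n] within a bounded number of steps. *)
Lemma not_tempered_open theta : irreducible_family A -> 0 < theta ->
  ~ tempered theta -> exists2 theta', theta < theta' & ~ tempered theta'.
Proof.
move=> irr t0 nt.
have tX n : 0 < theta ^+ n by apply: exprn_gt0.
pose S x := exists C : R, forall s, `|product A s *m x| <= C * theta ^+ size s.
have S_trivial x : S x -> x = 0.
  have [||V hV] := @vspace_of_pred R d S.
  - by exists 0 => s; rewrite mulmx0 normr0 mul0r.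
  - move=> c y z [C hC] [C' hC']; exists (`|c| * C + C') => s.
    rewrite mulmxDr -scalemxAr mulrDl; apply: le_trans (ler_normD _ _) _.
    by rewrite lerD // normrZ -mulrA ler_wpM2l.
  have [|V0|V1] := irr V.
  - move=> i y /hV[C hC]; apply/hV; exists (C * theta) => s.
    have := hC (s ++ [:: i]); rewrite product_cat product_seq1 -mulmxA size_cat.
    by rewrite addn1 exprS mulrA.
  - by move=> /hV; rewrite V0 memv0 => /eqP.
  case: nt; have hS y : S y by apply/hV; rewrite V1 memvf.
  have [C hC] := choice (fun i : 'I_d => hS (delta_mx i ord0)).
  exists (\sum_(i < d) C i) => s y.
  have e : y = \sum_(i < d) y i ord0 *: delta_mx i ord0.
    by rewrite {1}[y]matrix_sum_delta; apply: eq_bigr => i _; rewrite big_ord1.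
  rewrite {1}e mulmx_sumr; apply: le_trans (ler_norm_sum _ _ _) _.
  rewrite -mulrA mulr_suml; apply: ler_sum => i _.
  by rewrite -scalemxAr normrZ mulrA [leRHS]mulrC ler_pM // entry_le_norm.
have [N hN] : exists N : nat, forall x, exists s, (size s <= N)%N /\
    2 * theta ^+ size s * `|x| <= `|product A s *m x|.
  apply: contrapT => hN.
  have h1 n : exists x, `|x| = 1 /\ forall s, (size s <= n)%N ->
      `|product A s *m x| <= 2 * theta ^+ size s.
    apply: contrapT => hn; apply: hN; exists n => x.
    have [->|x0] := eqVneq x 0.
      by exists [::]; rewrite mulmx0 normr0 mulr0.
    apply: contrapT => hx; apply: hn.
    have nx : 0 < `|x| by rewrite normr_gt0.
    exists (`|x|^-1 *: x); rewrite normrZ normfV normr_id mulVf ?gt_eqF //.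
    split=> // s sn; rewrite -scalemxAr normrZ normfV normr_id mulrC.
    rewrite ler_pdivrMr // leNgt; apply/negP => hs; apply: hx.
    by exists s; split=> //; apply: ltW.
  case: (choice h1) => u hu.
  have [|x hx] := @bounded_cluster R d 1 u; first by move=> n; case: (hu n) => ->.
  have /S_trivial x0 : S x.
    exists 2 => s; apply: (@le_of_tail _ _ _ (d%:R * `|product A s|)).
      by rewrite mulr_ge0.
    move=> e e0; have [n sn xn] := hx e e0 (size s).
    rewrite -[x](subrK (u n)) addrC mulmxDr; apply: le_trans (ler_normD _ _) _.
    apply: lerD; first by case: (hu n) => _; apply.
    apply: le_trans (norm_mulmx_le _ _) _; rewrite ler_wpM2l ?mulr_ge0 //.
    by rewrite distrC ltW.
  have [n _] := hx 1 ltr01 0%N.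
  by rewrite x0 subr0; case: (hu n) => -> _; rewrite ltxx.
(* As [tau ^+ N >= 2 / 3], a gain of 2 over [theta] within [N] steps is still a gain of 4/3 over the
   larger rate [theta / tau]; iterating it contradicts temperedness at that rate. *)
have [|tau [tau0 tau1 htau]] := @root_near1 R (2 / 3) N; first lra.
exists (theta / tau); first by rewrite ltr_pdivlMr // gtr_pMr.
move=> [C hC]; set t := theta / tau in hC.
have tt : 0 < t by rewrite divr_gt0.
have tE : theta = tau * t by rewrite mulrC divfK // gt_eqF.
clearbody t.
have grow k x : exists s, (4 / 3) ^+ k * t ^+ size s * `|x| <= `|product A s *m x|.
  elim: k x => [|k IH] x.
    by exists [::]; rewrite product_nil mul1mx !expr0 !mul1r.
  have [s hs] := IH x; have [s' [s'N hs']] := hN (product A s *m x).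
  exists (s' ++ s); rewrite product_cat -mulmxA; apply: le_trans hs'.
  rewrite size_cat exprD exprS.
  have h4 : 4 / 3 * t ^+ size s' <= 2 * theta ^+ size s'.
    rewrite tE exprMn mulrA ler_wpM2r ?exprn_ge0 ?(ltW tt) //.
    have : 2 / 3 <= tau ^+ size s'; last lra.
    apply: le_trans htau _; apply: ler_wiXn2l => //; exact: ltW.
  have -> : 4 / 3 * (4 / 3) ^+ k * (t ^+ size s' * t ^+ size s) * `|x| =
    (4 / 3 * t ^+ size s') * ((4 / 3) ^+ k * t ^+ size s * `|x|) by ring.
  by apply: ler_pM => //; rewrite !mulr_ge0 ?exprn_ge0 ?(ltW tt) //; lra.
have [x x0] : exists x : 'cV[R]_d, x != 0.
  apply: contrapT => hx; apply: nt; exists 0 => s x.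
  have [->|x0] := eqVneq x 0; first by rewrite mulmx0 normr0 mulr0.
  by case: hx; exists x.
have [|k hk] := @geometric_unbounded R (4 / 3) C; first lra.
have [s hs] := grow k x; have := le_trans hs (hC s x).
rewrite ler_pM2r ?normr_gt0 // ler_pM2r ?exprn_gt0 //.
by rewrite leNgt hk.
Qed.

End Boundedness.

Section NormalisedBound.
Variables (R : realType) (d m : nat).
Implicit Types (A : 'I_m -> 'M[R]_d) (s : seq 'I_m) (x : 'cV[R]_d).

Lemma col_delta_mx (M : 'M[R]_d) j : M *m delta_mx j ord0 = col j M.
Proof.
apply/matrixP => i k; rewrite !mxE (bigD1 j) //= !mxE !eqxx (ord1 k) mulr1.
by rewrite big1 ?addr0 // => l lj; rewrite !mxE (negbTE lj) mulr0.
Qed.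

Lemma norm_le_op (M : 'M[R]_d) (C : R) : 0 <= C ->
  (forall x : 'cV[R]_d, `|M *m x| <= C * `|x|) -> `|M| <= C.
Proof.
move=> C0 hM; apply: norm_le_entries => // i j.
have -> : M i j = (M *m delta_mx j ord0) i (ord0 : 'I_1) by rewrite col_delta_mx mxE.
apply: le_trans (entry_le_norm _ _ _) _; apply: le_trans (hM _) _.
rewrite -[leRHS]mulr1 ler_wpM2l //; apply: norm_le_entries => // k l.
by rewrite mxE; case: (_ && _); rewrite ?normr1 ?normr0.
Qed.

Lemma bounded_products_pos A C : bounded_products A C ->
  exists2 C', 0 < C' & bounded_products A C'.
Proof.
move=> hC; exists (`|C| + 1); first by rewrite ltr_wpDl.
move=> s x; apply: le_trans (hC s x) _; rewrite ler_wpM2r //.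
by have := ler_norm C; lra.
Qed.

Lemma tempered_bounded A theta : 0 < theta -> tempered A theta ->
  exists C, bounded_products (fun i => theta^-1 *: A i) C.
Proof.
move=> t0 [C hC]; exists C => s x; rewrite product_scale -scalemxAl normrZ.
rewrite normrX gtr0_norm ?invr_gt0 // exprVn mulrC ler_pdivrMr ?exprn_gt0 //.
by apply: le_trans (hC s x) _; rewrite mulrAC.
Qed.

(** The infimum of the tempered rates is attained: were it not tempered, neither would be some
    larger rate, although tempered rates come arbitrarily close to the infimum. *)
Lemma tempered_least A : irreducible_family A -> forall q : R, 0 < q -> ~ tempered A q ->
  exists rho : R, [/\ q < rho, tempered A rho &
    forall theta, 0 < theta -> tempered A theta -> rho <= theta].
Proof.
move=> irr q q0 nq; pose T := [set theta : R | 0 < theta /\ tempered A theta].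
have Tq theta : T theta -> q < theta.
  move=> [t0 ht]; rewrite ltNge; apply/negP => tq; apply: nq.
  exact: tempered_mono tq ht.
have [t0 t00 ht0] := tempered_large A.
have hi : has_inf T by split; [exists t0|exists q => t /Tq /ltW].
have qr : q <= inf T by apply: lb_le_inf => [|t /Tq /ltW //]; exists t0.
have least theta : 0 < theta -> tempered A theta -> inf T <= theta.
  by move=> p ht; apply: ge_inf; [case: hi|].
have tr : tempered A (inf T).
  apply: contrapT => nt; have [|t tgt nt'] := not_tempered_open irr _ nt.
    exact: lt_le_trans qr.
  have [|u [u0 hu] ut] := @inf_adherent _ T (t - inf T) _ hi; first by rewrite subr_gt0.
  apply: nt'; apply: tempered_mono u0 _ hu; rewrite addrC subrK in ut; exact: ltW.
exists (inf T); split=> //; rewrite lt_neqAle qr andbT.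
by apply/eqP => e; apply: nq; rewrite e.
Qed.

Lemma decay_tempered A C n : 0 < C -> bounded_products A C -> (0 < n)%N ->
  (forall s x, size s = n -> `|product A s *m x| <= 2^-1 * `|x|) ->
  exists tau, [/\ 0 < tau, tau < 1 & tempered A tau].
Proof.
move=> C0 bA n0 hn.
have [|tau [tau0 tau1 htau]] := @root_near1 R 2^-1 n; first lra.
(* Dividing by [tau ^+ n] pays for the incomplete block of fewer than [n] letters. *)
exists tau; split=> //; exists (C / tau ^+ n) => s x.
have H k t : (k * n <= size t)%N -> `|product A t *m x| <= C * (tau ^+ n) ^+ k * `|x|.
  elim: k t => [|k IH] t; first by rewrite expr0 mulr1.
  rewrite mulSn => kt; rewrite -{1}(cat_take_drop n t) product_cat -mulmxA.
  have nt : (n <= size t)%N by apply: leq_trans kt; apply: leq_addr.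
  have st : size (take n t) = n by rewrite size_takel.
  apply: le_trans (hn _ _ st) _; rewrite exprS mulrCA -mulrA ler_pM ?invr_ge0 //.
  by apply: IH; rewrite size_drop leq_subRL.
apply: le_trans (H (size s %/ n)%N s (leq_trunc_div _ _)) _.
rewrite ler_wpM2r // -!mulrA ler_pM2l // mulrC -exprM.
rewrite ler_pdivlMr ?exprn_gt0 // -exprD ler_wiXn2l ?ltW // addnC -mulnS mulnC.
by apply: ltnW; apply: ltn_ceil.
Qed.

(* Were the least tempered rate [rho] larger than [q], the products normalised
   by [rho] would be bounded with spectra in a disc of radius [q / rho < 1]; the
   gap forbids recurrence, so they would decay, contradicting minimality. *)
Theorem normalised_bounded A q : 0 < q -> irreducible_family A ->
  (forall s mu, s <> [::] -> eigenvalue (complexify (product A s)) mu ->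
     cmod mu <= q ^+ size s) ->
  exists C, bounded_products (fun i => q^-1 *: A i) C.
Proof.
move=> q0 irr hev; apply: tempered_bounded => //; apply: contrapT => nq.
have [rho [qr tr least]] := tempered_least irr q0 nq.
have r0 : 0 < rho by apply: lt_trans qr.
pose A' i := rho^-1 *: A i.
have [_ /bounded_products_pos [C C0 bA']] := tempered_bounded r0 tr.
have b1 : q / rho < 1 by rewrite ltr_pdivrMr // mul1r.
have b0 : 0 <= q / rho by rewrite divr_ge0 ?ltW.
have [gamma g0 hg] := @gap R d C (q / rho) b1.
have gA s x : s <> [::] -> gamma * `|x| <= `|product A' s *m x - x|.
  move=> s0; apply: hg; first by apply: norm_le_op (ltW C0) _ => y; apply: bA'.
  move=> mu; rewrite product_scale => /eigenvalue_scale.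
  rewrite expf_neq0 ?invr_eq0 ?gt_eqF // => /(_ isT) /(hev _ _ s0).
  rewrite exprVn fmorphV invrK cmodM cmod_real gtr0_norm ?exprn_gt0 //.
  rewrite -ler_pdivlMr ?exprn_gt0 // -expr_div_n => /le_trans; apply.
  case: s s0 => // i s _ /=; rewrite exprS -[leRHS]mulr1 ler_wpM2l //.
  by rewrite exprn_ile1 // ltW.
have [|K hK] := recurrence bA' (_ : 0 < 2^-1) g0; first lra.
have half s x : size s = K.+1 -> `|product A' s *m x| <= 2^-1 * `|x|.
  move=> sK; have [->|x0] := eqVneq x 0; first by rewrite mulmx0 normr0 mulr0.
  rewrite leNgt; apply/negP => /ltW hx.
  (* Blocks are single letters: the spectral bound holds for every nonempty word, so any recurring
     run of letters is contradictory. *)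
  pose zs := [seq [:: i] | i <- s].
  have zsE : flatten zs = s by rewrite /zs flatten_seq1.
  have [||zs1 [zs2 [zs3 [e z2 [y0]]]]] := hK zs x _ x0.
  - by rewrite size_map sK.
  - by rewrite zsE.
  rewrite ltNge gA // => f2; case: zs2 z2 f2 e => // z zs2 _ /= f2 e.
  have : z \in zs by rewrite e mem_cat inE eqxx orbT.
  by move=> /mapP[i _ zi]; rewrite zi in f2.
have [tau [tau0 tau1 [D hD]]] := decay_tempered C0 bA' (ltn0Sn K) half.
have : rho <= rho * tau.
  apply: least; first by rewrite mulr_gt0.
  exists D => s x; have := hD s x; rewrite product_scale -scalemxAl normrZ.
  rewrite normrX gtr0_norm ?invr_gt0 // exprVn mulrC ler_pdivrMr ?exprn_gt0 //.
  move=> h; apply: le_trans h _; rewrite exprMn le_eqVlt; apply/orP; left.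
  by apply/eqP; ring.
by rewrite leNgt gtr_pMr // tau1.
Qed.

End NormalisedBound.

(** * Invariant norms of a normalised family *)

Section Suprema.
Variables (R : realType) (d : nat) (J : Type) (D : set J).
Variables (F : J -> 'cV[R]_d -> R) (B : R).
Hypotheses (D0 : D !=set0) (sF : forall j, D j -> seminorm (F j)).
Hypothesis FB : forall j x, D j -> F j x <= B * `|x|.

Definition sup_fun x := sup [set F j x | j in D].

Lemma sup_fun_ub j x : D j -> F j x <= sup_fun x.
Proof.
move=> Dj; apply: sup_upper_bound; last by exists j.
split; first by exists (F j x), j.
by exists (B * `|x|) => _ [k Dk <-]; apply: FB.
Qed.

Lemma sup_fun_le x b : (forall j, D j -> F j x <= b) -> sup_fun x <= b.
Proof.
move=> h; apply: ge_sup; last by move=> _ [j Dj <-]; apply: h.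
by have [j Dj] := D0; exists (F j x), j.
Qed.

Lemma seminorm_sup_fun : seminorm sup_fun.
Proof.
have Zle (c : R) x : sup_fun (c *: x) <= `|c| * sup_fun x.
  apply: sup_fun_le => j Dj; rewrite (seminormZ (sF Dj)) ler_wpM2l //.
  exact: sup_fun_ub.
split=> [c x|x y].
  apply/eqP; rewrite eq_le Zle /=; have [->|c0] := eqVneq c 0.
    rewrite normr0 mul0r; have [j Dj] := D0; apply: le_trans (sup_fun_ub _ Dj).
    by apply: seminorm_ge0; apply: sF.
  rewrite -ler_pdivlMl ?normr_gt0 // -normfV.
  by rewrite -{1}[x](scalerK c0); apply: Zle.
apply: sup_fun_le => j Dj; apply: le_trans (seminormD (sF Dj) _ _) _.
by apply: lerD; apply: sup_fun_ub.
Qed.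

End Suprema.

Section FiniteMax.
Variables (R : realType) (d : nat) (psi : 'cV[R]_d -> R) (spsi : seminorm psi).
Implicit Types (Ms : seq 'M[R]_d) (x : 'cV[R]_d).

Definition max_comp Ms x := \big[Num.max/0]_(M <- Ms) psi (M *m x).

Lemma max_comp_le Ms x b : 0 <= b -> (forall M, M \in Ms -> psi (M *m x) <= b) ->
  max_comp Ms x <= b.
Proof.
move=> b0 h; rewrite /max_comp big_seq; elim/big_ind: _ => // y z hy hz.
by rewrite ge_max hy hz.
Qed.

Lemma le_max_comp Ms x M : M \in Ms -> psi (M *m x) <= max_comp Ms x.
Proof.
rewrite /max_comp; elim: Ms => // N Ms IH; rewrite inE big_cons le_max => /orP[/eqP ->|/IH ->].
  by rewrite lexx.
by rewrite orbT.
Qed.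

Lemma max_comp_ge0 Ms x : 0 <= max_comp Ms x.
Proof.
by rewrite /max_comp; elim/big_ind: _ => // [y z hy hz|M _];
  [rewrite le_max hy|apply: seminorm_ge0].
Qed.

Lemma seminorm_max_comp Ms : seminorm (max_comp Ms).
Proof.
split=> [c x|x y].
  rewrite /max_comp; elim: Ms => [|M Ms IH]; first by rewrite !big_nil mulr0.
  by rewrite !big_cons IH maxr_pMr // -scalemxAr (seminormZ spsi).
apply: max_comp_le => [|M hM]; first by rewrite addr_ge0 // max_comp_ge0.
rewrite mulmxDr; apply: le_trans (seminormD spsi _ _) _.
by apply: lerD; apply: le_max_comp.
Qed.

End FiniteMax.

Section BigMax.
Variables (R : realType) (m : nat).

Lemma ord_max_attained (f : 'I_m -> R) (i0 : 'I_m) : (forall i, 0 <= f i) ->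
  exists i, f i = \big[Num.max/0]_(j < m) f j.
Proof.
move=> f0; have [//|j _ ->] := @eq_bigmax _ _ _ 0 i0 xpredT f isT.
by exists j.
Qed.

End BigMax.

Section Core.
Variables (R : realType) (d m : nat) (A : 'I_m -> 'M[R]_d) (w : seq 'I_m).
Variables (C gamma c : R) (T : 'M[R]_d) (psi : 'cV[R]_d -> R).
Implicit Types (s t : seq 'I_m) (zs : seq (seq 'I_m)) (x y : 'cV[R]_d).
Implicit Types (h : 'cV[R]_d -> R).

Local Notation P := (product A).
Local Notation Pi := (product A w).

(* [T] stands for the spectral projection of [Pi] onto its leading eigenspace and
   [psi] for the modulus of the leading coordinate of a vector. *)
Hypotheses (prim_w : primitive w) (w_neq0 : w <> [::]).
Hypotheses (C_gt0 : 0 < C) (bounded_A : bounded_products A C).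
Hypotheses (gamma_gt0 : 0 < gamma) (gap_A : forall s x,
  ~ rotated_power_of w s -> gamma * `|x| <= `|P s *m x - x|).
Hypotheses (comm_T : T *m Pi = Pi *m T) (idem_T : T *m T = T).
Hypothesis decay_T : forall e, 0 < e -> exists J, forall j, (J <= j)%N ->
  forall x, `|Pi ^+ j *m x - Pi ^+ j *m (T *m x)| <= e * `|x|.
Hypotheses (psi_seminorm : seminorm psi) (psi_Pi : forall x, psi (Pi *m x) = psi x).
Hypotheses (c_gt0 : 0 < c) (T_le_psi : forall x, `|T *m x| <= c * psi x).

Lemma powS_mul j x : Pi ^+ j.+1 *m x = Pi *m (Pi ^+ j *m x).
Proof. by rewrite exprS -mulmxA. Qed.

Lemma comm_T_pow j : T *m Pi ^+ j = Pi ^+ j *m T.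
Proof.
elim: j => [|j IH]; first by rewrite expr0 mulmx1 mul1mx.
by rewrite exprS [T *m _]mulmxA comm_T -mulmxA IH mulmxA.
Qed.

Lemma comm_T_powx j x : T *m (Pi ^+ j *m x) = Pi ^+ j *m (T *m x).
Proof. by rewrite !mulmxA comm_T_pow. Qed.

Lemma pow_bounded j x : `|Pi ^+ j *m x| <= C * `|x|.
Proof. by rewrite -product_power; apply: bounded_A. Qed.

Lemma psi_pow j x : psi (Pi ^+ j *m x) = psi x.
Proof.
elim: j => [|j IH]; first by rewrite expr0 mul1mx.
by rewrite powS_mul psi_Pi.
Qed.

(** [Pi] preserves [psi] but its powers shrink [x - T x] to 0, so [psi] vanishes there. *)
Lemma psi_T x : psi (T *m x) = psi x.
Proof.
have [B B0 hB] := seminorm_bounded psi_seminorm.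
have h0 : psi (x - T *m x) <= 0.
  apply: (@le_of_tail _ _ _ (B * `|x|)); first by rewrite mulr_ge0 // ltW.
  move=> e e0; have [J hJ] := decay_T e0.
  rewrite -(psi_pow J) mulmxBr add0r; apply: le_trans (hB _) _.
  by rewrite -mulrA ler_pM2l // mulrC hJ.
have h1 := seminorm_leB psi_seminorm (T *m x) x.
have h2 := seminorm_leB psi_seminorm x (T *m x).
rewrite -opprB seminormN // in h1.
by apply/eqP; rewrite eq_le; apply/andP; split; lra.
Qed.

Lemma T_bounded : exists2 B, 0 < B & forall x, `|T *m x| <= B * `|x|.
Proof.
have [B B0 hB] := seminorm_bounded psi_seminorm; exists (c * B) => [|x]; first by rewrite mulr_gt0.
by apply: le_trans (T_le_psi x) _; rewrite -mulrA ler_pM2l.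
Qed.

(** By the pigeonhole two matrices [Pi ^+ (i * J') T] and [Pi ^+ (j * J') T] are close. On the range
    of [T] the norm is controlled by [psi], which [Pi] preserves, so the common factor
    [Pi ^+ (i * J')] cancels. *)
Lemma T_near_pow e J : 0 < e -> exists2 j, (J <= j)%N &
  forall x, `|Pi ^+ j *m x - T *m x| <= e * `|x|.
Proof.
move=> e0; have e2 : 0 < e / 2 by rewrite divr_gt0.
have [J1 hJ1] := decay_T e2; pose J' := (J + J1).+1.
have [B B0 hB] := seminorm_bounded psi_seminorm; have [D D0 hD] := T_bounded.
(* The factors come from [|T v| <= c * psi v], from [psi <= B * |.|] and from the entrywise matrix
   norm, with 1 added to [d] for positivity. *)
pose delta := e / 2 / (c * B * (d%:R + 1)).
have d1 : 0 < d%:R + 1 :> R by rewrite ltr_wpDl.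
have delta0 : 0 < delta by rewrite divr_gt0 // !mulr_gt0.
have deltaE : e / 2 = c * B * (d%:R + 1) * delta.
  by rewrite /delta [RHS]mulrC divfK // gt_eqF // !mulr_gt0.
clearbody delta.
have [K hK] := @pigeonhole R d d (C * D) _ delta0.
have [k _|i [j [ij jK uij]]] := hK (fun k => Pi ^+ (k * J') *m T).
  apply: norm_le_op => [|x]; first by rewrite mulr_ge0 ?ltW.
  rewrite -mulmxA; apply: le_trans (pow_bounded _ _) _.
  by rewrite -mulrA ler_pM2l.
pose n := ((j - i) * J')%N; exists n => [|x].
  have : (J' <= n)%N by rewrite /n -{1}[J']mul1n leq_mul2r subn_gt0 ij orbT.
  by rewrite /J'; lia.
have nJ1 : (J1 <= n)%N.
  have : (J' <= n)%N by rewrite /n -{1}[J']mul1n leq_mul2r subn_gt0 ij orbT.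
  by rewrite /J'; lia.
rewrite -[_ - _](subrKA (Pi ^+ n *m (T *m x))).
apply: le_trans (ler_normD _ _) _; rewrite [e]splitr mulrDl lerD ?hJ1 //.
set v := _ - _; have Tv : T *m v = v.
  by rewrite /v mulmxBr comm_T_powx !(mulmxA T T) idem_T.
rewrite -Tv; apply: le_trans (T_le_psi v) _; rewrite -(psi_pow (i * J')).
have -> : Pi ^+ (i * J') *m v = (Pi ^+ (j * J') *m T - Pi ^+ (i * J') *m T) *m x.
  rewrite /v mulmxBr mulmxBl -!mulmxA [X in X - _]mulmxA -[X in X *m _]exprD.
  by rewrite /n -mulnDl subnKC // ltnW.
apply: (@le_trans _ _ (c * (B * (d%:R * delta * `|x|)))).
  rewrite ler_pM2l //; apply: le_trans (hB _) _; rewrite ler_pM2l //.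
  apply: le_trans (norm_mulmx_le _ _) _; rewrite ler_wpM2r // ler_wpM2l //.
  exact: ltW.
rewrite !mulrA ler_wpM2r //.
by rewrite deltaE ler_wpM2r ?(ltW delta0) // ler_wpM2l ?mulr_ge0 ?ltW //; lra.
Qed.

(** [T y] is approximated by [Pi ^+ j y] with [j > 0]; excluding [j = 0] is what makes a factor [Pi]
    available in the next use of recurrence. *)
Lemma limit_seminorm h y b : seminorm h -> (forall j, (0 < j)%N -> h (Pi ^+ j *m y) <= b) ->
  h (T *m y) <= b.
Proof.
move=> sh hb; have [B B0 hB] := seminorm_bounded sh.
apply: (@le_of_tail _ _ _ (B * `|y|)); first by rewrite mulr_ge0 // ltW.
move=> e e0; have [j j1 hj] := T_near_pow 1 e0.
apply: le_trans (seminorm_leB sh _ (Pi ^+ j *m y)) _; apply: lerD; first exact: hb.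
by apply: le_trans (hB _) _; rewrite -mulrA ler_pM2l // mulrC distrC.
Qed.

Lemma pow_nonincreasing h j x : (forall x, h (Pi *m x) <= h x) ->
  h (Pi ^+ j *m x) <= h x.
Proof.
move=> hP; elim: j => [|j IH]; first by rewrite expr0 mul1mx.
by rewrite powS_mul; apply: le_trans IH.
Qed.

Lemma seminorm_T_le h x : seminorm h -> (forall x, h (Pi *m x) <= h x) ->
  h (T *m x) <= h x.
Proof. by move=> sh hP; apply: limit_seminorm => // j _; apply: pow_nonincreasing. Qed.

(* [Pi] acts on the range of [T] as a recurrent isometry of [psi], so a
   seminorm which it does not increase is in fact preserved. *)
Lemma seminorm_T_Pi h x : seminorm h -> (forall x, h (T *m (Pi *m x)) <= h (T *m x)) ->
  h (T *m (Pi *m x)) = h (T *m x).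
Proof.
move=> sh hP; apply/eqP; rewrite eq_le hP /= -{1}idem_T -mulmxA.
apply: (@limit_seminorm (fun y => h (T *m y))); first exact: seminorm_comp.
case=> // j _; rewrite exprSr -mulmxA.
exact: (@pow_nonincreasing (fun y => h (T *m y))).
Qed.

Lemma product_nonincreasing h s x : (forall i x, h (A i *m x) <= h x) ->
  h (P s *m x) <= h x.
Proof.
move=> hA; elim: s x => [|i s IH] x; first by rewrite product_nil mul1mx.
by rewrite product_cons -mulmxA; apply: le_trans (hA _ _) (IH _).
Qed.

(** Any run of deviating words is deviating, hence no power of a rotation of [w], and [gap_A]
    forbids its recurrence; by [recurrence] a long chain must contract. *)
Lemma deviating_contraction eta : 0 < eta -> exists K, forall zs x,
  (K <= size zs)%N -> (forall z, z \in zs -> deviating w z) ->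
  `|P (flatten zs) *m x| <= eta * `|x|.
Proof.
move=> eta0; have [K hK] := recurrence bounded_A eta0 gamma_gt0.
exists K => zs x Kzs dev; have [->|x0] := eqVneq x 0.
  by rewrite mulmx0 normr0 mulr0.
rewrite leNgt; apply/negP => /ltW hx.
have [zs1 [zs2 [zs3 [e z2 [_]]]]] := hK zs x Kzs x0 hx.
rewrite ltNge gap_A //; apply: deviating_not_rotated => //.
apply: deviating_flatten => // z zz; apply: dev.
by rewrite e !mem_cat zz orbT.
Qed.

Definition invariant_norm h := is_norm h /\
  forall x, \big[Num.max/0]_(i < m) h (A i *m x) = h x.

Lemma invariant_norm_le h i x : invariant_norm h -> h (A i *m x) <= h x.
Proof. by move=> [_ hx]; rewrite -(hx x); apply: (le_bigmax _ (fun i => h (A i *m x))). Qed.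

Lemma invariant_trajectory h n x : invariant_norm h ->
  exists t, size t = n /\ h (P t *m x) = h x.
Proof.
move=> hh; have sh := is_norm_seminorm hh.1.
have i0 : 'I_m by case: w w_neq0.
elim: n => [|n [t [st ht]]]; first by exists [::]; rewrite product_nil mul1mx.
have [|i hi] := ord_max_attained (f := fun i => h (A i *m (P t *m x))) i0.
  by move=> i; apply: seminorm_ge0.
exists (i :: t); rewrite /= st product_cons -mulmxA; split=> //.
by rewrite hi hh.2.
Qed.

(* A trajectory on which [h] keeps its value is recurrent, and by [gap_A] only
   powers of rotations of [w] recur: it contains a long power of [w]. *)
Lemma entering h L : invariant_norm h -> exists N, forall x, exists s,
  (size (word_power w L ++ s) <= N)%N /\ h (P (word_power w L ++ s) *m x) = h x.
Proof.
move=> hh; have sh := is_norm_seminorm hh.1.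
have [c1 c10 hc1] := is_norm_bounded_below hh.1.
have [c2 c20 hc2] := seminorm_bounded sh.
have cc : 0 < c1 / c2 by rewrite divr_gt0.
have [K hK] := recurrence bounded_A cc gamma_gt0.
(* A power of a rotation filling a block of this length has at least [L + 1] factors and contains
   [w] to the power [L]. The summand [L * size w] covers [x = 0]. *)
pose b := (L.+1 * size w)%N; exists (K * b + L * size w)%N => x.
have [->|x0] := eqVneq x 0.
  exists [::]; rewrite cats0 size_word_power mulmx0 leq_addl; split=> //.
have [t [st ht]] := invariant_trajectory (K * b) x hh.
pose zs := reshape (nseq K b) t.
have sumK : sumn (nseq K b) = (K * b)%N by rewrite sumn_nseq mulnC.
have zsE : flatten zs = t by rewrite reshapeKr // sumK st.
have zs_size z : z \in zs -> size z = b.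
  move=> zz; have : size z \in shape zs by apply: map_f.
  by rewrite reshapeKl ?sumK ?st // mem_nseq => /andP[_ /eqP].
have [||zs1 [zs2 [zs3 [e z2 [_]]]]] := hK zs x _ x0.
- by rewrite size_reshape size_nseq.
- rewrite zsE mulrAC ler_pdivrMr //; apply: le_trans (hc1 x) _.
  by rewrite -ht mulrC.
rewrite ltNge => /negP f2.
have [k [p rE]] : rotated_power_of w (flatten zs2).
  by apply: contrapT => nr; apply: f2; apply: gap_A.
have Lp : (L < p)%N.
  have : (b <= size (flatten zs2))%N.
    case: zs2 z2 e {f2 rE} => // z zs2 _ e; rewrite /= size_cat.
    by rewrite zs_size ?leq_addr // e mem_cat inE eqxx orbT.
  rewrite rE size_word_power size_rot /b leq_pmul2r //.
  by rewrite lt0n size_eq0; apply/eqP.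
case: p Lp rE => // p; rewrite ltnS => Lp.
have [y1 [y2 [-> _]]] := rotated_power_split w k p => rE.
exists (y1 ++ flatten zs1).
have tE : t = (flatten zs3 ++ y2 ++ word_power w (p - L)) ++
              (word_power w L ++ y1 ++ flatten zs1).
  rewrite -zsE e !flatten_cat rE -{1}(subnK Lp) word_powerD -!catA.
  by [].
split.
  by apply: leq_trans (leq_addr _ _); rewrite -st tE [leqRHS]size_cat leq_addl.
(* [t] prolongs this word on the left and keeps the value [h x] at its end; as [h] never increases,
   it has that value in between too. *)
apply/eqP; rewrite eq_le (product_nonincreasing _ _ (fun i x => invariant_norm_le i x hh)).
rewrite -ht tE product_cat -mulmxA.
exact: (product_nonincreasing _ _ (fun i x => invariant_norm_le i x hh)).
Qed.

Section Weighted.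
Variables (K : nat) (a : R).
Hypotheses (a_gt1 : 1 < a) (weight : forall zs x, size zs = K.+1 ->
  (forall z, z \in zs -> deviating w z) ->
  a ^+ K.+1 * psi (P (flatten zs) *m (T *m x)) <= psi x).

(* Products of at most [K] deviating words, weighted by [a > 1] per word: the
   supremum of [psi] over them decreases by [a] along every word which is not a
   power of [w]. *)
Definition chains : set (seq (seq 'I_m)) :=
  [set zs | (size zs <= K)%N /\ forall z, z \in zs -> deviating w z].

Definition chain_value zs x := a ^+ size zs * psi (P (flatten zs) *m x).

Definition chain_sup := sup_fun chains chain_value.

(** Restricting to the range of [T] makes [chi] comparable with [psi] and turns the monotonicity of
    [chain_sup] under [Pi] into invariance. *)
Definition chi x := chain_sup (T *m x).

Let a_gt0 : 0 < a. Proof. by apply: lt_trans a_gt1. Qed.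

Let nil_chain : chains [::]. Proof. by []. Qed.

Let chains_neq0 : chains !=set0. Proof. by exists [::]. Qed.

Let chain_seminorm zs : chains zs -> seminorm (chain_value zs).
Proof.
by move=> _; apply/seminorm_scale/exprn_ge0/ltW/a_gt0; apply: seminorm_comp.
Qed.

Let chain_bounded : exists B, forall zs x, chains zs -> chain_value zs x <= B * `|x|.
Proof.
have [B B0 hB] := seminorm_bounded psi_seminorm; exists (a ^+ K * (B * C)) => zs x [zK _].
rewrite /chain_value -mulrA ler_pM ?seminorm_ge0 ?exprn_ge0 ?(ltW a_gt0) //.
  by rewrite ler_weXn2l // ltW.
by apply: le_trans (hB _) _; rewrite -mulrA ler_pM2l.
Qed.

Lemma le_chain_sup zs x : chains zs -> chain_value zs x <= chain_sup x.
Proof. by have [B hB] := chain_bounded; apply: (sup_fun_ub hB). Qed.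

Lemma chain_sup_le x b : (forall zs, chains zs -> chain_value zs x <= b) ->
  chain_sup x <= b.
Proof. exact: sup_fun_le. Qed.

Lemma seminorm_chain_sup : seminorm chain_sup.
Proof.
have [B hB] := chain_bounded; exact: (seminorm_sup_fun chains_neq0 chain_seminorm hB).
Qed.

Lemma seminorm_chi : seminorm chi.
Proof. exact: seminorm_comp seminorm_chain_sup _. Qed.

Lemma psi_le_chi x : psi x <= chi x.
Proof.
rewrite -{1}psi_T; have := le_chain_sup (T *m x) nil_chain.
by rewrite /chain_value /= product_nil mul1mx expr0 mul1r.
Qed.

Lemma chi_le_psi : exists2 B, 0 < B & forall x, chi x <= B * psi x.
Proof.
have [B B0 hB] := seminorm_bounded seminorm_chain_sup.
exists (B * c) => [|x]; first exact: mulr_gt0.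
by apply: le_trans (hB _) _; rewrite -mulrA ler_pM2l.
Qed.

(** The factor [Pi] is absorbed into the last word of the chain, [z ++ w] being deviating with [z];
    for the empty chain [psi] itself is invariant. *)
Lemma chain_sup_Pi x : chain_sup (Pi *m x) <= chain_sup x.
Proof.
apply: chain_sup_le => zs [zK dz]; rewrite /chain_value.
case/lastP: zs zK dz => [|zs z] zK dz.
  rewrite /= product_nil mul1mx psi_Pi; have := le_chain_sup x nil_chain.
  by rewrite /chain_value /= product_nil mul1mx.
have -> : P (flatten (rcons zs z)) *m (Pi *m x) = P (flatten (rcons zs (z ++ w))) *m x.
  by rewrite !flatten_rcons mulmxA -!product_cat !catA.
have -> : size (rcons zs z) = size (rcons zs (z ++ w)) by rewrite !size_rcons.
apply: le_chain_sup; split=> [|y]; first by move: zK; rewrite !size_rcons.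
rewrite mem_rcons inE => /orP[/eqP ->|yz].
  by apply: deviating_catw => //; apply: dz; rewrite mem_rcons inE eqxx.
by apply: dz; rewrite mem_rcons inE yz orbT.
Qed.

Lemma chi_Pi x : chi (Pi *m x) = chi x.
Proof.
apply: seminorm_T_Pi => [|y]; first exact: seminorm_chain_sup.
by rewrite mulmxA comm_T -mulmxA chain_sup_Pi.
Qed.

(** By invariance [w] may be put in front of [s]. The deviating word [w ++ s] then prolongs any
    chain and gains a factor [a]; chains already of length [K] are handled by [weight]. *)
Lemma chi_contraction s x : ~ power_of w s -> a * chi (P s *m (T *m x)) <= chi x.
Proof.
move=> ns; rewrite -(chi_Pi (P s *m _)) mulmxA -product_cat /chi.
set z := w ++ s; have dz : deviating w z by exists s.
apply: (@le_trans _ _ (a * chain_sup (P z *m (T *m x)))).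
  rewrite ler_pM2l //; apply: seminorm_T_le; first exact: seminorm_chain_sup.
  exact: chain_sup_Pi.
rewrite -ler_pdivlMl //; apply: chain_sup_le => zs [zK dzs].
rewrite ler_pdivlMl // /chain_value mulrA -exprS mulmxA -product_cat.
have -> : flatten zs ++ z = flatten (rcons zs z) by rewrite flatten_rcons.
have dr (u : seq 'I_m) : u \in rcons zs z -> deviating w u.
  by rewrite mem_rcons inE => /orP[/eqP ->|/dzs].
case: (ltnP (size zs) K) => [zK'|Kz].
  rewrite -(size_rcons zs z); apply: le_chain_sup; split=> //.
  by rewrite size_rcons.
have zE : size zs = K by apply/eqP; rewrite eqn_leq zK.
rewrite zE; apply: le_trans (psi_le_chi x); apply: weight => //.
by rewrite size_rcons zE.
Qed.

End Weighted.

Lemma weights_exist : exists K a, 1 < a /\ forall zs x, size zs = K.+1 ->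
  (forall z, z \in zs -> deviating w z) ->
  a ^+ K.+1 * psi (P (flatten zs) *m (T *m x)) <= psi x.
Proof.
have [B B0 hB] := seminorm_bounded psi_seminorm.
(* With this rate [K + 1] deviating words halve [psi] on the range of [T], so any [a > 1] with
   [a ^+ K.+1 <= 2] is admissible. *)
have eta0 : 0 < (2 * B * c)^-1 by rewrite invr_gt0 !mulr_gt0.
have [K hK] := deviating_contraction eta0.
have [|tau [t0 t1 ht]] := @root_near1 R 2^-1 K.+1; first lra.
exists K, tau^-1; split=> [|zs x zK dz]; first by rewrite invf_gt1.
have h1 : psi (P (flatten zs) *m (T *m x)) <= 2^-1 * psi x.
  apply: le_trans (hB _) _; rewrite -ler_pdivlMl //.
  apply: le_trans (hK _ _ _ dz) _; first by rewrite zK.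
  rewrite -ler_pdivlMl ?invr_gt0 ?mulr_gt0 // invrK; apply: le_trans (T_le_psi x) _.
  rewrite le_eqVlt; apply/orP; left; apply/eqP.
  by field; rewrite gt_eqF.
rewrite exprVn ler_pdivrMl ?exprn_gt0 //; apply: le_trans h1 _.
by rewrite ler_wpM2r ?seminorm_ge0.
Qed.

(** The bound by [psi] says that [h] sees only the leading coordinate. Rational non-real rotations
    preserve many such seminorms; there the finite order of [Pi] on the range of [T] takes over. *)
Definition rigid := forall h, seminorm h -> (forall x, h (Pi *m x) = h x) ->
  (exists2 B, 0 < B & forall x, h x <= B * psi x) ->
  exists2 k, 0 <= k & forall x, h x = k * psi x.

Hypothesis periodic_or_rigid : (exists2 n, (0 < n)%N & Pi ^+ n *m T = T) \/ rigid.

(* The supremum [chi] is replaced by a finite maximum: in the rigid case it is a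
   multiple of [psi]; in the periodic case it is approximated on a finite net of
   matrices and made invariant again by maximising over a period of [Pi]. *)
Lemma adapted_seminorm : exists (Ms : seq 'M[R]_d) (theta : R),
  [/\ theta < 1, forall x, max_comp psi Ms (Pi *m x) = max_comp psi Ms x,
      forall x, psi x <= max_comp psi Ms x &
      forall s x, ~ power_of w s ->
        max_comp psi Ms (P s *m (T *m x)) <= theta * max_comp psi Ms x].
Proof.
have [K [a [a1 weight]]] := weights_exist.
have a0 : 0 < a by apply: lt_trans a1.
have contr := chi_contraction a1 weight.
have schi := seminorm_chi K a1.
have psichi := psi_le_chi K a1.
have chiPi := chi_Pi K a1.
have ai1 : a^-1 < 1 by rewrite invf_lt1.
case: periodic_or_rigid => [[n n0 hn]|rig]; last first.
  have [k k0 hk] := rig _ schi chiPi (chi_le_psi K a1).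
  have E x : max_comp psi [:: 1%:M] x = psi x.
    by rewrite /max_comp big_cons big_nil mul1mx max_l // seminorm_ge0.
  exists [:: 1%:M], a^-1; split=> // [x|x|s x ns]; rewrite !E //.
  have := contr s x ns; rewrite !hk mulrCA; have [k00|kn] := eqVneq k 0.
    have psi0 y : psi y = 0.
      apply/eqP; rewrite eq_le seminorm_ge0 // andbT.
      by apply: le_trans (psichi y) _; rewrite hk k00 mul0r.
    by rewrite !psi0 !mulr0.
  have kp : 0 < k by rewrite lt_def kn.
  by rewrite ler_pM2l // -ler_pdivlMl.
have [B B0 hB] := seminorm_bounded psi_seminorm; have [D D0 hD] := T_bounded.
pose d1 : R := d%:R + 1; have d10 : 0 < d1 by rewrite ltr_wpDl.
(* Passing to a net costs a factor [1 + e]; with this [e], [a^-1 * (1 + e)] is still below 1. *)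
pose e := (1 - a^-1) / 2; have e0 : 0 < e by rewrite divr_gt0 // subr_gt0.
have ai0 : 0 < a^-1 by rewrite invr_gt0.
pose delta := e / (B * d1 * c).
have delta0 : 0 < delta by rewrite divr_gt0 // !mulr_gt0.
have deltaE : B * d1 * c * delta = e by rewrite mulrC divfK // gt_eqF // !mulr_gt0.
clearbody delta.
pose mat zs := a ^+ size zs *: (P (flatten zs) *m T).
pose inN N := exists2 zs, chains K zs & N = mat zs.
have mat_T zs : mat zs *m T = mat zs by rewrite /mat -scalemxAl -mulmxA idem_T.
have psi_mat zs x : psi (mat zs *m x) = chain_value a zs (T *m x).
  rewrite /mat -scalemxAl seminormZ // ger0_norm ?exprn_ge0 ?ltW //.
  by rewrite -mulmxA.
have bN N : inN N -> `|N| <= a ^+ K * (C * D).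
  move=> [zs [zK _] ->]; apply: norm_le_op => [|x]; first by rewrite !mulr_ge0 ?exprn_ge0 ?ltW.
  rewrite /mat -scalemxAl normrZ ger0_norm ?exprn_ge0 ?(ltW a0) // -[leRHS]mulrA.
  rewrite ler_pM ?exprn_ge0 ?(ltW a0) //; first by rewrite ler_weXn2l // ltW.
  by rewrite -mulmxA; apply: le_trans (bounded_A _ _) _; rewrite -mulrA ler_pM2l.
have [n' [cell hcell]] := @finite_cells R d d (a ^+ K * (C * D)) _ delta0.
have T_in : inN T.
  by exists [::] => //; rewrite /mat /= expr0 scale1r product_nil mul1mx.
(* Cells that meet no chain matrix get the default [T], itself the matrix of the empty chain. *)
have hrep (i : 'I_n') : exists N, inN N /\ forall N', inN N' -> cell N' = i -> cell N = i.
  case: (pselect (exists2 N, inN N & cell N = i)) => [[N hN ci]|no].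
    by exists N; split.
  by exists T; split=> // N' hN' ci; case: no; exists N'.
have [rep hrep'] := choice hrep.
pose Ms0 := T :: [seq rep i | i <- enum 'I_n'].
have Ms0_in N : N \in Ms0 -> inN N.
  by rewrite inE => /orP[/eqP -> //|/mapP[i _ ->]]; case: (hrep' i).
have Ms0_T N x : N \in Ms0 -> N *m (T *m x) = N *m x.
  by move=> /Ms0_in[zs _ ->]; rewrite mulmxA mat_T.
have Ms0_chi N x : N \in Ms0 -> psi (N *m x) <= chi K a x.
  by move=> /Ms0_in[zs hz ->]; rewrite psi_mat; apply: le_chain_sup.
have psi_Ms0 x : psi x <= max_comp psi Ms0 x.
  by rewrite -psi_T; apply: le_max_comp; rewrite inE eqxx.
have chi_Ms0 x : chi K a x <= (1 + e) * max_comp psi Ms0 x.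
  apply: chain_sup_le => zs hz; rewrite -psi_mat.
  have hN : inN (mat zs) by exists zs.
  have [hr /(_ _ hN erefl) er] := hrep' (cell (mat zs)).
  set N := rep _ in hr er.
  have NM : N \in Ms0 by rewrite inE map_f ?orbT // mem_enum.
  apply: le_trans (seminorm_leB psi_seminorm _ (N *m x)) _.
  rewrite mulrDl mul1r; apply: lerD; first exact: le_max_comp.
  have -> : mat zs *m x - N *m x = (mat zs - N) *m (T *m x).
    rewrite mulmxBl (Ms0_T N) //; congr (_ - _).
    by rewrite mulmxA mat_T.
  apply: (@le_trans _ _ (e * psi x)); last by rewrite ler_pM2l.
  apply: le_trans (hB _) _; rewrite -deltaE -!mulrA ler_pM2l //.
  apply: le_trans (norm_mulmx_le _ _) _; rewrite -mulrA.
  apply: ler_pM => //; first by rewrite lerDl.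
  rewrite mulrCA; apply: ler_pM => //; apply: ltW.
  by apply: hcell (esym er); apply: bN.
have invT x : max_comp psi Ms0 (T *m x) = max_comp psi Ms0 x.
  by rewrite /max_comp big_seq [RHS]big_seq; apply: eq_bigr => N NM; rewrite Ms0_T.
pose Ms := [seq N *m Pi ^+ j | N <- Ms0, j <- iota 0 n].
have Ms_in N j : N \in Ms0 -> (j < n)%N -> N *m Pi ^+ j \in Ms.
  by move=> NM jn; apply: allpairs_f => //; rewrite mem_iota.
have Ms0_Ms x : max_comp psi Ms0 x <= max_comp psi Ms x.
  apply: max_comp_le => [|N NM]; first exact: max_comp_ge0.
  rewrite -[N]mulmx1 -[1%:M]/(1 : 'M[R]_d) -(expr0 Pi).
  by apply: le_max_comp; apply: Ms_in.
have Ms_le x b : 0 <= b -> (forall j N, (j < n)%N -> N \in Ms0 ->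
    psi (N *m (Pi ^+ j *m x)) <= b) -> max_comp psi Ms x <= b.
  move=> b0 h; apply: max_comp_le => // M /allpairsP[[N j] [/= NM]].
  by rewrite mem_iota => jn ->; rewrite -mulmxA; apply: h.
have Ms_T x : max_comp psi Ms (T *m x) = max_comp psi Ms x.
  rewrite /max_comp big_seq [RHS]big_seq; apply: eq_bigr => M MMs.
  have [[N j] [/= NM _ eM]] := allpairsP MMs.
  by rewrite eM -!mulmxA -comm_T_powx Ms0_T.
have Ms_Pi_le x : max_comp psi Ms (Pi *m x) <= max_comp psi Ms x.
  apply: Ms_le => [|j N jn NM]; first exact: max_comp_ge0.
  rewrite [Pi ^+ j *m _]mulmxA -[_ *m Pi]exprSr.
  case: (ltnP j.+1 n) => [jn'|nj].
    by rewrite mulmxA; apply: le_max_comp; apply: Ms_in.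
  (* The period closes up: [N Pi ^+ n = N T Pi ^+ n = N T = N]. *)
  have -> : j.+1 = n by apply/eqP; rewrite eqn_leq nj jn.
  apply: le_trans (Ms0_Ms x); rewrite -(Ms0_T N) // comm_T_powx [Pi ^+ n *m _]mulmxA hn.
  by rewrite Ms0_T //; apply: le_max_comp.
have Ms_chi x : max_comp psi Ms x <= chi K a x.
  apply: Ms_le => [|j N _ NM]; first exact: seminorm_ge0.
  apply: le_trans (Ms0_chi _ _ NM) _; apply: pow_nonincreasing => y.
  by rewrite chiPi.
have chi_Ms x : chi K a x <= (1 + e) * max_comp psi Ms x.
  by apply: le_trans (chi_Ms0 x) _; rewrite ler_pM2l // addr_gt0.
exists Ms, (a^-1 * (1 + e)); split.
- have : a^-1 * (1 + e) < 1 * (1 + e) by rewrite ltr_pM2r ?addr_gt0.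
  rewrite /e; nra.
- move=> x; rewrite -Ms_T -[RHS]Ms_T; apply: seminorm_T_Pi.
    exact: seminorm_max_comp.
  by move=> y; rewrite !Ms_T.
- by move=> x; apply: le_trans (psi_Ms0 x) (Ms0_Ms x).
move=> s x ns; apply: le_trans (Ms_chi _) _.
rewrite -mulrA ler_pdivlMl //; apply: le_trans (contr s x ns) _.
exact: chi_Ms.
Qed.

Hypotheses (irr_A : irreducible_family A) (psi_neq0 : exists x, psi x <> 0).

Lemma short_words N : exists ss : seq (seq 'I_m),
  forall s, (size s <= N)%N -> s \in ss.
Proof.
exists (flatten [seq [seq tval u | u <- enum {: n.-tuple 'I_m}] | n <- iota 0 N.+1]).
move=> s sN; apply/flattenP; exists [seq tval u | u <- enum {: (size s).-tuple 'I_m}].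
  by apply/mapP; exists (size s) => //; rewrite mem_iota.
by apply/mapP; exists (in_tuple s); rewrite ?mem_enum.
Qed.

(* The norm [F] is the supremum of [chi0] along all products. After a long power
   of [w] a vector is so close to the range of [T] that [F] and [chi0] agree on
   it, and [entering] reaches such a vector in boundedly many steps. *)
Theorem invariant_norm_exists : exists Ms : seq 'M[R]_d,
  invariant_norm (max_comp psi Ms).
Proof.
have [Ms0 [theta [theta1 chiPi psichi contr]]] := adapted_seminorm.
set chi0 := max_comp psi Ms0 in chiPi psichi contr.
have schi : seminorm chi0 by apply: seminorm_max_comp.
have [B B0 hB] := seminorm_bounded schi.
pose F := sup_fun [set: seq 'I_m] (fun s x => chi0 (P s *m x)).
have T0 : [set: seq 'I_m] !=set0 by exists [::].
have sF0 s : [set: seq 'I_m] s -> seminorm (fun x => chi0 (P s *m x)).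
  by move=> _; apply: seminorm_comp.
have FB s x : [set: seq 'I_m] s -> chi0 (P s *m x) <= B * C * `|x|.
  by move=> _; apply: le_trans (hB _) _; rewrite -mulrA ler_pM2l.
have sF : seminorm F := seminorm_sup_fun T0 sF0 FB.
have F_ub s x : chi0 (P s *m x) <= F x by apply: (sup_fun_ub FB).
have F_le x b : (forall s, chi0 (P s *m x) <= b) -> F x <= b.
  by move=> h; apply: sup_fun_le => // s _; apply: h.
have chiF x : chi0 x <= F x by have := F_ub [::] x; rewrite product_nil mul1mx.
have FA i x : F (A i *m x) <= F x.
  apply: F_le => s; rewrite mulmxA -[A i](product_seq1 A) -product_cat.
  exact: F_ub.
have nF : is_norm F.
  apply: (irreducible_seminorm irr_A sF).
    move=> i x Fx; apply/eqP; rewrite eq_le (seminorm_ge0 sF) andbT -Fx.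
    exact: FA.
  have [x px] := psi_neq0; exists x => Fx; apply: px; apply/eqP.
  rewrite eq_le (seminorm_ge0 psi_seminorm) andbT -Fx.
  exact: le_trans (psichi x) (chiF x).
have F0 x : 0 <= F x by apply: seminorm_ge0.
have iF : invariant_norm F.
  split=> // x; apply/eqP; rewrite eq_le; apply/andP; split.
    by apply/bigmax_leP; split.
  have aux s i : chi0 (P (rcons s i) *m x) <= \big[Num.max/0]_(j < m) F (A j *m x).
    rewrite -cats1 product_cat product_seq1 -mulmxA.
    apply: le_trans (F_ub _ _) _; exact: (le_bigmax _ (fun j => F (A j *m x))).
  (* For the empty word, [chi0 x = chi0 (Pi *m x)] and [w] has a last letter, so the previous bound
     applies. *)
  apply: F_le => s; case/lastP: s => // ; rewrite product_nil mul1mx -chiPi.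
  by case/lastP: w w_neq0.
have [c1 c10 hc1] := is_norm_bounded_below nF.
have [c2 c20 hc2] := seminorm_bounded sF.
(* Powers of [w] keep [chi0 z]. Any other word brings [T z] down to [theta * chi0 z], which leaves
   room [(1 - theta) * chi0 z] for the remainder [z - T z]. *)
have near_V z : F (z - T *m z) <= (1 - theta) * chi0 z -> F z = chi0 z.
  move=> hz; apply/eqP; rewrite eq_le chiF andbT; apply: F_le => s.
  case: (pselect (power_of w s)) => [[k ->]|ns].
    rewrite product_power; elim: k => [|k IH]; first by rewrite expr0 mul1mx.
    by rewrite powS_mul chiPi.
  rewrite -{1}[z](subrK (T *m z)) mulmxDr; apply: le_trans (seminormD schi _ _) _.
  have := contr s z ns; have := le_trans (F_ub s (z - T *m z)) hz; lra.
(* If [F (z - T z) <= e1 * F z] with [e1 <= 1 / 2], then [F z <= 2 * F (T z) <= 2 * c2 * c * chi0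
   z]; this [mu] turns that into the hypothesis of [near_V]. *)
pose mu := (1 - theta) / (2 * (c2 * c)).
have mu0 : 0 < mu by rewrite divr_gt0 ?subr_gt0 // !mulr_gt0.
pose e1 := Num.min 2^-1 mu.
have e10 : 0 < e1 by rewrite lt_min mu0 andbT invr_gt0.
pose e := e1 * c1 / (c2 * C).
have e0 : 0 < e by rewrite divr_gt0 // mulr_gt0.
have [L hL] := decay_T e0.
have [N hN] := entering L iF.
have [ss hss] := short_words N.
pose Ms := [seq M *m P s | M <- Ms0, s <- ss].
have Ms_le x : max_comp psi Ms x <= F x.
  apply: max_comp_le => // M /allpairsP[[M0 s] [/= M0M _ ->]].
  by rewrite -mulmxA; apply: le_trans (F_ub s x); apply: le_max_comp.
suff FE : F = max_comp psi Ms by exists Ms; rewrite -FE.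
apply/funext => x; apply/eqP; rewrite eq_le Ms_le andbT.
have [s [sN hs]] := hN x.
set s' := word_power w L ++ s in sN hs.
have -> : F x = chi0 (P s' *m x).
  rewrite -hs; apply: near_V; set z := P s' *m x in hs *.
  pose y := P s *m x.
  have zE : z = Pi ^+ L *m y by rewrite /z product_cat product_power -mulmxA.
  have h1 : F (z - T *m z) <= e1 * F z.
    rewrite zE comm_T_powx; apply: le_trans (hc2 _) _.
    apply: (@le_trans _ _ (c2 * (e * (C * `|x|)))).
      rewrite ler_pM2l //; apply: le_trans (hL L (leqnn L) y) _.
      by rewrite ler_pM2l // bounded_A.
    rewrite -zE hs; have -> : c2 * (e * (C * `|x|)) = e1 * (c1 * `|x|).
      by rewrite /e; field; rewrite !gt_eqF.
    by rewrite ler_pM2l.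
  have h2 : F (T *m z) <= c2 * c * chi0 z.
    apply: le_trans (hc2 _) _; rewrite -mulrA ler_pM2l //.
    apply: le_trans (T_le_psi z) _; rewrite ler_pM2l //.
  have h3 := seminorm_leB sF z (T *m z).
  have e1h : e1 <= 2^-1 by rewrite ge_min lexx.
  have e1m : e1 <= mu by rewrite ge_min lexx orbT.
  have h4 : 2^-1 * F z <= c2 * c * chi0 z.
    have : e1 * F z <= 2^-1 * F z by rewrite ler_wpM2r.
    by lra.
  apply: le_trans h1 _; apply: (@le_trans _ _ (mu * F z)); first by rewrite ler_wpM2r.
  have -> : mu * F z = (1 - theta) / (c2 * c) * (2^-1 * F z).
    by rewrite /mu; field; rewrite !gt_eqF.
  rewrite -[leRHS](_ : (1 - theta) / (c2 * c) * (c2 * c * chi0 z) = _); last first.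
    by rewrite mulrA divfK // gt_eqF // mulr_gt0.
  by rewrite ler_pM2l // divr_gt0 ?subr_gt0 // mulr_gt0.
apply: max_comp_le => [|M MM]; first exact: max_comp_ge0.
by rewrite mulmxA; apply: le_max_comp; apply: allpairs_f => //; apply: hss.
Qed.

(* By rigidity an invariant norm is a multiple of [psi] on the range of [T], and
   [entering] determines it elsewhere as a supremum along products. *)
Theorem invariant_norm_unique h1 h2 : rigid -> invariant_norm h1 -> invariant_norm h2 ->
  exists2 k, 0 < k & forall x, h2 x = k * h1 x.
Proof.
move=> rig ih1 ih2; have [B B0 hB] := seminorm_bounded psi_seminorm.
pose Psi := sup_fun [set: seq 'I_m] (fun s x => psi (P s *m x)).
have T0 : [set: seq 'I_m] !=set0 by exists [::].
have FB s x : [set: seq 'I_m] s -> psi (P s *m x) <= B * C * `|x|.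
  by move=> _; apply: le_trans (hB _) _; rewrite -mulrA ler_pM2l.
have main h : invariant_norm h -> exists2 k, 0 < k & forall x, h x = k * Psi x.
  move=> ih; have sh := is_norm_seminorm ih.1.
  have [c2 c20 hc2] := seminorm_bounded sh.
  have hPi x : h (Pi *m x) <= h x.
    by apply: product_nonincreasing => i y; apply: invariant_norm_le.
  have [|||k k0 hk] := rig (fun x => h (T *m x)).
  - exact: seminorm_comp.
  - move=> x; apply: seminorm_T_Pi => // y.
    by rewrite mulmxA comm_T -mulmxA.
  - exists (c2 * c) => [|x]; first exact: mulr_gt0.
    by apply: le_trans (hc2 _) _; rewrite -mulrA ler_pM2l.
  have kn : k != 0.
    have [x px] := psi_neq0; apply/eqP => k00; apply: px.
    have := hk x; rewrite k00 mul0r => hTx; rewrite -psi_T.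
    case: ih => -[h0 _ _] _; rewrite (h0 _ hTx); exact: seminorm0.
  have kp : 0 < k by rewrite lt_def kn.
  exists k => // x; apply/eqP; rewrite eq_le; apply/andP; split; last first.
    rewrite -ler_pdivlMl //; apply: sup_fun_le => // s _.
    rewrite ler_pdivlMl // -hk; apply: le_trans (seminorm_T_le _ sh hPi) _.
    by apply: product_nonincreasing => i y; apply: invariant_norm_le.
  (* After the final power of [w], replacing [y] by [T y] changes [h] by an arbitrarily small
     amount, and on the range of [T] its value is [k * psi y]. *)
  apply: (@le_of_tail _ _ _ (c2 * (C * `|x|))); first by rewrite !mulr_ge0 // ltW.
  move=> e e0; have [L hL] := decay_T e0.
  have [N hN] := entering L ih; have [s [_ <-]] := hN x.
  rewrite product_cat product_power -mulmxA; set y := P s *m x.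
  apply: le_trans (seminorm_leB sh _ (Pi ^+ L *m (T *m y))) _; apply: lerD.
    rewrite -comm_T_powx hk psi_pow ler_pM2l //.
    exact: (sup_fun_ub (D := [set: seq 'I_m]) FB).
  apply: le_trans (hc2 _) _; rewrite -mulrA ler_pM2l //.
  apply: le_trans (hL L (leqnn L) y) _.
  by rewrite [leRHS]mulrC ler_pM2l // bounded_A.
have [k1 k10 e1] := main h1 ih1; have [k2 k20 e2] := main h2 ih2.
exists (k2 / k1) => [|x]; first by rewrite divr_gt0.
by rewrite e1 e2 mulrA divfK // gt_eqF.
Qed.

End Core.

(** * The leading eigenspace of the dominant product *)

Section GeometricMultiplicity.
Variables (F : fieldType) (n : nat) (M : 'M[F]_n) (a : F).

(** In a basis [B] whose first [r] rows are eigenvectors, those rows of [B (X - M)] are divisible by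
    [X - a], so [(X - a)^r] divides the determinant. *)
Lemma rank_eigenspace_le_mup : (\rank (eigenspace M a) <= mup a (char_poly M))%N.
Proof.
set E := eigenspace M a; set r := \rank E.
rewrite mup_geq ?monic_neq0 ?char_poly_monic //.
pose B := row_ebase E.
have rowB (i : 'I_n) : (i < r)%N -> row i B *m M = a *: row i B.
  move=> ir; apply/eigenspaceP; have := submxMl (invmx (col_ebase E)) E.
  rewrite -{2}(mulmx_ebase E) -mulmxA mulKmx ?col_ebase_unit //.
  move=> /(submx_trans _); apply.
  have -> : row i B = row i (pid_mx r *m B).
    apply/rowP => j; rewrite !mxE (bigD1 i) //= mxE eqxx ir mul1r big1 ?addr0 //.
    move=> k ki; rewrite mxE; case: eqP => [/val_inj e|_]; last by rewrite mul0r.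
    by rewrite e eqxx in ki.
  exact: row_sub.
pose cB := map_mx polyC B.
pose N := \matrix_(i < n, j < n) (if (i < r)%N then (B i j)%:P
             else (cB *m char_poly_mx M) i j).
pose D := \row_(i < n) (if (i < r)%N then 'X - a%:P else 1).
have e : cB *m char_poly_mx M = diag_mx D *m N.
  apply/matrixP => i j; rewrite mul_diag_mx [RHS]mxE [D _ _]mxE [N _ _]mxE.
  case: ifP => ir; last by rewrite mul1r.
  rewrite /char_poly_mx mulmxBr mxE mul_mx_scalar -map_mxM !mxE.
  have := congr1 (fun v : 'rV_n => v ord0 j) (rowB i ir); rewrite -row_mul !mxE => ->.
  by rewrite mulrBl -polyCM.
have := congr1 determinant e; rewrite !det_mulmx det_diag det_map_mx.
have -> : \prod_(i < n) D ord0 i = ('X - a%:P) ^+ r.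
  rewrite (eq_bigr (fun i : 'I_n => if (i < r)%N then 'X - a%:P else 1)); last first.
    by move=> i _; rewrite mxE.
  rewrite -big_mkcond /= prodr_const; congr (_ ^+ _).
  have rn : (r <= n)%N by apply: rank_leq_row.
  rewrite -sum1_card (eq_bigl (fun i : 'I_n => (i < r)%N)) //.
  by rewrite -(big_ord_widen n (fun=> 1%N)) // sum1_card card_ord.
move=> h; have : ('X - a%:P) ^+ r %| (\det B)%:P * char_poly M.
  by rewrite /char_poly h dvdp_mulr.
rewrite mul_polyC dvdpZr //; have := row_ebase_unit E.
by rewrite unitmxE unitfE.
Qed.

End GeometricMultiplicity.

Section Decay.
Variables (R : realType).

Lemma contraction_limit (theta : R) (x z : nat -> R) : 0 <= theta -> theta < 1 ->
  (forall j, x j.+1 <= theta * x j + z j) ->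
  (forall e, 0 < e -> exists J, forall j, (J <= j)%N -> z j <= e) ->
  forall e, 0 < e -> exists J, forall j, (J <= j)%N -> x j <= e.
Proof.
move=> t0 t1 hx hz e e0.
(* This value makes [e / 2] the fixed point of [y |-> theta * y + e * (1 - theta) / 2]. *)
have [|J hJ] := hz (e * (1 - theta) / 2).
  by rewrite divr_gt0 ?mulr_gt0 ?subr_gt0.
have H n : x (J + n)%N <= theta ^+ n * `|x J| + e / 2.
  elim: n => [|n IH].
    by rewrite addn0 expr0 mul1r; have := ler_norm (x J); lra.
  rewrite addnS; apply: le_trans (hx _) _.
  have := hJ (J + n)%N (leq_addr _ _); have := ler_wpM2l t0 IH.
  by rewrite exprS; lra.
have [t00|tn] := eqVneq theta 0.
  exists J.+1 => j Jj; have := H (j - J)%N; rewrite subnKC ?(ltnW Jj) //.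
  by rewrite t00 expr0n subn_eq0 leqNgt Jj mul0r; lra.
have tp : 0 < theta by rewrite lt_def tn.
have [|n hn] := @geometric_small R theta (e / 2 / (`|x J| + 1)) tp t1.
  by rewrite !divr_gt0 // ltr_wpDl.
exists (J + n)%N => j Jnj; have := H (j - J)%N; rewrite subnKC; last first.
  by apply: leq_trans Jnj; apply: leq_addr.
move=> /le_trans; apply; rewrite [leRHS]splitr lerD2r.
have h1 : theta ^+ (j - J) <= theta ^+ n by rewrite ler_wiXn2l ?ltW // leq_subRL //; lia.
have h2 : theta ^+ (j - J) * `|x J| <= theta ^+ n * `|x J| by rewrite ler_wpM2r.
apply: le_trans h2 _; move: hn; rewrite ltr_pdivlMr ?ltr_wpDl // => hn.
have : 0 < theta ^+ n by apply: exprn_gt0.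
lra.
Qed.

Variable d : nat.
Implicit Types M N : 'M[R[i]]_d.+1.

Definition entry_sum N : R := \sum_(i < d.+1) \sum_(j < d.+1) cmod (N i j).

Lemma entry_le_sum N i j : cmod (N i j) <= entry_sum N.
Proof.
rewrite /entry_sum (bigD1 i) //= (bigD1 j) //= -addrA lerDl addr_ge0 //.
  by apply: sumr_ge0 => *; apply: cmod_ge0.
by apply: sumr_ge0 => *; apply: sumr_ge0 => *; apply: cmod_ge0.
Qed.

Lemma entry_sumD M N : entry_sum (M + N) <= entry_sum M + entry_sum N.
Proof.
rewrite -big_split /=; apply: ler_sum => i _; rewrite -big_split /=.
by apply: ler_sum => j _; rewrite mxE ler_cmodD.
Qed.

Lemma entry_sumZ a M : entry_sum (a *: M) = cmod a * entry_sum M.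
Proof.
rewrite /entry_sum mulr_sumr; apply: eq_bigr => i _; rewrite mulr_sumr.
by apply: eq_bigr => j _; rewrite mxE cmodM.
Qed.

(** Induction on the roots replaces a Jordan form: in [M^(j+1) N = mu M^j N + M^j (M - mu) N] the
    last term decays by induction, and [mu] is smaller than [r] in modulus. *)
Lemma annihilated_decay M N (r : R) (rs : seq R[i]) : 0 < r ->
  (forall mu, mu \in rs -> cmod mu < r) ->
  horner_mx M (\prod_(mu <- rs) ('X - mu%:P)) *m N = 0 ->
  forall e, 0 < e -> exists J, forall j, (J <= j)%N ->
    r ^- j * entry_sum (M ^+ j *m N) <= e.
Proof.
move=> r0; elim: rs N => [|mu rs IH] N hrs.
  rewrite big_nil rmorph1 mul1mx => -> e e0; exists 0%N => j _.
  rewrite mulmx0 /entry_sum big1 ?mulr0 ?ltW // => i _; rewrite big1 // => k _.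
  by rewrite mxE cmod_sqrt /= expr0n addr0 sqrtr0.
rewrite big_cons mulrC rmorphM /= -mulmxA => h.
have muN : horner_mx M ('X - mu%:P) *m N = M *m N - mu *: N.
  by rewrite rmorphB /= horner_mx_X horner_mx_C mulmxBl mul_scalar_mx.
have hrs' (nu : R[i]) : nu \in rs -> cmod nu < r.
  by move=> nr; apply: hrs; rewrite inE nr orbT.
have hz := IH _ hrs' h.
have mur : cmod mu < r by apply: hrs; rewrite inE eqxx.
apply: (@contraction_limit (cmod mu / r) _ (fun j => r^-1 *
  (r ^- j * entry_sum (M ^+ j *m (horner_mx M ('X - mu%:P) *m N))))).
- by rewrite divr_ge0 ?cmod_ge0 // ltW.
- by rewrite ltr_pdivrMr // mul1r.
- move=> j; rewrite muN mulmxBr -scalemxAr.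
  have -> : cmod mu / r * (r ^- j * entry_sum (M ^+ j *m N)) =
      r^-1 * (r ^- j * entry_sum (mu *: (M ^+ j *m N))).
    by rewrite entry_sumZ; ring.
  rewrite -!mulrDr exprS invfM -mulrA ler_pM2l ?invr_gt0 // ler_pM2l ?invr_gt0 ?exprn_gt0 //.
  rewrite addrC; apply: le_trans _ (entry_sumD _ _); rewrite subrK.
  by rewrite exprSr -mulmxA.
move=> e e0; have [|J hJ] := hz (r * e); first by rewrite mulr_gt0.
by exists J => j /hJ hj; rewrite ler_pdivrMl.
Qed.

End Decay.

Section LinearForm.
Local Open Scope complex_scope.
Variables (R : realType) (d : nat).
Implicit Types (u : 'rV[R[i]]_d) (x y : 'cV[R]_d) (M : 'M[R]_d).

Definition zeta u x : R[i] := (u *m map_mx (rc R) x) ord0 ord0.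

Lemma zetaD u x y : zeta u (x + y) = zeta u x + zeta u y.
Proof. by rewrite /zeta map_mxD mulmxDr mxE. Qed.

Lemma zetaZ u (k : R) x : zeta u (k *: x) = k%:C * zeta u x.
Proof. by rewrite /zeta map_mxZ /= -scalemxAr mxE. Qed.

Lemma zetaB u x y : zeta u (x - y) = zeta u x - zeta u y.
Proof. by rewrite -scaleN1r zetaD zetaZ rmorphN rmorph1 mulN1r. Qed.

Lemma zeta_mul u M x : zeta u (M *m x) = zeta (u *m complexify M) x.
Proof. by rewrite /zeta map_mxM mulmxA. Qed.

Definition modulus u x : R := cmod (zeta u x).

Lemma seminorm_modulus u : seminorm (modulus u).
Proof.
split=> [k x|x y]; first by rewrite /modulus zetaZ cmodM cmod_real.
by rewrite /modulus zetaD ler_cmodD.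
Qed.

Lemma zeta_ReIm u x : zeta u x =
  (dot (\col_i complex.Re (u ord0 i)) x +i* dot (\col_i complex.Im (u ord0 i)) x)%C.
Proof.
rewrite /zeta mxE; apply/eqP; rewrite eq_complex /= !raddf_sum /=.
by apply/andP; split; apply/eqP; apply: eq_bigr => k _; rewrite !mxE;
  case: (u ord0 k) => a b /=; rewrite !mulr0 ?subr0 ?add0r.
Qed.

End LinearForm.

Section SpectralSplit.
Local Open Scope complex_scope.
Variables (R : realType) (d : nat) (M : 'M[R]_d.+1) (lambda : R[i]).
Hypotheses (lead : unique_simple_leading_eigenvalue M lambda).
Hypothesis lambda_gt0 : 0 < cmod lambda.

Local Notation Mc := (complexify M).
Local Notation "p ^toC" := (map_poly (rc R) p) (at level 2, format "p ^toC").

Let charC : (char_poly M)^toC = char_poly Mc.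
Proof. exact: map_char_poly. Qed.

(** A real eigenvector is chosen for real [lambda], so that the leading coordinate is a real form
    and the ellipses degenerate to segments. *)
Lemma left_eigenvector : exists u : 'rV[R[i]]_d.+1, [/\ u != 0, u *m Mc = lambda *: u &
  lambda \is Num.real -> exists p : 'rV[R]_d.+1, u = map_mx (rc R) p].
Proof.
have [[elam _] _ _] := lead.
case: (boolP (lambda \is Num.real)) => [lr|lnr]; last first.
  by have /eigenvalueP[u hu u0] := elam; exists u; split.
have [k kE] := complex_realP _ lr.
have : eigenvalue M k.
  by rewrite eigenvalue_root_char -(fmorph_root (rc R)) charC /= -kE -eigenvalue_root_char.
move=> /eigenvalueP[v hv v0]; exists (map_mx (rc R) v); split.
- apply: contraNneq v0 => /(congr1 (map_mx (@complex.Re R))).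
  by rewrite -map_mx_comp map_mx_id // map_mx0 => ->.
- by rewrite -map_mxM hv map_mxZ kE.
- by exists v.
Qed.

Lemma eigenspace_line (u : 'rV[R[i]]_d.+1) k (W : 'M[R[i]]_(k, d.+1)) : u != 0 ->
  u *m Mc = lambda *: u -> W *m Mc = lambda *: W -> exists D : 'cV_k, W = D *m u.
Proof.
move=> u0 /eigenspaceP uE /eigenspaceP WE; have [_ mup1 _] := lead.
have rE := rank_eigenspace_le_mup Mc lambda; rewrite mup1 in rE.
have ru : \rank u = 1%N by rewrite rank_rV u0.
have [rle] := mxrank_leqif_sup uE; rewrite ru in rle *.
rewrite eqn_leq rle rE => /esym Eu.
by have /submxP[D ->] := submx_trans WE Eu; exists D.
Qed.

Lemma root_conj (p : {poly R}) z : root p^toC (z^*)%C = root p^toC z.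
Proof.
rewrite /root; have -> : p^toC.[(z^*)%C] = (p^toC.[z])^*%C.
  rewrite -[RHS]horner_map /=; congr (_.[_]); apply/polyP => k.
  by rewrite !coef_map /=; apply/eqP; rewrite eq_complex /= oppr0 !eqxx.
by rewrite conjc_eq0.
Qed.

Lemma leading_factor : exists q s, [/\ q^toC = ('X - lambda%:P) * s, q^toC %| char_poly Mc,
   (forall mu, cmod mu < cmod lambda -> ~~ root q^toC mu) &
   (s = 1 \/ complex.Im lambda != 0 /\ s = 'X - (lambda^*)%C%:P)].
Proof.
have [[elam _] _ _] := lead.
have rlam : root (char_poly Mc) lambda by rewrite -eigenvalue_root_char.
have not_root mu nu : cmod mu < cmod lambda -> cmod nu = cmod lambda -> ~~ root ('X - nu%:P) mu.
  by move=> m1 n1; rewrite root_XsubC; apply: contraTneq m1 => ->; rewrite n1 ltxx.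
case: (boolP (lambda \is Num.real)) => [lr|lnr].
  have [k kE] := complex_realP _ lr; exists ('X - k%:P), 1.
  have e : ('X - k%:P)^toC = 'X - lambda%:P by rewrite map_polyXsubC kE.
  rewrite e mulr1; split=> //; last by left.
  - by rewrite dvdp_XsubCl; apply: rlam.
  - by move=> mu m1; apply: not_root => //; rewrite -kE.
have im0 : complex.Im lambda != 0.
  by apply: contraNneq lnr => i0; rewrite [lambda]complexE i0 mulr0 addr0 complex_real.
have modJ : cmod (lambda^*)%C = cmod lambda by rewrite /cmod normcJ.
have neqJ : lambda != (lambda^*)%C.
  apply: contraNneq im0; case: (lambda) => a b /= [] /eqP; rewrite -addr_eq0 -mulr2n.
  by rewrite mulrn_eq0.
pose q : {poly R} := 'X^2 - (complex.Re lambda *+ 2)%:P * 'X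
  + (complex.Re lambda ^+ 2 + complex.Im lambda ^+ 2)%:P.
have e : q^toC = ('X - lambda%:P) * ('X - (lambda^*)%C%:P).
  rewrite /q rmorphD rmorphB /= map_polyXn rmorphM /= map_polyX !map_polyC /=.
  have -> : (complex.Re lambda *+ 2)%:C = lambda + (lambda^*)%C.
    by rewrite addcJ rmorphMn mulr_natl.
  have -> : (complex.Re lambda ^+ 2 + complex.Im lambda ^+ 2)%:C = lambda * (lambda^*)%C.
    by rewrite add_Re2_Im2 sqr_normc.
  rewrite polyCD polyCM; ring.
exists q, ('X - (lambda^*)%C%:P); rewrite e; split=> //; last by right.
- have := @uniq_roots_dvdp _ (char_poly Mc) [:: lambda; (lambda^*)%C].
  rewrite !big_cons big_nil mulr1; apply.
    by rewrite /= rlam andbT -charC root_conj charC rlam.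
  by rewrite uniq_rootsE /= inE neqJ.
- by move=> mu m1; rewrite rootM negb_or !not_root.
Qed.

(* With [q] the real irreducible factor of the characteristic polynomial which
   vanishes at [lambda] and [rho] the cofactor, coprime to [q], a Bezout relation
   [a * rho + b * q = 1] gives the projection [T = (a * rho)(M)]. *)
Theorem spectral_split : exists (T : 'M[R]_d.+1) (u : 'rV[R[i]]_d.+1) (c : R),
  [/\ T *m M = M *m T /\ T *m T = T,
      forall e, 0 < e -> exists J, forall j, (J <= j)%N ->
        forall x : 'cV[R]_d.+1,
          `|M ^+ j *m x - M ^+ j *m (T *m x)| <= e * cmod lambda ^+ j * `|x|,
      0 < c /\ forall x : 'cV[R]_d.+1, `|T *m x| <= c * modulus u x,
      u != 0 /\ u *m Mc = lambda *: u &
      lambda \is Num.real -> exists p : 'rV[R]_d.+1, u = map_mx (rc R) p].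
Proof.
have [[elam _] mup1 small] := lead.
have [u [u0 hu ureal]] := left_eigenvector.
have [q [s [qE qdvd qroot sE]]] := leading_factor.
have cn0 : char_poly Mc != 0 by rewrite monic_neq0 ?char_poly_monic.
pose rho := char_poly M %/ q.
have cE : char_poly M = rho * q.
  by rewrite divpK // -(dvdp_map (rc R)) charC.
have cEC : char_poly Mc = rho^toC * q^toC by rewrite -charC cE rmorphM.
have root_q : root q^toC lambda by rewrite qE rootM root_XsubC eqxx.
have rho_lambda : ~~ root rho^toC lambda.
  apply/negP => rl; move: mup1; rewrite cEC.
  rewrite cEC mulf_eq0 negb_or in cn0; case/andP: cn0 => r0 q0.
  have h1 : (0 < mup lambda rho^toC)%N by rewrite -XsubC_dvd // dvdp_XsubCl.
  have h2 : (0 < mup lambda q^toC)%N by rewrite -XsubC_dvd // dvdp_XsubCl.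
  by rewrite mupM //; lia.
have rho_root mu : root rho^toC mu -> cmod mu < cmod lambda.
  move=> rmu; have emu : eigenvalue Mc mu.
    by rewrite eigenvalue_root_char cEC rootM rmu.
  rewrite -lt_cmod; apply: small => //.
    by apply: contraNneq rho_lambda => <-.
  by apply: contraNneq rho_lambda => e; rewrite -root_conj -e.
have cop : coprimep rho q.
  rewrite -(coprimep_map (rc R)) /= qE coprimepMr coprimep_XsubC rho_lambda /=.
  case: sE => [->|[_ ->]]; first by rewrite coprimep1.
  by rewrite coprimep_XsubC root_conj.
have [[a b] /= ab] := Bezout_eq1_coprimepP _ _ cop.
pose T := horner_mx M (a * rho).
have comm_hM p : horner_mx M p *m M = M *m horner_mx M p.
  have := comm_horner_mx2 M p 'X; rewrite horner_mx_X; exact.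
have T1 : 1%:M - T = horner_mx M (b * q).
  have e1 : horner_mx M (a * rho + b * q) = 1%:M by rewrite ab rmorph1.
  by rewrite -e1 rmorphD /= addrC addKr.
have hM2 (N : 'M[R]_d.+1) p p' : horner_mx N p *m horner_mx N p' = horner_mx N (p * p').
  by rewrite rmorphM.
have hMc2 (N : 'M[R[i]]_d.+1) p p' : horner_mx N p *m horner_mx N p' = horner_mx N (p * p').
  by rewrite rmorphM.
have horner_char p : horner_mx M (p * char_poly M) = 0.
  by rewrite rmorphM /= Cayley_Hamilton mulr0.
have hMc p : map_mx (rc R) (horner_mx M p) = horner_mx Mc p^toC by rewrite map_horner_mx.
(* By Cayley-Hamilton the rows of [T s(M)] are left eigenvectors for [lambda], and simplicity makes
   them multiples of [u]. *)
have [D hD] : exists D : 'cV_d.+1, map_mx (rc R) T *m horner_mx Mc s = D *m u.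
  apply: (eigenspace_line u0 hu); apply/eqP; rewrite -subr_eq0; apply/eqP.
  rewrite -mul_mx_scalar -mulmxBr -[X in X - _]horner_mx_X -(horner_mx_C Mc) -rmorphB /=.
  rewrite -mulmxA hMc !hMc2.
  have -> : (a * rho)^toC * (s * ('X - lambda%:P)) = (a * char_poly M)^toC.
    by rewrite cE [a * (rho * q)]mulrA [RHS]rmorphM /= qE [s * _]mulrC.
  by rewrite -hMc horner_char map_mx0.
have Dx x i : (map_mx (rc R) T *m (horner_mx Mc s *m map_mx (rc R) x)) i (ord0 : 'I_1) =
    D i ord0 * zeta u x.
  by rewrite mulmxA hD -mulmxA mxE big_ord1.
pose S := 1 + \sum_i cmod (D i ord0).
have S0 : 0 < S by rewrite ltr_pwDl // sumr_ge0 // => i _; apply: cmod_ge0.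
have DS i : cmod (D i ord0) <= S.
  rewrite /S (bigD1 i) //= addrCA lerDl addr_ge0 //.
  by apply: sumr_ge0 => *; apply: cmod_ge0.
have [K K0 hK] : exists2 K, 0 < K & forall x i,
    `|(T *m x) i (ord0 : 'I_1)| <= K * cmod (D i ord0 * zeta u x).
  case: sE => [s1|[im0 sE]].
    exists 1 => // x i; rewrite mul1r -Dx s1 rmorph1 mul1mx -map_mxM [map_mx _ _ _ _]mxE.
    by rewrite cmod_real.
  (* As [T x] and [M T x] are real, the imaginary part of [(M - conj lambda) T x] is [Im lambda]
     times [T x]. *)
  exists `|complex.Im lambda|^-1 => [|x i]; first by rewrite invr_gt0 normr_gt0.
  rewrite ler_pdivlMl ?normr_gt0 // -normrM.
  have -> : complex.Im lambda * (T *m x) i ord0 = complex.Im (D i ord0 * zeta u x).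
    rewrite -Dx sE rmorphB /= horner_mx_X horner_mx_C mulmxBl mul_scalar_mx mulmxBr.
    rewrite -scalemxAr -!map_mxM; move: (T *m x) (T *m (M *m x)) => y y'.
    rewrite !mxE; case: (lambda) => a' b' /=.
    by rewrite !mulr0 !add0r mulNr opprK.
  exact: norm_Im_le.
exists T, u, (K * S); split=> //.
- split; first exact: comm_hM.
  apply/eqP; rewrite -subr_eq0 -{3}[T]mulmx1 -mulmxBr -opprB mulmxN T1 hM2.
  have -> : a * rho * (b * q) = a * b * char_poly M by rewrite cE; ring.
  by rewrite horner_char oppr0.
- move=> e e0; pose N := map_mx (rc R) (1%:M - T).
  have [rs rsE] := closed_field_poly_normal rho^toC.
  have lead0 : lead_coef rho^toC != 0.
    by rewrite lead_coef_eq0; apply: contraNneq cn0 => r0; rewrite cEC r0 mul0r.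
  (* [rho (1 - T) = b * rho * q] is a multiple of the characteristic polynomial, so only the roots
     of [rho], all below [lambda] in modulus, act on [1 - T]. *)
  have hann : horner_mx Mc (\prod_(mu <- rs) ('X - mu%:P)) *m N = 0.
    have : horner_mx Mc rho^toC *m N = 0.
      rewrite /N T1 -hMc -map_mxM hM2.
      have -> : rho * (b * q) = b * char_poly M by rewrite cE; ring.
      by rewrite horner_char map_mx0.
    rewrite {1}rsE horner_mxZ -scalemxAl => /eqP.
    by rewrite scaler_eq0 (negbTE lead0) => /eqP.
  have hrs mu : mu \in rs -> cmod mu < cmod lambda.
    move=> mr; apply: rho_root; rewrite rsE rootZ //; by rewrite root_prod_XsubC.
  have e1 : 0 < e / d.+1%:R by rewrite divr_gt0.
  have [J hJ] := annihilated_decay lambda_gt0 hrs hann e1; exists J => j /hJ h x.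
  rewrite -mulmxBr -{1}[x]mul1mx -mulmxBl mulmxA.
  apply: le_trans (norm_mulmx_le _ _) _; rewrite ler_wpM2r //.
  have rj : 0 < cmod lambda ^+ j by apply: exprn_gt0.
  move: h; rewrite mulrC ler_pdivrMr // => h.
  have -> : e * cmod lambda ^+ j = d.+1%:R * (e / d.+1%:R * cmod lambda ^+ j) by field.
  rewrite ler_pM2l //; apply: norm_le_entries => [|i k].
    by rewrite mulr_ge0 ?ltW.
  apply: le_trans h; apply: le_trans (entry_le_sum _ i k).
  have -> : (Mc ^+ j *m N) i k = ((M ^+ j *m (1%:M - T)) i k)%:C.
    by rewrite /N /complexify -rmorphXn /= -map_mxM mxE.
  by rewrite cmod_real.
- split=> [|x]; first by rewrite mulr_gt0.
  apply: norm_le_entries => [|i k]; first by rewrite !mulr_ge0 ?cmod_ge0 ?ltW.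
  rewrite (ord1 k); apply: le_trans (hK x i) _; rewrite -mulrA ler_pM2l //.
  by rewrite cmodM ler_wpM2r ?cmod_ge0.
Qed.

End SpectralSplit.

(** * Powers on the unit circle *)

Section Circle.
Variable R : realType.
Local Open Scope complex_scope.
Implicit Types (t : R) (z : R[i]).

Definition cis t : R[i] := cos t +i* sin t.

Lemma cisD t1 t2 : cis (t1 + t2) = cis t1 * cis t2.
Proof.
rewrite /cis cosD sinD; apply/eqP; rewrite eq_complex /= eqxx /=.
by rewrite [X in _ == X]addrC mulrC [cos t1 * _]mulrC.
Qed.

Lemma cis0 : cis 0 = 1.
Proof. by rewrite /cis cos0 sin0. Qed.

Lemma cis_muln t n : cis (n%:R * t) = cis t ^+ n.
Proof.
elim: n => [|n IH]; first by rewrite mul0r cis0.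
by rewrite -natr1 mulrDl mul1r cisD IH exprSr.
Qed.

Lemma cmod_cis t : cmod (cis t) = 1.
Proof. by rewrite cmod_sqrt /= cos2Dsin2 sqrtr1. Qed.

Lemma cis_2pi n : cis (n%:R * (2 * pi)) = 1.
Proof.
by rewrite cis_muln /cis mulr_natl cos2pi sin2pi expr1n.
Qed.

Lemma cos_sin_surj (a b : R) : a ^+ 2 + b ^+ 2 = 1 ->
  exists t, [/\ 0 <= t, t <= 2 * pi, cos t = a & sin t = b].
Proof.
move=> ab; have a1 : -1 <= a <= 1.
  by rewrite -ler_norml -(@expr_le1 _ 2) // real_normK ?num_real // -ab lerDl sqr_ge0.
have ca : cos (acos a) = a by rewrite acosK // in_itv.
have sa : sin (acos a) = `|b|.
  by rewrite sin_acos // -sqrtr_sqr -ab addrAC subrr add0r.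
have t0 := acos_ge0 a1; have t1 := acos_lepi a1; have p0 := pi_ge0 R.
case: (leP 0 b) => b0.
  by exists (acos a); rewrite ca sa ger0_norm //; split=> //; lra.
exists (- acos a + pi *+ 2); rewrite cosD2pi sinD2pi cosN sinN ca sa ltr0_norm // opprK.
by split=> //; rewrite -mulr_natl; lra.
Qed.

Lemma cis_surj z : cmod z = 1 -> exists t, [/\ 0 <= t, t <= 2 * pi & z = cis t].
Proof.
move=> z1; have [|t [t0 t1 ct st]] := @cos_sin_surj (complex.Re z) (complex.Im z).
  have := congr1 (fun r => r ^+ 2) z1; rewrite cmod_sqrt sqr_sqrtr ?expr1n //.
  by rewrite addr_ge0 ?sqr_ge0.
by exists t; split=> //; rewrite /cis ct st; case: z {z1 ct st}.
Qed.

Lemma cis_continuous0 (e : R) : 0 < e -> exists2 delta, 0 < delta &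
  forall t, `|t| < delta -> cmod (cis t - 1) < e.
Proof.
move=> e0; have e2 : 0 < e / 2 by rewrite divr_gt0.
have /cvgrPdist_lt/(_ _ e2)/nbhs_ballP[d1 /= d10 h1] := @continuous_cos R 0.
have /cvgrPdist_lt/(_ _ e2)/nbhs_ballP[d2 /= d20 h2] := @continuous_sin R 0.
exists (Num.min d1 d2) => [|t]; first by rewrite lt_min d10.
rewrite lt_min => /andP[t1 t2].
have {}h1 := h1 t; rewrite -ball_normE /= sub0r normrN cos0 in h1.
have {}h2 := h2 t; rewrite -ball_normE /= sub0r normrN sin0 sub0r normrN in h2.
have -> : cis t - 1 = (cos t - 1)%:C + (sin t)%:C * 'i.
  by apply/eqP; rewrite eq_complex /=; apply/andP; split; apply/eqP; ring.
apply: le_lt_trans (ler_cmodD _ _) _; rewrite cmodM !cmod_real.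
have -> : cmod ('i : R[i]) = 1 by rewrite cmod_sqrt /= expr0n expr1n add0r sqrtr1.
rewrite mulr1 [e]splitr ltrD // ?h2 // distrC; exact: h1.
Qed.

(** Two of the angles of [z1 ^+ k], reduced mod [2 * pi], are close; their difference [alpha] is
    nonzero, and its multiples run round the circle in steps below [delta]. *)
Lemma unit_powers_dense z1 z2 (e : R) : cmod z1 = 1 -> cmod z2 = 1 ->
  (forall n, (0 < n)%N -> z1 ^+ n != 1) -> 0 < e ->
  exists j, cmod (z1 ^+ j - z2) < e.
Proof.
move=> /cis_surj[phi [phi0 _ ->]] /cis_surj[beta [beta0 beta1 ->]] nroot e0.
have [delta d0 hd] := cis_continuous0 e0.
have p0 : 0 < 2 * pi :> R by rewrite mulr_gt0 // pi_gt0.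
pose fl k := Num.truncn (k%:R * phi / (2 * pi)).
pose f k : R := k%:R * phi - (fl k)%:R * (2 * pi).
have f01 k : 0 <= f k <= 2 * pi.
  have h0 : 0 <= k%:R * phi / (2 * pi) by rewrite divr_ge0 ?mulr_ge0 ?pi_ge0.
  have /andP[] := truncn_itv h0; rewrite ler_pdivlMr // ltr_pdivrMr // -natr1.
  by rewrite /f -/(fl k); lra.
have [K hK] := @pigeonhole R 1 1 (2 * pi) _ d0.
have [|i [j [ij _ hij]]] := hK (fun k => (f k)%:M).
  move=> k _; apply: norm_le_entries => [|a b]; first exact: ltW.
  by rewrite !mxE !ord1 eqxx mulr1n; have /andP[? ?] := f01 k; rewrite ger0_norm.
have {}hij : `|f j - f i| < delta.
  apply: le_lt_trans hij.
  by have := entry_le_norm ((f j)%:M - (f i)%:M : 'M[R]_1) ord0 ord0; rewrite !mxE !mulr1n.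
have cis_f k : cis (f k) = cis phi ^+ k.
  by rewrite -cis_muln -[k%:R * phi](subrK ((fl k)%:R * (2 * pi))) [RHS]cisD cis_2pi mulr1.
pose alpha := f j - f i.
have cis_a : cis alpha = cis phi ^+ (j - i).
  have ci : cis phi ^+ i != 0.
    rewrite expf_neq0 //; apply/eqP => /(congr1 (@cmod R)).
    by rewrite cmod_cis /cmod normr0 /=; lra.
  by apply: (mulIf ci); rewrite -exprD subnK ?(ltnW ij) // -!cis_f -cisD subrK.
have a0 : alpha != 0.
  have := nroot (j - i)%N; rewrite subn_gt0 => /(_ ij); rewrite -cis_a.
  by apply: contraNneq => ->; rewrite cis0.
have {}hij : `|alpha| < delta by [].
clearbody alpha.
suff [n [b' [bb hn]]] : exists n b', cis b' = cis beta /\ `|n%:R * alpha - b'| < delta.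
  exists ((j - i) * n)%N; rewrite exprM -cis_a -cis_muln -bb.
  have -> : cis (n%:R * alpha) - cis b' = cis b' * (cis (n%:R * alpha - b') - 1).
    by rewrite mulrBr mulr1 -cisD [b' + _]addrC subrK.
  by rewrite cmodM cmod_cis mul1r hd.
case: (ltgtP alpha 0) => [an|ap|e1]; last by rewrite e1 eqxx in a0.
  (* Negative steps reach the target from the other side, at its representative below 0. *)
  pose b' := beta - 2 * pi; exists (Num.truncn (b' / alpha)), b'; split.
    have := cis_2pi 1; rewrite mul1r => c1.
    by rewrite -[beta](subrK (2 * pi)) [RHS]cisD c1 mulr1.
  have h0 : 0 <= b' / alpha by rewrite nmulr_lge0 ?invr_lt0 // /b'; lra.
  have /andP[] := truncn_itv h0; rewrite ler_ndivlMr // ltr_ndivrMr // -natr1.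
  set n := (Num.truncn _)%:R => n1 n2; apply: le_lt_trans hij.
  by rewrite (ltr0_norm an) ler_norml; apply/andP; split; lra.
exists (Num.truncn (beta / alpha)), beta; split=> //.
have h0 : 0 <= beta / alpha by rewrite divr_ge0 // ltW.
have /andP[] := truncn_itv h0; rewrite ler_pdivlMr // ltr_pdivrMr // -natr1.
set n := (Num.truncn _)%:R => n1 n2; apply: le_lt_trans hij.
by rewrite (gtr0_norm ap) ler_norml; apply/andP; split; lra.
Qed.

(** The remainder of [n * |t|] modulo [pi] has zero sine, hence vanishes, and [t / pi] would be
    rational with denominator [n]. *)
Lemma irrational_not_root t n : (t / pi : R) \in @irrational R -> (0 < n)%N ->
  cis t ^+ n != 1.
Proof.
rewrite inE => irr n0; apply/eqP => e; apply: irr.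
have p0 := pi_gt0 R; have nR : 0 < n%:R :> R by rewrite ltr0n.
have sn : sin (n%:R * `|t|) = 0.
  have st : sin (n%:R * t) = 0 by have := congr1 (@complex.Im R) e; rewrite -cis_muln.
  case: (leP 0 t) => t0; first by rewrite ger0_norm.
  by rewrite ltr0_norm // mulrN sinN st oppr0.
pose k := Num.truncn (n%:R * `|t| / pi).
have h0 : 0 <= n%:R * `|t| / pi by rewrite divr_ge0 ?mulr_ge0 ?pi_ge0.
have /andP[] := truncn_itv h0; rewrite ler_pdivlMr // ltr_pdivrMr // -natr1 -/k => k1 k2.
pose x := n%:R * `|t| - k%:R * pi.
have sx : sin x = 0.
  have : n%:R * `|t| = x + pi *+ k by rewrite /x -[pi *+ k]mulr_natl subrK.
  move=> E; move: sn; rewrite E (alternatingn (@sinDpi R)).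
  move=> /eqP; rewrite mulf_eq0 signr_eq0 /= => /eqP //.
have x0 : x = 0.
  apply/eqP; rewrite eq_le; apply/andP; split; last by rewrite /x; lra.
  rewrite leNgt; apply/negP => xp; have := @sin_gt0_pi R x.
  by rewrite xp /= sx ltxx => h; have : false by apply: h; rewrite /x; lra.
have tE : `|t| / pi = k%:R / n%:R.
  have : n%:R * `|t| = k%:R * pi by move: x0; rewrite /x; lra.
  by move=> E; apply/eqP; rewrite eqr_div ?(gt_eqF p0) ?(gt_eqF nR) // mulrC E.
case: (leP 0 t) => t0.
  exists (k%:Q / n%:Q) => //; rewrite fmorph_div /= !ratr_nat -tE ger0_norm //.
exists (- (k%:Q / n%:Q)) => //; rewrite rmorphN fmorph_div /= !ratr_nat -tE ltr0_norm //.
by rewrite mulNr opprK.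
Qed.

End Circle.

Section Rigidity.
Variables (R : realType) (d : nat).
Local Open Scope complex_scope.
Implicit Types (M T : 'M[R]_d) (u : 'rV[R[i]]_d) (x y : 'cV[R]_d) (h : 'cV[R]_d -> R).

Lemma zeta_pow M u lambda j x : u *m complexify M = lambda *: u ->
  zeta u (M ^+ j *m x) = lambda ^+ j * zeta u x.
Proof.
move=> hu; elim: j => [|j IH]; first by rewrite !expr0 mul1mx mul1r.
rewrite exprS -mulmxA zeta_mul hu exprS -mulrA -IH.
by rewrite /zeta -scalemxAl mxE.
Qed.

Lemma modulus_normalised u : u != 0 -> exists x, modulus u x = 1.
Proof.
move=> u0; have [j uj] : exists j, u ord0 j != 0.
  apply: contrapT => h; case/eqP: u0; apply/rowP => j; rewrite mxE.
  by apply/eqP; apply: contrapT => uj; apply: h; exists j; apply/negP.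
have m0 : modulus u (delta_mx j ord0) != 0.
  rewrite /modulus; have -> : zeta u (delta_mx j ord0) = u ord0 j.
    rewrite /zeta mxE (bigD1 j) //= big1 ?addr0 => [|k kj]; rewrite !mxE.
      by rewrite !eqxx rmorph1 mulr1.
    by rewrite (negbTE kj) /= mulr0.
  by apply: contraNneq uj => /cmod_eq0 ->.
have sm := seminorm_modulus u.
exists ((modulus u (delta_mx j ord0))^-1 *: delta_mx j ord0).
by rewrite seminormZ // ger0_norm ?mulVf // invr_ge0 seminorm_ge0.
Qed.

Lemma periodic_range M T u lambda (c : R) n : T *m M = M *m T ->
  (forall x, `|T *m x| <= c * modulus u x) -> u *m complexify M = lambda *: u ->
  lambda ^+ n = 1 -> M ^+ n *m T = T.
Proof.
move=> TM hT hu ln.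
have TMn : T *m M ^+ n = M ^+ n *m T.
  elim: n {ln} => [|n IH]; first by rewrite expr0 mulmx1 mul1mx.
  by rewrite exprS [T *m _]mulmxA TM -mulmxA IH mulmxA.
apply/matrixP => i j; have h0 : T *m (M ^+ n *m delta_mx j ord0 - delta_mx j ord0) = 0 :> 'cV[R]_d.
  apply/eqP; rewrite -normr_le0; apply: le_trans (hT _) _.
  rewrite /modulus zetaB (zeta_pow _ _ hu) ln mul1r subrr.
  by rewrite /cmod normr0 /= mulr0.
move: h0; rewrite mulmxBr mulmxA TMn !col_delta_mx => /eqP; rewrite subr_eq0 => /eqP.
by move=> /(congr1 (fun v : 'cV_d => v i ord0)); rewrite !mxE.
Qed.

Lemma seminorm_of_modulus h u : u != 0 -> seminorm h ->
  (exists2 B, 0 < B & forall x, h x <= B * modulus u x) ->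
  (forall x y, modulus u x = modulus u y -> h x <= h y) ->
  exists2 k, 0 <= k & forall x, h x = k * modulus u x.
Proof.
move=> u0 sh [B B0 hB] hle; have [x0 m1] := modulus_normalised u0.
have sm := seminorm_modulus u.
exists (h x0) => [|x]; first exact: seminorm_ge0.
have mx : modulus u (modulus u x *: x0) = modulus u x.
  by rewrite seminormZ // m1 mulr1 ger0_norm // seminorm_ge0.
rewrite mulrC -[modulus u x](ger0_norm (seminorm_ge0 sm _)) -(seminormZ sh).
by apply/eqP; rewrite eq_le !hle.
Qed.

(** Real values of equal modulus differ by a sign; [h] is even and vanishes wherever the form
    does. *)
Lemma real_form_rigid h u (p : 'rV[R]_d) : u != 0 -> u = map_mx (rc R) p -> seminorm h ->
  (exists2 B, 0 < B & forall x, h x <= B * modulus u x) ->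
  exists2 k, 0 <= k & forall x, h x = k * modulus u x.
Proof.
move=> u0 up sh hB; apply: seminorm_of_modulus => // x y; case: hB => [B B0 hB].
have zE z : zeta u z = ((p *m z) ord0 ord0)%:C by rewrite /zeta up -map_mxM mxE.
rewrite /modulus !zE !cmod_real => exy.
have [e|e] : zeta u x = zeta u y \/ zeta u x = zeta u (- y).
  rewrite -[- y]scaleN1r zetaZ !zE; move/eqP: exy; rewrite eqr_norm2.
  by case/orP => /eqP ->; [left|right; rewrite -rmorphM mulN1r].
  apply: le_trans (seminorm_leB sh x y) _; rewrite gerDl.
  by apply: le_trans (hB _) _; rewrite /modulus zetaB e subrr /cmod normr0 /= mulr0.
rewrite -(seminormN sh y); apply: le_trans (seminorm_leB sh x (- y)) _; rewrite gerDl.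
by apply: le_trans (hB _) _; rewrite /modulus zetaB e subrr /cmod normr0 /= mulr0.
Qed.

(** Leading coordinates of equal modulus differ by a rotation, which powers of [lambda] approximate;
    thus [h x] is at most [h (M ^+ j *m y) = h y] up to a small error. *)
Lemma rotation_rigid h M u lambda : u != 0 -> cmod lambda = 1 ->
  (forall n, (0 < n)%N -> lambda ^+ n != 1) -> u *m complexify M = lambda *: u ->
  seminorm h -> (forall x, h (M *m x) = h x) ->
  (exists2 B, 0 < B & forall x, h x <= B * modulus u x) ->
  exists2 k, 0 <= k & forall x, h x = k * modulus u x.
Proof.
move=> u0 l1 nroot hu sh hM hB; apply: seminorm_of_modulus => // x y.
case: hB => [B B0 hB] exy; have hMj j z : h (M ^+ j *m z) = h z.
  elim: j => [|j IH]; first by rewrite expr0 mul1mx.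
  by rewrite exprS -mulmxA hM.
have [y0|y0] := eqVneq (modulus u y) 0.
  apply: le_trans (hB x) _; rewrite exy y0 mulr0; exact: seminorm_ge0.
apply: (@le_of_tail _ _ _ (B * modulus u y)).
  by rewrite mulr_ge0 ?(ltW B0) // cmod_ge0.
move=> e e0.
have zy0 : zeta u y != 0 by apply: contraNneq y0 => zy; rewrite /modulus zy /cmod normr0.
have q1 : cmod (zeta u x / zeta u y) = 1.
  have := cmodM (zeta u x / zeta u y) (zeta u y); rewrite divfK //.
  rewrite -/(modulus u x) -/(modulus u y) exy => E.
  by apply: (mulIf y0); rewrite mul1r.
have [j hj] := unit_powers_dense l1 q1 nroot e0.
apply: le_trans (seminorm_leB sh x (M ^+ j *m y)) _; rewrite hMj lerD2l.
apply: le_trans (hB _) _; rewrite -mulrA ler_pM2l // /modulus zetaB (zeta_pow _ _ hu).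
have -> : zeta u x - lambda ^+ j * zeta u y =
    - ((lambda ^+ j - zeta u x / zeta u y) * zeta u y).
  by rewrite mulrBl divfK // opprB.
rewrite cmodN cmodM mulrC ler_wpM2l ?cmod_ge0 //; exact: ltW.
Qed.

End Rigidity.

(** * Invariant bodies and support functions *)

Section JointSpectralRadius.
Variables (R : realType) (d m : nat).
Implicit Types (A : 'I_m -> 'M[R]_d) (f : 'cV[R]_d -> R).

Lemma joint_spectral_radius_transpose A :
  joint_spectral_radius (transpose_family A) = joint_spectral_radius A.
Proof.
congr (lim (_ @ \oo)); apply/funext => n.
have le (B B' : 'I_m -> 'M[R]_d) :
    (forall w, `|product B w| = `|product B' (rev w)|) ->
    \big[Num.max/0]_(w : n.-tuple 'I_m) `|product B w| `^ n%:R^-1 <=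
    \big[Num.max/0]_(w : n.-tuple 'I_m) `|product B' w| `^ n%:R^-1.
  move=> e; apply/bigmax_leP; split=> [|w _].
    by apply/bigmax_geP; left.
  apply/bigmax_geP; right; exists [tuple of rev w] => //=.
  by rewrite e.
apply/eqP; rewrite eq_le; apply/andP; split; apply: le => w.
  by rewrite product_transpose norm_trmx.
by rewrite product_transpose norm_trmx revK.
Qed.

Lemma root_cvg1 (k : R) : 0 < k -> (fun n : nat => k `^ n%:R^-1) @ \oo --> (1 : R).
Proof.
move=> k0; have -> : (fun n : nat => k `^ n%:R^-1) =
    expR \o (fun n : nat => n%:R^-1 * ln k).
  by apply/funext => n /=; rewrite /powR gt_eqF.
rewrite -[X in _ --> X](@expR0 R); apply: continuous_cvg; first exact: continuous_expR.
have h : (fun n : nat => n%:R^-1 : R) @ \oo --> (0 : R).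
  by rewrite -cvg_shiftS; exact: cvg_harmonic.
by rewrite -(mul0r (ln k)); apply: cvgMl.
Qed.

(** The largest norm of a product of length [n] lies between constant multiples of [q ^+ n], the
    lower bound coming from a greedy trajectory of [x0]. This identifies the limit with [nu A w]
    once an extremal norm is known. *)
Lemma joint_spectral_radius_norm A f (q : R) : 0 <= q -> is_norm f ->
  (exists x : 'cV[R]_d, x != 0) -> (0 < m)%N ->
  (forall x, \big[Num.max/0]_(i < m) f (A i *m x) = q * f x) ->
  joint_spectral_radius A = q.
Proof.
move=> q0 nf [x0 x00] m0 hf; have sf := is_norm_seminorm nf.
have [c1 c10 hc1] := is_norm_bounded_below nf.
have [c2 c20 hc2] := seminorm_bounded sf.
have fA i x : f (A i *m x) <= q * f x.
  by rewrite -hf; apply: (le_bigmax _ (fun i => f (A i *m x))).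
have up s x : f (product A s *m x) <= q ^+ size s * f x.
  elim: s => [|i s IH]; first by rewrite product_nil mul1mx expr0 mul1r.
  rewrite product_cons -mulmxA; apply: le_trans (fA _ _) _.
  by rewrite exprS -mulrA ler_wpM2l.
have upn s : `|product A s| <= c2 / c1 * q ^+ size s.
  apply: norm_le_op => [|x]; first by rewrite mulr_ge0 ?exprn_ge0 // divr_ge0 ?ltW.
  rewrite -!mulrA mulrCA ler_pdivlMl //; apply: le_trans (hc1 _) _.
  apply: le_trans (up s x) _; rewrite mulrCA ler_wpM2l ?exprn_ge0 //.
pose a n := \big[Num.max/0]_(w : n.-tuple 'I_m) `|product A w| `^ n%:R^-1.
suff cvg_a : a @ \oo --> q by apply: cvg_lim.
have an0 n (w : n.-tuple 'I_m) : `|product A w| `^ n%:R^-1 <= a n.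
  exact: (le_bigmax _ (fun w : n.-tuple 'I_m => `|product A w| `^ n%:R^-1)).
have d0 : (0 < d)%N.
  by case: d x0 x00 {A f hf nf sf hc1 hc2 fA up upn a an0} => // x0; rewrite [x0]flatmx0 eqxx.
have dR : 0 < d%:R :> R by rewrite ltr0n.
have [q00|qn] := eqVneq q 0.
  have h n : (0 < n)%N -> a n = 0.
    move=> n0; apply/eqP; rewrite eq_le; apply/andP; split; last by apply/bigmax_geP; left.
    rewrite /a; apply/bigmax_leP; split=> // w _.
    have -> : `|product A w| = 0.
      apply/eqP; rewrite eq_le normr_ge0 andbT; apply: le_trans (upn w) _.
      by rewrite q00 size_tuple expr0n gtn_eqF // mulr0.
    by rewrite powR0 // invr_eq0 pnatr_eq0 -lt0n.
  rewrite q00; apply: cvg_near_cst; exists 1%N => // n /= n1; exact: h.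
have qp : 0 < q by rewrite lt_def qn.
pose k := c1 / (c2 * d%:R); have k0 : 0 < k by rewrite divr_gt0 // mulr_gt0.
pose K := c2 / c1; have K0 : 0 < K by rewrite divr_gt0.
have powE (r : R) n : 0 < r -> (0 < n)%N -> (r * q ^+ n) `^ n%:R^-1 = r `^ n%:R^-1 * q.
  move=> r0 n0; rewrite powRM ?exprn_ge0 ?ltW // -powR_mulrn ?ltW // -powRrM mulfV ?powRr1 ?ltW //.
  by rewrite pnatr_eq0 -lt0n.
have traj n : exists2 w : n.-tuple 'I_m, True & f (product A w *m x0) = q ^+ n * f x0.
  elim: n => [|n [w _ IH]].
    by exists [tuple] => //; rewrite product_nil mul1mx expr0 mul1r.
  have [|i hi] := ord_max_attained (f := fun i => f (A i *m (product A w *m x0))) (Ordinal m0).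
    by move=> i; apply: seminorm_ge0.
  exists [tuple of i :: w] => //; rewrite product_cons -mulmxA hi hf IH.
  by rewrite exprS mulrA.
have lown n : exists w : n.-tuple 'I_m, k * q ^+ n <= `|product A w|.
  have [w _ hw] := traj n; exists w.
  have nx0 : 0 < `|x0| by rewrite normr_gt0.
  rewrite -(ler_pM2r nx0) /k.
  have h1 : q ^+ n * (c1 * `|x0|) <= c2 * (d%:R * `|product A w| * `|x0|).
    apply: le_trans (_ : f (product A w *m x0) <= _).
      by rewrite hw ler_pM2l ?exprn_gt0.
    apply: le_trans (hc2 _) _; rewrite ler_pM2l //; exact: norm_mulmx_le.
  have -> : c1 / (c2 * d%:R) * q ^+ n * `|x0| = q ^+ n * (c1 * `|x0|) / (c2 * d%:R).
    by field; rewrite !gt_eqF.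
  rewrite ler_pdivrMr ?mulr_gt0 //; apply: le_trans h1 _.
  by rewrite le_eqVlt; apply/orP; left; apply/eqP; ring.
have upK s : `|product A s| <= K * q ^+ size s by apply: upn.
clearbody k K.
apply: (@squeeze_cvgr _ _ _ _ (fun n : nat => k `^ n%:R^-1 * q) (fun n : nat => K `^ n%:R^-1 * q)).
- exists 1%N => // n /= n1; rewrite -!powE //; apply/andP; split.
    have [w hw] := lown n; apply: le_trans (an0 n w).
    apply: ge0_ler_powR; rewrite ?invr_ge0 ?nnegrE ?mulr_ge0 ?exprn_ge0 ?(ltW k0) //.
  rewrite /a; apply/bigmax_leP; split=> [|w _]; first exact: powR_ge0.
  apply: ge0_ler_powR; rewrite ?invr_ge0 ?nnegrE ?mulr_ge0 ?exprn_ge0 ?(ltW K0) //.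
  by have := upK w; rewrite size_tuple.
- by rewrite -[X in _ --> X]mul1r; apply: cvgMl; apply: root_cvg1.
- by rewrite -[X in _ --> X]mul1r; apply: cvgMl; apply: root_cvg1.
Qed.

End JointSpectralRadius.

(** * Separation and compact convex hulls *)

Section Convexity.
Variables (R : realType) (d : nat).
Local Notation V := ('cV[R]_d).
Implicit Types (K G : set V) (x y z : V).

Lemma convex_setP K : @convex_set R V K <->
  forall x y (t : R), K x -> K y -> 0 <= t -> t <= 1 -> K (t *: x + (1 - t) *: y).
Proof.
split=> [cK x y t Kx Ky t0 t1|cK x y l].
  have t01 : 0 <= t <= 1 by rewrite t0.
  have := cK x y (Itv01 t0 t1); rewrite !inE => /(_ Kx Ky).
  by [].
rewrite !inE => Kx Ky; apply: cK => //.
Qed.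

Lemma convex_hull_convex K : @convex_set R V (convex_hull K).
Proof.
apply/convex_setP => x y t Kx Ky t0 t1 B [cB KB].
by move/convex_setP: (cB); apply=> //; [apply: Kx|apply: Ky].
Qed.

Lemma sub_convex_hull K : K `<=` convex_hull K.
Proof. exact: sub_gen_smallest. Qed.

Lemma convex_hull_sub K G : @convex_set R V G -> K `<=` G -> convex_hull K `<=` G.
Proof. by move=> cG KG; apply: smallest_sub. Qed.

Lemma convex_halfspace x (b : R) : @convex_set R V [set z | dot z x <= b].
Proof.
apply/convex_setP => y z t /= yb zb t0 t1; rewrite dotDl !dotZl.
have t1' : 0 <= 1 - t by rewrite subr_ge0.
have := ler_wpM2l t0 yb; have := ler_wpM2l t1' zb; lra.
Qed.

Lemma dot_continuous (T : topologicalType) (f g : T -> V) :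
  continuous f -> continuous g -> continuous (fun t => dot (f t) (g t)).
Proof.
move=> cf cg; have h (i : 'I_d) : true ->
    continuous (fun t => f t i ord0 * g t i ord0 : R^o).
  move=> _ t; apply: cvgM.
    apply: (@continuous_comp _ _ _ f (fun M : V => M i ord0)); first exact: cf.
    exact: coord_continuous.
  apply: (@continuous_comp _ _ _ g (fun M : V => M i ord0)); first exact: cg.
  exact: coord_continuous.
have addc : continuous (fun x : R^o * R^o => x.1 + x.2) by exact: add_continuous.
exact: (@continuous_big R^o 'I_d +%R 0 xpredT addc T (index_enum _) _ h).
Qed.

Lemma dot_shift (t : R) x y : dot (t *: x - y) (t *: x - y) =
  dot y y - 2 * (t * dot x y) + t * (t * dot x x).
Proof. by rewrite dotBl !dotBr !dotZl !dotZr (dotC y x); ring. Qed.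

(** [x] points from the nearest point [k0] of [K] to [y]: minimality along the segment from [k0] to
    [k] gives [(k - k0, y - k0) <= 0]. *)
Lemma separation K y : compact K -> @convex_set R V K -> ~ K y ->
  exists x, forall k, K k -> dot k x < dot y x.
Proof.
move=> cK /convex_setP vK Ky; have [K0|K0] := pselect (K !=set0); last first.
  by exists 0 => k Kk; case: K0; exists k.
pose f z := dot (z - y) (z - y).
have cf : continuous f.
  have cs : continuous (fun z : V => z - y).
    move=> z; exact: (@cvgB _ _ _ (nbhs z) _ id (cst y) z y cvg_id (cvg_cst _)).
  exact: dot_continuous.
have [k0] := compact_EVT_min K0 cK (continuous_subspaceT cf).
rewrite inE => Kk0 kmin; exists (y - k0) => k Kk.
have ky : y - k0 != 0 by rewrite subr_eq0; apply: contra_notN Ky => /eqP ->.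
have pos := dot_gt0 ky.
have h : dot (k - k0) (y - k0) <= 0.
  apply: (@le_of_tail _ _ _ (dot (k - k0) (k - k0))); first exact: dot_ge0.
  move=> e e0; pose t := Num.min e 1.
  have t0 : 0 < t by rewrite lt_min e0 ltr01.
  have t1 : t <= 1 by rewrite ge_min lexx orbT.
  have te : t <= e by rewrite ge_min lexx.
  have := kmin (t *: k + (1 - t) *: k0); rewrite inE => /(_ (vK _ _ _ Kk Kk0 (ltW t0) t1)).
  set a := k - k0; set b := y - k0.
  have -> : f (t *: k + (1 - t) *: k0) = f k0 - 2 * (t * dot a b) + t * (t * dot a a).
    rewrite /f; have -> : t *: k + (1 - t) *: k0 - y = t *: a - b.
      by apply/matrixP => i j; rewrite !mxE; ring.
    by rewrite dot_shift -(opprB y k0) dotNl dotNr opprK.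
  move=> h1; have h2 : t * (2 * dot a b) <= t * (t * dot a a) by lra.
  rewrite ler_pM2l // in h2.
  have := dot_ge0 a => aa; have h3 : t * dot a a <= e * dot a a by rewrite ler_wpM2r.
  have : 0 <= e * dot a a by rewrite mulr_ge0 // ltW.
  by rewrite add0r mulrC; lra.
have : dot k (y - k0) = dot (k - k0) (y - k0) + dot k0 (y - k0) by rewrite dotBl subrK.
have : dot (y - k0) (y - k0) = dot y (y - k0) - dot k0 (y - k0) by rewrite dotBl.
lra.
Qed.

Lemma mem_of_support K y : K !=set0 -> compact K -> @convex_set R V K ->
  (forall x, exists2 k, K k & dot y x <= dot k x) -> K y.
Proof.
move=> _ cK vK h; apply: contrapT => /(separation cK vK)[x hx].
by have [k Kk] := h x; rewrite leNgt hx.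
Qed.

(** For nonempty convex sets this is the hull of the union, but in a form that is visibly compact,
    as an image of [[0, 1] x K x G]. *)
Definition join K G : set V :=
  [set z | exists t x y, [/\ 0 <= t, t <= 1, K x, G y & z = t *: x + (1 - t) *: y]].

Lemma join_sub K G C : @convex_set R V C -> K `<=` C -> G `<=` C -> join K G `<=` C.
Proof.
move=> /convex_setP vC KC GC z [t [x [y [t0 t1 Kx Gy ->]]]].
by apply: vC => //; [apply: KC|apply: GC].
Qed.

Lemma sub_joinl K G : G !=set0 -> K `<=` join K G.
Proof.
move=> [y Gy] x Kx; exists 1, x, y; split=> //.
by rewrite subrr scale0r addr0 scale1r.
Qed.

Lemma sub_joinr K G : K !=set0 -> G `<=` join K G.
Proof.
move=> [x Kx] y Gy; exists 0, x, y; split=> //.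
by rewrite subr0 scale0r add0r scale1r.
Qed.

Lemma join_compact K G : compact K -> compact G -> compact (join K G).
Proof.
move=> cK cG; pose phi (p : R * (V * V)) := p.1 *: p.2.1 + (1 - p.1) *: p.2.2.
have -> : join K G = phi @` (`[0, 1]%classic `*` (K `*` G)).
  apply/seteqP; split=> [z [t [x [y [t0 t1 Kx Gy ->]]]]|z [[t [x y]]]].
    by exists (t, (x, y)) => //; split=> //=; rewrite in_itv /= t0.
  move=> [/= + [Kx Gy] <-]; rewrite in_itv /= => /andP[t0 t1].
  by exists t, x, y.
apply: continuous_compact; last first.
  by apply: compact_setX; [exact: segment_compact|apply: compact_setX].
apply: continuous_subspaceT => p.
have c1 : (fun p : R * (V * V) => p.1) @ p --> p.1 by apply: cvg_fst.
have c2 : (fun p : R * (V * V) => p.2.1) @ p --> p.2.1.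
  by apply: cvg_comp; [apply: cvg_snd|apply: cvg_fst].
have c3 : (fun p : R * (V * V) => p.2.2) @ p --> p.2.2.
  by apply: cvg_comp; [apply: cvg_snd|apply: cvg_snd].
apply: cvgD; first exact: cvgZ.
by apply: cvgZ => //; apply: cvgB => //; apply: cvg_cst.
Qed.

Lemma join_convex K G : @convex_set R V K -> @convex_set R V G -> @convex_set R V (join K G).
Proof.
move=> /convex_setP vK /convex_setP vG; apply/convex_setP => z z' s.
move=> [t [x [y [t0 t1 Kx Gy ->]]]] [t' [x' [y' [t0' t1' Kx' Gy' ->]]]] s0 s1.
pose r := s * t + (1 - s) * t'.
have s1' : 0 <= 1 - s by rewrite subr_ge0.
have comb (C : set V) (a b : R) (v v' : V) : 0 <= a -> 0 <= b ->
    (forall x y (t : R), C x -> C y -> 0 <= t -> t <= 1 -> C (t *: x + (1 - t) *: y)) ->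
    C v -> C v' -> exists2 v'', C v'' & a *: v + b *: v' = (a + b) *: v''.
  move=> a0 b0 vC Cv Cv'; have [ab|ab] := eqVneq (a + b) 0.
    exists v => //; have [-> ->] : a = 0 /\ b = 0 by split; lra.
    by rewrite addr0 !scale0r addr0.
  have abp : 0 < a + b by rewrite lt_def ab addr_ge0.
  exists ((a / (a + b)) *: v + (1 - a / (a + b)) *: v').
    apply: vC => //; first by rewrite divr_ge0 // ltW.
    by rewrite ler_pdivrMr // mul1r lerDl.
  have -> : 1 - a / (a + b) = b / (a + b) by field.
  by rewrite scalerDr !scalerA ![(a + b) * _]mulrC !divfK.
have [p Kp hp] := comb K (s * t) ((1 - s) * t') x x' (mulr_ge0 s0 t0) (mulr_ge0 s1' t0') vK Kx Kx'.
have t1s : 0 <= 1 - t by rewrite subr_ge0.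
have t1s' : 0 <= 1 - t' by rewrite subr_ge0.
have [q Gq hq] := comb G (s * (1 - t)) ((1 - s) * (1 - t')) y y' (mulr_ge0 s0 t1s)
  (mulr_ge0 s1' t1s') vG Gy Gy'.
exists r, p, q; split=> //.
- by rewrite addr_ge0 // mulr_ge0.
- have := ler_wpM2l s0 t1; have := ler_wpM2l s1' t1'; rewrite /r; lra.
have -> : 1 - r = s * (1 - t) + (1 - s) * (1 - t') by rewrite /r; ring.
rewrite -hp -hq !scalerDr !scalerA; apply/matrixP => i j; rewrite !mxE; ring.
Qed.

Lemma compact_hull_exists (J : eqType) (l : seq J) (K : J -> set V) : l <> [::] ->
  (forall j, j \in l -> [/\ compact (K j), @convex_set R V (K j) & K j !=set0]) ->
  exists H, [/\ compact H, @convex_set R V H, forall j, j \in l -> K j `<=` H &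
    forall C, @convex_set R V C -> (forall j, j \in l -> K j `<=` C) -> H `<=` C].
Proof.
elim: l => // j [|j' l] IH _ hK.
  have [cj vj _] := hK j (mem_head _ _); exists (K j); split=> // [k|C vC].
    by rewrite inE => /eqP ->.
  by apply; rewrite inE.
have [//|k kl|H [cH vH KH Hmin]] := IH; first by apply: hK; rewrite inE kl orbT.
have [cj vj Kj] := hK j (mem_head _ _).
have H0 : H !=set0.
  have [|_ _ [x Kx]] := hK j'; first by rewrite !inE eqxx orbT.
  by exists x; apply: (KH j') => //; rewrite inE eqxx.
exists (join (K j) H); split.
- exact: join_compact.
- exact: join_convex.
- move=> k; rewrite inE => /orP[/eqP ->|kl]; first exact: sub_joinl.
  exact: subset_trans (KH k kl) (sub_joinr Kj).
- move=> C vC KC; apply: join_sub => //; first by apply: KC; rewrite inE eqxx.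
  by apply: Hmin => // k kl; apply: KC; rewrite inE kl orbT.
Qed.

Lemma compact_convex_hull (J : eqType) (l : seq J) (K : J -> set V) : l <> [::] ->
  (forall j, j \in l -> [/\ compact (K j), @convex_set R V (K j) & K j !=set0]) ->
  compact (convex_hull (\bigcup_(j in [set` l]) K j)).
Proof.
move=> l0 hK; have [H [cH vH KH Hmin]] := compact_hull_exists l0 hK.
suff -> : convex_hull (\bigcup_(j in [set` l]) K j) = H by [].
apply/seteqP; split.
  by apply: convex_hull_sub => // x [j jl Kx]; apply: KH Kx.
apply: Hmin; first exact: convex_hull_convex.
by move=> j jl x Kx; apply: sub_convex_hull; exists j.
Qed.

Lemma linear_image_compact (M : 'M[R]_d) K : compact K -> compact [set M *m x | x in K].
Proof.
move=> cK; apply: continuous_compact => //; apply: continuous_subspaceT => x.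
have [B B0 hB] : exists2 B : R, 0 < B & forall y, `|M *m y| <= B * `|y|.
  exists (d%:R * `|M| + 1) => [|y]; first by rewrite ltr_wpDl // mulr_ge0.
  apply: le_trans (norm_mulmx_le _ _) _; rewrite ler_wpM2r // lerDl //.
apply/(@cvgrPdist_lt _ V _ (nbhs x) _ (fun y : V => M *m y)) => e e0.
apply/nbhs_ballP; exists (e / B); first by rewrite /= divr_gt0.
move=> y; rewrite -ball_normE /= -mulmxBr => h.
by apply: le_lt_trans (hB _) _; rewrite mulrC -ltr_pdivlMr.
Qed.

Lemma linear_image_convex (M : 'M[R]_d) K : @convex_set R V K ->
  @convex_set R V [set M *m x | x in K].
Proof.
move=> /convex_setP vK; apply/convex_setP => _ _ t [x Kx <-] [y Ky <-] t0 t1.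
exists (t *: x + (1 - t) *: y); first exact: vK.
by rewrite mulmxDr -!scalemxAr.
Qed.

End Convexity.

Section SupportFunctions.
Variables (R : realType) (d : nat).
Local Notation V := ('cV[R]_d).
Implicit Types (K G : set V) (x y z : V) (f : V -> R).

Definition support_of G f := forall x, is_max [set dot g x | g in G] (f x).

Lemma is_max_unique (S : set R) a b : is_max S a -> is_max S b -> a = b.
Proof.
move=> [Sa ua] [Sb ub]; apply/eqP; rewrite eq_le.
by apply/andP; split; [apply: ub|apply: ua].
Qed.

Lemma support_ub G f g x : support_of G f -> G g -> dot g x <= f x.
Proof. by move=> /(_ x)[_ ub] Gg; apply: ub; exists g. Qed.

Lemma support_mem G f y : support_of G f -> compact G -> @convex_set R V G ->
  (forall x, dot y x <= f x) -> G y.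
Proof.
move=> sG cG vG hy; apply: contrapT => /(separation cG vG)[x hx].
have [[g Gg gx] _] := sG x; have := hx g Gg; rewrite gx => h.
by have := hy x; rewrite leNgt h.
Qed.

Lemma support_is_norm G f : support_of G f -> interior G !=set0 ->
  (forall x, G x -> G (- x)) -> is_norm f.
Proof.
move=> sG [g0 intG] symG.
have neg g x : G g -> - dot g x <= f x.
  by move=> Gg; rewrite -dotNl; apply: support_ub => //; apply: symG.
have Zle (c : R) x : f (c *: x) <= `|c| * f x.
  have [[g Gg <-] _] := sG (c *: x); rewrite dotZr.
  apply: le_trans (ler_norm _) _; rewrite normrM ler_wpM2l // ler_norml.
  by rewrite (support_ub _ sG Gg) andbT lerNl neg.
split=> [x fx|c x|x y].
- have /nbhs_ballP[e /= e0 he] := intG.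
  have Gd g : G g -> dot g x = 0.
    move=> Gg; apply/eqP; rewrite eq_le; have := neg g x Gg.
    by have := support_ub x sG Gg; rewrite fx oppr_le0 => -> ->.
  pose t := e / (2 * (`|x| + 1)).
  have nx : 0 < `|x| + 1 by rewrite ltr_wpDl.
  have t0 : 0 < t by rewrite divr_gt0 // mulr_gt0.
  (* Both [g0] and [g0 + t *: x] lie in [G], hence are orthogonal to [x] when [f x = 0]; so [x] is
     orthogonal to itself. *)
  have Gt : G (g0 + t *: x).
    apply: he; rewrite -ball_normE /= opprD addrA subrr add0r normrN normrZ gtr0_norm //.
    have -> : e = t * (2 * (`|x| + 1)) by rewrite divfK // gt_eqF // mulr_gt0.
    by rewrite ltr_pM2l //; have := normr_ge0 x; lra.
  have G0 : G g0 by apply: he; apply: ballxx.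
  apply: dot_eq0; have := Gd _ Gt; rewrite dotDl dotZl (Gd _ G0) add0r => /eqP.
  by rewrite mulf_eq0 gt_eqF //= => /eqP.
- apply/eqP; rewrite eq_le Zle /=; have [->|c0] := eqVneq c 0.
    rewrite normr0 mul0r scale0r; have [[g Gg <-] _] := sG 0.
    by rewrite dotC dot0l.
  rewrite -ler_pdivlMl ?normr_gt0 // -normfV.
  by rewrite -{1}[x](scalerK c0); apply: Zle.
have [[g Gg <-] _] := sG (x + y); rewrite dotDr.
by apply: lerD; apply: support_ub.
Qed.

Variables (m : nat) (A : 'I_m -> 'M[R]_d) (rho : R).
Hypotheses (m_gt0 : (0 < m)%N) (rho_ge0 : 0 <= rho).

Let image_union G := \bigcup_(i in [set: 'I_m]) [set transpose_family A i *m x | x in G].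

(** At [x] the transposed image of [G] under [A i] has support value [f (A i *m x)], the hull of a
    union has the maximum of these values, and [rho G] has [rho * f x]. *)
Lemma invariant_body_support G f : support_of G f -> seminorm f ->
  convex_hull (image_union G) = [set rho *: x | x in G] ->
  forall x, \big[Num.max/0]_(i < m) f (A i *m x) = rho * f x.
Proof.
move=> sG sf hG x; apply/eqP; rewrite eq_le; apply/andP; split.
  have le i : f (A i *m x) <= rho * f x.
    have [[g Gg <-] _] := sG (A i *m x); rewrite -dot_tr.
    have : convex_hull (image_union G) ((A i)^T *m g).
      by apply: sub_convex_hull; exists i => //; exists g.
    rewrite hG => -[g' Gg' <-]; rewrite dotZl ler_wpM2l //; exact: support_ub.
  by apply/bigmax_leP; split=> //; rewrite mulr_ge0 // seminorm_ge0.
have [[g Gg <-] _] := sG x.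
have hg : convex_hull (image_union G) (rho *: g) by rewrite hG; exists g.
rewrite -dotZl; set b := \big[_/_]_i _.
suff sub : image_union G `<=` [set z | dot z x <= b].
  exact: (convex_hull_sub (@convex_halfspace R d x b) sub hg).
move=> _ [i _ [g' Gg' <-]] /=; rewrite dot_tr.
apply: le_trans (support_ub _ sG Gg') _.
exact: (le_bigmax _ (fun i => f (A i *m x))).
Qed.

(** Compact convex sets are recovered from their support functions by separation; the lower bound
    [c * |x| <= f x] puts a ball about 0 into [G]. *)
Lemma norm_invariant_body G f : support_of G f -> compact G -> @convex_set R V G ->
  is_norm f -> (forall x, \big[Num.max/0]_(i < m) f (A i *m x) = rho * f x) ->
  convex_body G /\ convex_hull (image_union G) = [set rho *: x | x in G].
Proof.
move=> sG cG vG nf hf; have sf := is_norm_seminorm nf.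
have [c c0 hc] := is_norm_bounded_below nf.
have G0 : G !=set0 by have [[g Gg _] _] := sG 0; exists g.
have symG x : G x -> G (- x).
  move=> Gx; apply: (support_mem sG cG vG) => y.
  by rewrite dotNl -dotNr -(seminormN sf y); apply: support_ub.
have scaleE : [set rho *: x | x in G] = [set rho%:M *m x | x in G].
  by apply/seteqP; split=> _ [x Gx <-]; exists x; rewrite ?mul_scalar_mx.
split; first split=> //.
  exists 0; apply/nbhs_ballP.
  have d1 : 0 < d%:R + 1 :> R by rewrite ltr_wpDl.
  exists (c / (d%:R + 1)) => /=; first by rewrite divr_gt0.
  move=> y; rewrite -ball_normE /= sub0r normrN => hy.
  apply: (support_mem sG cG vG) => x; apply: le_trans (ler_norm _) _.
  apply: le_trans (norm_dot_le _ _) _; apply: le_trans (hc x); rewrite ler_wpM2r //.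
  move: hy; rewrite ltr_pdivlMr // => hy; have := normr_ge0 y; lra.
apply/seteqP; split.
  apply: convex_hull_sub.
    by rewrite scaleE; apply: linear_image_convex.
  move=> _ [i _ [g Gg <-]].
  have : [set rho%:M *m x | x in G] ((A i)^T *m g); last by rewrite scaleE.
  apply: (mem_of_support (K := [set rho%:M *m x | x in G])).
  - by have [y Gy] := G0; exists (rho%:M *m y); exists y.
  - exact: linear_image_compact.
  - exact: linear_image_convex.
  move=> x; have [[g' Gg' hg'] _] := sG x; exists (rho%:M *m g'); first by exists g'.
  rewrite dot_tr mul_scalar_mx dotZl hg' -hf.
  apply: le_trans (support_ub _ sG Gg) _.
  exact: (le_bigmax _ (fun i => f (A i *m x))).
move=> _ [g Gg <-].
have imE : image_union G = \bigcup_(i in [set` index_enum 'I_m])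
    [set transpose_family A i *m x | x in G].
  apply/seteqP; split=> _ [i _ [x Gx <-]]; exists i => //; last by exists x.
    by rewrite /= mem_index_enum.
  by exists x.
apply: mem_of_support.
- have [y Gy] := G0; exists ((A (Ordinal m_gt0))^T *m y); apply: sub_convex_hull.
  by exists (Ordinal m_gt0) => //; exists y.
- rewrite imE; apply: compact_convex_hull.
    move=> e; have := mem_index_enum (Ordinal m_gt0); by rewrite e.
  move=> i _; split; [exact: linear_image_compact|exact: linear_image_convex|].
  by have [y Gy] := G0; exists (transpose_family A i *m y); exists y.
- exact: convex_hull_convex.
move=> x; have [|i hi] := ord_max_attained (f := fun i => f (A i *m x)) (Ordinal m_gt0).
  by move=> i; apply: seminorm_ge0.
have [[g' Gg' hg'] _] := sG (A i *m x); exists ((A i)^T *m g').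
  by apply: sub_convex_hull; exists i => //; exists g'.
rewrite dot_tr hg' hi hf dotZl ler_wpM2l //; exact: support_ub.
Qed.

End SupportFunctions.

(** * Hulls of ellipses *)

Section Ellipses.
Variables (R : realType) (d : nat).
Local Notation V := ('cV[R]_d).
Implicit Types (x y z : V) (E : V * V) (Es : seq (V * V)).

(** The support function of the ellipse, by Cauchy-Schwarz. *)
Definition ell E x := Num.sqrt (dot E.1 x ^+ 2 + dot E.2 x ^+ 2).

Definition ell_max Es x := \big[Num.max/0]_(E <- Es) ell E x.

Lemma ell_arg_ge0 E x : 0 <= dot E.1 x ^+ 2 + dot E.2 x ^+ 2.
Proof. by rewrite addr_ge0 ?sqr_ge0. Qed.

Lemma le_ell_max Es E x : E \in Es -> ell E x <= ell_max Es x.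
Proof.
rewrite /ell_max; elim: Es => // E' Es IH.
rewrite inE big_cons le_max => /orP[/eqP ->|/IH ->]; first by rewrite lexx.
by rewrite orbT.
Qed.

Lemma ell_max_attained Es x : Es <> [::] -> exists2 E, E \in Es & ell E x = ell_max Es x.
Proof.
rewrite /ell_max; elim: Es => // E [|E' Es] IH _.
  by exists E; rewrite ?inE // big_cons big_nil max_l // sqrtr_ge0.
have [//|E0 E0s e0] := IH; rewrite big_cons -e0.
case: (leP (ell E0 x) (ell E x)) => h; first by exists E; rewrite ?inE ?eqxx.
by exists E0; rewrite // inE E0s orbT.
Qed.

Lemma dot_disc_le E x (a b : R) : a ^+ 2 + b ^+ 2 <= 1 ->
  `|dot (a *: E.1 + b *: E.2) x| <= ell E x.
Proof.
move=> ab; rewrite -sqrtr_sqr ler_sqrt ?ell_arg_ge0 // dotDl !dotZl.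
set p := dot E.1 x; set q := dot E.2 x.
have e : (a * p + b * q) ^+ 2 = (a ^+ 2 + b ^+ 2) * (p ^+ 2 + q ^+ 2) - (a * q - b * p) ^+ 2.
  by ring.
have h0 : 0 <= p ^+ 2 + q ^+ 2 by rewrite addr_ge0 ?sqr_ge0.
have := ler_wpM2r h0 ab; have := sqr_ge0 (a * q - b * p).
by rewrite e mul1r; lra.
Qed.

Lemma ell_attained E x : exists t : R,
  dot (cos t *: E.1 + sin t *: E.2) x = ell E x.
Proof.
have [e0|en] := eqVneq (ell E x) 0.
  exists 0; rewrite e0; apply/eqP; rewrite -normr_le0 -[leRHS]e0.
  by apply: dot_disc_le; rewrite cos2Dsin2.
have ep : 0 < ell E x by rewrite lt_def en sqrtr_ge0.
have sq : ell E x ^+ 2 = dot E.1 x ^+ 2 + dot E.2 x ^+ 2.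
  by rewrite sqr_sqrtr // ell_arg_ge0.
have [|t [_ _ ct st]] := @cos_sin_surj R (dot E.1 x / ell E x) (dot E.2 x / ell E x).
  by rewrite !expr_div_n -mulrDl -sq divff // expf_neq0.
exists t; rewrite dotDl !dotZl ct st.
by apply: (mulIf en); rewrite -[RHS]expr2 sq; field.
Qed.

Lemma ell_is_max E x : is_max [set `|dot z x| | z in ellipse E] (ell E x).
Proof.
split.
  have [t ht] := ell_attained E x; exists (cos t *: E.1 + sin t *: E.2).
    by exists t.
  by rewrite ht ger0_norm // sqrtr_ge0.
move=> _ [_ [t _ <-] <-]; apply: dot_disc_le; by rewrite cos2Dsin2.
Qed.

Lemma given_by_ellipsesE Es f : given_by_ellipses Es f -> f = ell_max Es.
Proof.
move=> gf; apply/funext => x; have [[E EEs hE] ub] := gf x.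
have fE := is_max_unique hE (ell_is_max E x).
apply/eqP; rewrite eq_le {1}fE le_ell_max //=.
have [E' E'Es <-] : exists2 E', E' \in Es & ell E' x = ell_max Es x.
  by apply: ell_max_attained; case: (Es) EEs.
by apply: ub; exists E' => //; apply: ell_is_max.
Qed.

Lemma ell_max_given Es : Es <> [::] -> given_by_ellipses Es (ell_max Es).
Proof.
move=> Es0 x; split.
  have [E EEs <-] := ell_max_attained x Es0.
  by exists E => //; apply: ell_is_max.
move=> r [E EEs hr]; rewrite (is_max_unique hr (ell_is_max E x)).
exact: le_ell_max.
Qed.

(** The filled ellipse: it has the same hull and, unlike the curve, is convex, as the compactness of
    hulls of finite unions requires. *)
Definition disc E : set V :=
  [set z | exists a b : R, a ^+ 2 + b ^+ 2 <= 1 /\ z = a *: E.1 + b *: E.2].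

Lemma disc_convex E : @convex_set R V (disc E).
Proof.
apply/convex_setP => _ _ t [a [b [ab ->]]] [a' [b' [ab' ->]]] t0 t1.
exists (t * a + (1 - t) * a'), (t * b + (1 - t) * b'); split.
  have t1' : 0 <= 1 - t by rewrite subr_ge0.
  have := ler_wpM2l t0 ab; have := ler_wpM2l t1' ab'.
  have : 0 <= t * (1 - t) * ((a - a') ^+ 2 + (b - b') ^+ 2).
    by rewrite !mulr_ge0 // addr_ge0 ?sqr_ge0.
  nra.
by apply/matrixP => i j; rewrite !mxE; ring.
Qed.

Lemma disc_compact E : compact (disc E).
Proof.
pose D := [set p : R * R | p.1 ^+ 2 + p.2 ^+ 2 <= 1].
pose phi (p : R * R) : V := p.1 *: E.1 + p.2 *: E.2.
have -> : disc E = phi @` D.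
  apply/seteqP; split=> [_ [a [b [ab ->]]]|_ [[a b] /= ab <-]]; first by exists (a, b).
  by exists a, b.
have c1 : continuous (fun p : R * R => p.1) by move=> p; apply: cvg_fst.
have c2 : continuous (fun p : R * R => p.2) by move=> p; apply: cvg_snd.
apply: continuous_compact.
  apply: continuous_subspaceT => p; apply: cvgD; apply: cvgZ; try exact: cvg_cst.
    exact: c1.
  exact: c2.
have := @subclosed_compact _ D (`[-1, 1]%classic `*` `[-1, 1]%classic). apply.
- apply: (@preimage_closed _ _ (fun p : R * R => p.1 ^+ 2 + p.2 ^+ 2) [set r | r <= 1]);
    last exact: closed_le.
  by move=> p _; apply: cvgD; apply: cvgM; [exact: c1|exact: c1|exact: c2|exact: c2].
- by apply: compact_setX; apply: segment_compact.
have itv (a : R) : a ^+ 2 <= 1 -> `[-1, 1]%classic a.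
  by move=> a1; rewrite /= in_itv /= -ler_norml -(@expr_le1 _ 2) // real_normK ?num_real.
move=> [a b] /= ab; have a2 := sqr_ge0 a; have b2 := sqr_ge0 b.
by split; apply: itv => /=; rewrite /D /= in ab; lra.
Qed.

Lemma ellipses_hullE Es : ellipses_hull Es = convex_hull (\bigcup_(E in [set` Es]) disc E).
Proof.
apply/seteqP; split.
  apply: convex_hull_sub; first exact: convex_hull_convex.
  move=> z [E EEs [t _ <-]]; apply: sub_convex_hull; exists E => //.
  by exists (cos t), (sin t); rewrite cos2Dsin2.
apply: convex_hull_sub; first exact: convex_hull_convex.
move=> _ [E EEs [a [b [ab ->]]]].
have /convex_setP vH := @convex_hull_convex R d (\bigcup_(E in [set` Es]) ellipse E).
pose r := Num.sqrt (a ^+ 2 + b ^+ 2).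
have r0 : 0 <= r by apply: sqrtr_ge0.
have r1 : r <= 1 by rewrite -sqrtr1 ler_sqrt.
have rr : r ^+ 2 = a ^+ 2 + b ^+ 2 by rewrite sqr_sqrtr // addr_ge0 ?sqr_ge0.
have [t [at_ bt]] : exists t, a = r * cos t /\ b = r * sin t.
  have [r00|rn] := eqVneq r 0.
    exists 0; rewrite r00 !mul0r; move: rr; rewrite r00 expr0n /= => /esym/eqP.
    rewrite paddr_eq0 ?sqr_ge0 // !expf_eq0 /= => /andP[/eqP -> /eqP ->] //.
  have [|t [_ _ ct st]] := @cos_sin_surj R (a / r) (b / r).
    by rewrite !expr_div_n -mulrDl -rr divff // expf_neq0.
  by exists t; rewrite ct st ![r * _]mulrC !divfK.
(* A point at radius [r] divides the diameter between the angles [t] and [t + pi] with weights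
   [(1 + r) / 2] and [(1 - r) / 2]. *)
have -> : a *: E.1 + b *: E.2 = ((1 + r) / 2) *: (cos t *: E.1 + sin t *: E.2) +
    (1 - (1 + r) / 2) *: (cos (t + pi) *: E.1 + sin (t + pi) *: E.2).
  have [-> ->] : cos (t + pi) = - cos t /\ sin (t + pi) = - sin t.
    by rewrite cosD sinD cospi sinpi; split; ring.
  by rewrite at_ bt; apply/matrixP => i j; rewrite !mxE; field.
apply: vH.
- by apply: sub_convex_hull; exists E => //; exists t.
- by apply: sub_convex_hull; exists E => //; exists (t + pi).
- by rewrite divr_ge0 // addr_ge0.
- by lra.
Qed.

Lemma ellipses_hull_compact Es : Es <> [::] -> compact (ellipses_hull Es).
Proof.
move=> Es0; rewrite ellipses_hullE; apply: compact_convex_hull => // E _.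
split; [exact: disc_compact|exact: disc_convex|].
by exists 0; exists 0, 0; rewrite expr0n addr0 ler01 !scale0r addr0.
Qed.

Lemma ellipses_hull_support Es : Es <> [::] -> support_of (ellipses_hull Es) (ell_max Es).
Proof.
move=> Es0 x; split.
  have [E EEs <-] := ell_max_attained x Es0; have [t ht] := ell_attained E x.
  exists (cos t *: E.1 + sin t *: E.2) => //.
  by apply: sub_convex_hull; exists E => //; exists t.
move=> _ [g hg <-]; set b := ell_max Es x.
suff sub : \bigcup_(E in [set` Es]) ellipse E `<=` [set z | dot z x <= b].
  exact: (convex_hull_sub (@convex_halfspace R d x b) sub hg).
move=> _ [E EEs [t _ <-]] /=; apply: le_trans (le_ell_max x EEs).
apply: le_trans (ler_norm _) _; apply: dot_disc_le.
by rewrite cos2Dsin2.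
Qed.

(** The square of [ell (a, b)] is the form with matrix [a a^T + b b^T], so each piece, where one
    ellipse dominates, is cut out by differences of such forms. *)
Lemma ell_max_piecewise_quadratic Es : Es <> [::] -> piecewise_quadratic (ell_max Es).
Proof.
move=> Es0; pose Q E := E.1 *m E.1^T + E.2 *m E.2^T.
have QE E x : quadratic_form (Q E) x = ell E x ^+ 2.
  rewrite /quadratic_form /Q mulmxDl dotDr sqr_sqrtr ?ell_arg_ge0 //.
  have h (u : V) : dot x (u *m u^T *m x) = dot u x ^+ 2.
    rewrite -mulmxA [u^T *m x]mx11_scalar -dotE mul_mx_scalar dotZr dotC expr2 //.
  by rewrite !h.
have QB E E' x : quadratic_form (Q E - Q E') x = ell E x ^+ 2 - ell E' x ^+ 2.
  by rewrite -!QE /quadratic_form mulmxBl dotBr.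
exists [seq ([seq Q E - Q E' | E' <- Es], Q E) | E <- Es]; split=> [x|p].
  have [E EEs e] := ell_max_attained x Es0.
  exists ([seq Q E - Q E' | E' <- Es], Q E); first exact: map_f.
  move=> _ /mapP[E' E'Es ->]; rewrite QB e subr_ge0.
  by rewrite lerXn2r // ?nnegrE -?e ?sqrtr_ge0 // e le_ell_max.
move=> /mapP[E EEs ->] x /= hx; rewrite QE; congr (_ ^+ 2).
apply/eqP; rewrite eq_le le_ell_max // andbT.
have [E' E'Es <-] := ell_max_attained x Es0.
have := hx _ (map_f (fun E' => Q E - Q E') E'Es); rewrite QB subr_ge0.
by rewrite ler_pXn2r ?nnegrE ?sqrtr_ge0.
Qed.

End Ellipses.

(** * Polytopes and their vertices *)

Section Polytopes.
Variables (R : realType) (d : nat).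
Local Notation V := ('cV[R]_d).
Implicit Types (x y z p : V) (s : seq V) (G : set V).

Lemma degenerate_ellipses_polytope (Es : seq (V * V)) :
  (forall E, E \in Es -> E.2 = 0) -> polytope (ellipses_hull Es).
Proof.
move=> E20; pose s := [seq E.1 | E <- Es] ++ [seq - E.1 | E <- Es].
have ptE E t : E \in Es -> cos t *: E.1 + sin t *: E.2 = cos t *: E.1.
  by move=> EEs; rewrite E20 // scaler0 addr0.
exists s; apply/seteqP; split; apply: convex_hull_sub; try exact: convex_hull_convex.
  move=> _ [E EEs [t _ <-]]; rewrite ptE //.
  have /convex_setP vH := @convex_hull_convex R d [set` s].
  have -> : cos t *: E.1 = ((1 + cos t) / 2) *: E.1 + (1 - (1 + cos t) / 2) *: (- E.1).
    by apply/matrixP => i j; rewrite !mxE; field.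
  have := cos_max t; rewrite ler_norml => /andP[c1 c2].
  apply: vH; [| |lra|lra]; apply: sub_convex_hull; rewrite /= /s mem_cat.
    by rewrite map_f.
  by rewrite (map_f (fun E : V * V => - E.1)) // orbT.
move=> z /=; rewrite mem_cat => /orP[] /mapP[E EEs ->]; apply: sub_convex_hull; exists E => //.
  by exists 0 => //; rewrite ptE // cos0 scale1r.
by exists pi => //; rewrite ptE // cospi scaleN1r.
Qed.

(** The base value 0 does no harm for symmetric hulls, where some [p] in [s] has [0 <= dot p x]. *)
Definition poly_max s x := \big[Num.max/0]_(p <- s) dot p x.

Lemma seq_argmax (J : eqType) (l : seq J) (f : J -> R) : l <> [::] ->
  exists2 j, j \in l & forall k, k \in l -> f k <= f j.
Proof.
elim: l => // j [|j' l] IH _; first by exists j; rewrite ?inE // => k; rewrite inE => /eqP ->.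
have [//|k kl kmax] := IH; case: (leP (f k) (f j)) => h.
  exists j; first by rewrite inE eqxx.
  move=> i; rewrite inE => /orP[/eqP -> //|/kmax /le_trans]; exact.
exists k; first by rewrite inE kl orbT.
by move=> i; rewrite inE => /orP[/eqP ->|/kmax //]; apply: ltW.
Qed.

Lemma le_poly_max s x p : p \in s -> dot p x <= poly_max s x.
Proof.
rewrite /poly_max; elim: s => // q s IH.
rewrite inE big_cons le_max => /orP[/eqP ->|/IH ->]; first by rewrite lexx.
by rewrite orbT.
Qed.

Lemma hull_le_poly_max s x g : convex_hull [set` s] g -> dot g x <= poly_max s x.
Proof.
move=> hg; set b := poly_max s x.
suff sub : [set` s] `<=` [set z | dot z x <= b].
  exact: (convex_hull_sub (@convex_halfspace R d x b) sub hg).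
by move=> p /= ps; apply: le_poly_max.
Qed.

Lemma poly_max_attained s x : (exists p, p \in s /\ 0 <= dot p x) ->
  exists2 p, p \in s & dot p x = poly_max s x.
Proof.
move=> [p0 [p0s p00]]; have [|p ps pmax] := @seq_argmax _ s (fun p => dot p x).
  by case: (s) p0s.
exists p => //; apply/eqP; rewrite eq_le le_poly_max //= /poly_max big_seq.
elim/big_ind: _ => [|a b ha hb|q qs]; last exact: pmax.
  exact: le_trans p00 (pmax _ p0s).
by rewrite ge_max ha hb.
Qed.

Lemma convex_sqnorm_sublevel x (eta b : R) : 0 <= eta ->
  @convex_set R V [set z | dot z x + eta * dot z z <= b].
Proof.
move=> e0; apply/convex_setP => y z t /= yb zb t0 t1.
have t1' : 0 <= 1 - t by rewrite subr_ge0.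
have -> : dot (t *: y + (1 - t) *: z) x + eta * dot (t *: y + (1 - t) *: z) (t *: y + (1 - t) *: z)
  = t * (dot y x + eta * dot y y) + (1 - t) * (dot z x + eta * dot z z)
    - eta * (t * (1 - t)) * dot (y - z) (y - z).
  by rewrite !dotBl !dotBr !dotDl !dotDr !dotZl !dotZr (dotC z y); ring.
have h : 0 <= eta * (t * (1 - t)) * dot (y - z) (y - z) by rewrite !mulr_ge0 ?dot_ge0.
have := ler_wpM2l t0 yb; have := ler_wpM2l t1' zb; lra.
Qed.

(* A maximiser of the strictly convex function [z |-> (z, x) + eta |z|^2] over
   a polytope is a vertex; for small [eta] it also maximises [(z, x)]. *)
Lemma vertex_of_maximiser s x (eta : R) p : 0 < eta -> p \in s ->
  (forall q, q \in s -> dot q x + eta * dot q q <= dot p x + eta * dot p p) ->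
  vertices (convex_hull [set` s]) p.
Proof.
move=> e0 ps pmax; split; first by apply: sub_convex_hull.
set b := dot p x + eta * dot p p.
have sub : [set` s] `<=` [set z | dot z x + eta * dot z z <= b] by move=> q /= /pmax.
have ub := convex_hull_sub (@convex_sqnorm_sublevel x eta b (ltW e0)) sub.
move=> y z t Gy Gz t0 t1 pE.
have /= yb := ub y Gy; have /= zb := ub z Gz.
have e : b = t * (dot y x + eta * dot y y) + (1 - t) * (dot z x + eta * dot z z)
    - eta * (t * (1 - t)) * dot (y - z) (y - z).
  by rewrite /b pE !dotBl !dotBr !dotDl !dotDr !dotZl !dotZr (dotC z y); ring.
have h1 : t * (dot y x + eta * dot y y) <= t * b by rewrite ler_pM2l.
have t1' : 0 < 1 - t by rewrite subr_gt0.
have h2 : (1 - t) * (dot z x + eta * dot z z) <= (1 - t) * b by rewrite ler_pM2l.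
have k0 : 0 < eta * (t * (1 - t)) by rewrite !mulr_gt0.
have yz : y = z.
  apply/eqP; rewrite -subr_eq0; apply/eqP/dot_eq0; apply/eqP.
  rewrite eq_le dot_ge0 andbT -(ler_pM2l k0) mulr0; lra.
have py : p = y by rewrite pE yz -scalerDl addrC subrK scale1r.
by rewrite -yz py.
Qed.

(** Among the points of [s] maximising [(p, x)] take one of largest Euclidean norm: it stays maximal
    when [eta |p|^2] is added, as the other points of [s] fall short by a margin that exceeds a
    small perturbation. *)
Lemma vertex_attained s x : (exists p, p \in s /\ 0 <= dot p x) ->
  exists2 v, vertices (convex_hull [set` s]) v & dot v x = poly_max s x.
Proof.
move=> /poly_max_attained[p0 p0s p0x].
have [p [ps px pbig]] : exists p, [/\ p \in s, dot p x = poly_max s x &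
    forall q, q \in s -> dot q x = poly_max s x -> dot q q <= dot p p].
  pose s' := [seq q <- s | dot q x == poly_max s x].
  have p0s' : p0 \in s' by rewrite mem_filter p0x eqxx.
  have [|p] := @seq_argmax _ s' (fun q => dot q q); first by case: (s') p0s'.
  rewrite mem_filter => /andP[/eqP px ps] pmax; exists p; split=> // q qs qx.
  by apply: pmax; rewrite mem_filter qx eqxx.
have [eta e0 heta] : exists2 eta : R, 0 < eta & forall q, q \in s ->
    dot q x + eta * dot q q <= dot p x + eta * dot p p.
  have h q : q \in s -> exists2 e : R, 0 < e & forall eta, 0 <= eta -> eta <= e ->
      dot q x + eta * dot q q <= dot p x + eta * dot p p.
    move=> qs; have [qx|qx] := eqVneq (dot q x) (poly_max s x).
      by exists 1 => // eta e0 _; rewrite qx px lerD2l ler_wpM2l // pbig.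
    have qlt : dot q x < dot p x by rewrite lt_neqAle px qx le_poly_max.
    have n0 : 0 < dot q q + 1 by rewrite ltr_wpDl // dot_ge0.
    exists ((dot p x - dot q x) / (dot q q + 1)); first by rewrite divr_gt0 // subr_gt0.
    move=> eta e0; rewrite ler_pdivlMr // => h.
    have := mulr_ge0 e0 (dot_ge0 p); lra.
  have all_h (s0 : seq V) : {subset s0 <= s} -> exists2 e : R, 0 < e & forall eta, 0 <= eta ->
      eta <= e -> forall q, q \in s0 -> dot q x + eta * dot q q <= dot p x + eta * dot p p.
    elim: s0 => [|q s0 IH] sub; first by exists 1.
    have [|e1 e10 h1] := h q; first by apply: sub; rewrite inE eqxx.
    have [|e2 e20 h2] := IH; first by move=> r rs; apply: sub; rewrite inE rs orbT.
    exists (Num.min e1 e2) => [|eta eta0]; first by rewrite lt_min e10.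
    rewrite le_min => /andP[l1 l2] r; rewrite inE => /orP[/eqP ->|]; first exact: h1.
    exact: h2.
  have [e e0 he] := all_h s (fun _ h => h).
  by exists e => // q qs; apply: he (ltW e0) (lexx e) q qs.
by exists p => //; apply: vertex_of_maximiser e0 ps heta.
Qed.

Lemma poly_max_piecewise_linear s : (forall x, exists p, p \in s /\ 0 <= dot p x) ->
  piecewise_linear (poly_max s).
Proof.
move=> s0; exists [seq ([seq p - q | q <- s], p) | p <- s]; split=> [x|p0].
  have [p ps e] := poly_max_attained (s0 x).
  exists ([seq p - q | q <- s], p); first exact: map_f.
  move=> _ /mapP[q qs ->]; rewrite dotBl e subr_ge0; exact: le_poly_max.
move=> /mapP[p ps ->] x /= hx; apply/eqP; rewrite eq_le le_poly_max // andbT.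
have [q qs <-] := poly_max_attained (s0 x).
by have := hx _ (map_f (fun q => p - q) qs); rewrite dotBl subr_ge0.
Qed.

Lemma polytope_support s : (forall x, convex_hull [set` s] x -> convex_hull [set` s] (- x)) ->
  s <> [::] ->
  [/\ forall x, exists p, p \in s /\ 0 <= dot p x,
      support_of (convex_hull [set` s]) (poly_max s) &
      given_by_vertices (convex_hull [set` s]) (poly_max s)].
Proof.
move=> symG sn; set G := convex_hull _ in symG *.
have s0 x : exists p, p \in s /\ 0 <= dot p x.
  have [p ps pmax] := seq_argmax (fun p => dot p x) sn; exists p; split=> //.
  (* [- p] lies in the hull, so [- dot p x] is at most the maximum [dot p x]. *)
  have Gp : G (- p) by apply: symG; apply: sub_convex_hull.
  have sub : [set` s] `<=` [set z | dot z x <= dot p x] by move=> q /= /pmax.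
  have := convex_hull_sub (@convex_halfspace R d x (dot p x)) sub Gp.
  by rewrite /= dotNl; lra.
have sup : support_of G (poly_max s).
  move=> x; split; last by move=> _ [g Gg <-]; apply: hull_le_poly_max.
  by have [p ps e] := poly_max_attained (s0 x); exists p => //; apply: sub_convex_hull.
split=> // x; split.
  have [v vG e] := vertex_attained (s0 x); exists v => //.
  rewrite e ger0_norm //; have [p [ps p0]] := s0 x.
  exact: le_trans p0 (le_poly_max x ps).
move=> _ [v [vG _] <-]; rewrite ler_norml; apply/andP; split.
  by rewrite lerNl -dotNl; apply: hull_le_poly_max; apply: symG.
exact: hull_le_poly_max.
Qed.

End Polytopes.

(** * Barabanov norms *)

Section Eigenvalues.
Variables (F : fieldType) (n : nat).

(** Rotating a word turns its product [M N] into [N M]. *)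
Lemma eigenvalue_mulC (M N : 'M[F]_n) mu : mu != 0 ->
  eigenvalue (M *m N) mu -> eigenvalue (N *m M) mu.
Proof.
move=> mu0 /eigenvalueP[v hv v0]; apply/eigenvalueP; exists (v *m M).
  by rewrite mulmxA -[v *m M *m N]mulmxA hv -scalemxAl.
apply: contraNneq v0 => vM; have : mu *: v = 0 by rewrite -hv mulmxA vM mul0mx.
by move/eqP; rewrite scaler_eq0 (negbTE mu0).
Qed.

End Eigenvalues.

Section SpectralBounds.
Variable R : realType.
Local Open Scope complex_scope.

Lemma annihilated_eigenvalue n (M : 'M[R[i]]_n.+1) (rs : seq R[i]) (v : 'rV_n.+1) :
  v != 0 -> v *m horner_mx M (\prod_(nu <- rs) ('X - nu%:P)) = 0 ->
  exists2 nu, nu \in rs & eigenvalue M nu.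
Proof.
elim: rs v => [|nu rs IH] v v0.
  by rewrite big_nil rmorph1 mulmx1 => v00; rewrite v00 eqxx in v0.
rewrite big_cons rmorphM /= mulmxA => h.
case: (eqVneq (v *m horner_mx M ('X - nu%:P)) 0) => [hv|hv].
  exists nu; first by rewrite inE eqxx.
  apply/eigenvalueP; exists v => //; apply/eqP; rewrite -subr_eq0 -hv.
  by rewrite rmorphB /= horner_mx_X horner_mx_C mulmxBr mul_mx_scalar.
by have [mu mr emu] := IH _ hv h; exists mu; rewrite // inE mr orbT.
Qed.

(** Factoring [X^p - mu] over its roots shows that one of them, a [p]-th root of [mu], is an
    eigenvalue of [M]. *)
Lemma eigenvalue_pow_le n (M : 'M[R[i]]_n) (r : R) p mu :
  (forall nu, eigenvalue M nu -> cmod nu <= r) ->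
  eigenvalue (M ^+ p) mu -> cmod mu <= r ^+ p.
Proof.
case: n M => [M _ /eigenvalueP[v _]|n M]; first by rewrite thinmx0 eqxx.
move=> hM /eigenvalueP[v hv v0]; case: p hv => [|p] hv.
  have mu1 : (1 - mu) *: v = 0.
    by rewrite scalerBl -hv expr0 mulmx1 scale1r subrr.
  move/eqP: mu1; rewrite scaler_eq0 (negbTE v0) orbF subr_eq0 => /eqP <-.
  by rewrite expr0 -(rmorph1 (rc R)) cmod_real normr1.
have [rs rsE] := closed_field_poly_normal ('X^(p.+1) - mu%:P).
have lead1 : lead_coef ('X^(p.+1) - mu%:P) = 1 by rewrite lead_coefXnsubC.
rewrite lead1 scale1r in rsE.
have [|nu nr enu] := @annihilated_eigenvalue _ M rs v v0.
  rewrite -rsE rmorphB rmorphXn /= horner_mx_X horner_mx_C mulmxBr hv mul_mx_scalar.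
  by rewrite subrr.
have : root ('X^(p.+1) - mu%:P) nu by rewrite rsE root_prod_XsubC.
rewrite /root !hornerE subr_eq0 => /eqP <-.
by rewrite cmodX lerXn2r ?nnegrE ?cmod_ge0 ?hM // (le_trans (cmod_ge0 _) (hM _ enu)).
Qed.

Variables (d m : nat) (A : 'I_m -> 'M[R]_d) (w : seq 'I_m) (lambda : R[i]).
Hypothesis dom_w : unique_dominant_product A w.
Hypothesis lead : unique_simple_leading_eigenvalue (product A w) lambda.

Let q := nu A w.

Lemma dominant_word : w <> [::] /\ primitive w.
Proof. by have [h _ _] := dom_w; apply: h. Qed.

Let w_gt0 : (0 < size w)%N.
Proof. by rewrite lt0n size_eq0; apply/eqP; case: dominant_word. Qed.

Lemma spectral_radius_lead : spectral_radius (product A w) = cmod lambda.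
Proof.
have [[elam lmax] _ _] := lead; apply/eqP; rewrite eq_le; apply/andP; split.
  apply: ge_sup; first by exists (cmod lambda), lambda.
  by move=> _ [mu /= emu <-]; rewrite -/(cmod mu) -le_cmod; apply: lmax.
exact: eigenvalue_le_spectral_radius.
Qed.

Lemma root_pow (x : R) k : 0 <= x -> (0 < k)%N -> (x `^ k%:R^-1) ^+ k = x.
Proof.
move=> x0 k0; rewrite -powR_mulrn ?powR_ge0 // -powRrM mulVf ?powRr1 //.
by rewrite pnatr_eq0 -lt0n.
Qed.

Lemma nu_ge0 : 0 <= q. Proof. exact: powR_ge0. Qed.

Lemma nu_pow : q ^+ size w = cmod lambda.
Proof. by rewrite /q /nu spectral_radius_lead root_pow ?cmod_ge0. Qed.

Lemma rotated_eigenvalue k p mu :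
  eigenvalue (complexify (product A (word_power (rot k w) p))) mu ->
  cmod mu <= q ^+ size (word_power (rot k w) p).
Proof.
rewrite product_power size_word_power size_rot mulnC exprM nu_pow.
have -> : complexify (product A (rot k w) ^+ p) = complexify (product A (rot k w)) ^+ p.
  elim: p => [|p IH]; first by rewrite /complexify !expr0 map_mx1.
  by rewrite !exprS -IH; apply: map_mxM.
apply: eigenvalue_pow_le => nu; have [->|nu0] := eqVneq nu 0.
  by rewrite -(rmorph0 (rc R)) cmod_real normr0 cmod_ge0.
rewrite /rot product_cat /complexify map_mxM => /(eigenvalue_mulC nu0).
rewrite -map_mxM -product_cat cat_take_drop => enu.
by have [[_ lmax] _ _] := lead; rewrite -le_cmod; apply: lmax.
Qed.

(** The exponent [1 / |s|] in the dominance condition makes the margin uniform: raised to the power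
    [|s|], it leaves the factor [1 - eps] for every length. This supplies the disc needed by
    [gap]. *)
Lemma dominated_eigenvalue : exists2 b : R, b < 1 & forall s mu, s <> [::] ->
  ~ rotated_power_of w s -> eigenvalue (complexify (product A s)) mu ->
  cmod mu <= b * q ^+ size s.
Proof.
have [_ _ [q' [hq' [eps [e0 e1 heps]]]]] := dom_w.
have qE : q' = q by rewrite -(hq' w).
exists (1 - eps) => [|s mu s0 ns emu]; first lra.
have s_gt0 : (0 < size s)%N by rewrite lt0n size_eq0; apply/eqP.
have := heps s s0; rewrite qE => h.
have {}h : nu A s <= (1 - eps) `^ (size s)%:R^-1 * q.
  by apply: h => -[u [w' [k [/= -> [j ->] sE]]]]; apply: ns; exists j, k.
have sr0 : 0 <= spectral_radius (product A s).
  exact: le_trans (cmod_ge0 mu) (eigenvalue_le_spectral_radius emu).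
apply: le_trans (eigenvalue_le_spectral_radius emu) _.
rewrite -(root_pow sr0 s_gt0) -[X in X * _](@root_pow (1 - eps) (size s)) //; last lra.
by rewrite -exprMn lerXn2r // nnegrE ?mulr_ge0 ?powR_ge0 ?nu_ge0.
Qed.

Lemma all_eigenvalues s mu : s <> [::] ->
  eigenvalue (complexify (product A s)) mu -> cmod mu <= q ^+ size s.
Proof.
move=> s0 emu; have [[k [p sE]]|ns] := pselect (rotated_power_of w s).
  by rewrite sE; apply: rotated_eigenvalue; rewrite -sE.
have [b b1 hb] := dominated_eigenvalue; apply: le_trans (hb s mu s0 ns emu) _.
rewrite -[leRHS]mul1r ler_wpM2r ?exprn_ge0 ?nu_ge0 //; exact: ltW.
Qed.

End SpectralBounds.

Section ExtremalNorms.
Variable R : realType.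
Local Open Scope complex_scope.

(** The Barabanov equation with rate [q], available before the joint spectral radius is known to
    equal [q]. *)
Definition scaled_norm d m (A : 'I_m -> 'M[R]_d) (q : R) (h : 'cV[R]_d -> R) :=
  is_norm h /\ forall x, \big[Num.max/0]_(i < m) h (A i *m x) = q * h x.

Lemma bigmax_scale m (q : R) (f : 'I_m -> R) : 0 <= q ->
  \big[Num.max/0]_(i < m) (q * f i) = q * \big[Num.max/0]_(i < m) f i.
Proof.
move=> q0; elim/big_ind2: _ => [|a b a' b' -> ->|//]; first by rewrite mulr0.
by rewrite maxr_pMr.
Qed.

Lemma scaled_invariant d m (A : 'I_m -> 'M[R]_d) (q : R) h : 0 < q ->
  scaled_norm A q h <-> invariant_norm (fun i => q^-1 *: A i) h.
Proof.
move=> q0; have qi : 0 <= q^-1 by rewrite invr_ge0 ltW.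
split=> -[nh hA]; split=> // x; have sh := is_norm_seminorm nh.
  rewrite (eq_bigr (fun i => q^-1 * h (A i *m x))).
    by rewrite bigmax_scale // hA mulrA mulVf ?gt_eqF // mul1r.
  by move=> i _; rewrite -scalemxAl (seminormZ sh) ger0_norm.
rewrite -hA -bigmax_scale ?(ltW q0) //; apply: eq_bigr => i _.
by rewrite -scalemxAl (seminormZ sh) ger0_norm // mulrA mulfV ?gt_eqF // mul1r.
Qed.

Lemma irreducible_scale d m (A : 'I_m -> 'M[R]_d) (q : R) : q != 0 ->
  irreducible_family A -> irreducible_family (fun i => q^-1 *: A i).
Proof.
move=> q0 irr U hU; apply: irr => i x xU.
have := hU i x xU; rewrite -scalemxAl => h.
have -> : A i *m x = q *: (q^-1 *: (A i *m x)) by rewrite scalerA mulfV // scale1r.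
exact: memvZ.
Qed.

(** Writing [u = p + i r], the modulus of [u M x] is the support function of the ellipse spanned by
    [M^T p] and [M^T r]. *)
Lemma max_modulus_ell d (u : 'rV[R[i]]_d) (Ms : seq 'M[R]_d) :
  let p := \col_i complex.Re (u ord0 i) in let r := \col_i complex.Im (u ord0 i) in
  max_comp (modulus u) Ms = ell_max [seq (M^T *m p, M^T *m r) | M <- Ms].
Proof.
move=> p r; apply/funext => x; rewrite /max_comp /ell_max big_map.
apply: eq_bigr => M _; rewrite /ell /= !dot_tr /modulus zeta_ReIm cmod_sqrt //.
Qed.

Section PositiveRadius.
Variables (d m : nat) (A : 'I_m -> 'M[R]_d.+1) (w : seq 'I_m) (lambda : R[i]).
Hypotheses (irrA : irreducible_family A) (dom_w : unique_dominant_product A w).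
Hypothesis lead : unique_simple_leading_eigenvalue (product A w) lambda.
Hypothesis lambda_gt0 : 0 < cmod lambda.

Let q := nu A w.
Let B i := q^-1 *: A i.
Let r := cmod lambda.

Lemma nu_gt0 : 0 < q.
Proof.
rewrite lt_def nu_ge0 // andbT; apply/eqP => q0.
have := nu_pow dom_w lead; rewrite -/q q0 => h.
have [w0 _] := dominant_word dom_w; move: h lambda_gt0.
rewrite expr0n; case: (w) w0 => // i s _ <-; by rewrite ltxx.
Qed.

Lemma normalised_product : product B w = r^-1 *: product A w.
Proof. by rewrite product_scale exprVn (nu_pow dom_w lead). Qed.

Theorem positive_radius : 
  (exists Es, [/\ Es <> [::], scaled_norm A q (ell_max Es) &
     lambda \is Num.real -> forall E, E \in Es -> E.2 = 0]) /\
  (lambda \is Num.real \/ argument_irrational_mod_pi lambda ->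
   forall h1 h2, scaled_norm A q h1 -> scaled_norm A q h2 ->
   exists2 k, 0 < k & forall x, h2 x = k * h1 x).
Proof.
have q0 := nu_gt0; have qn : q != 0 by rewrite gt_eqF.
have r0 : 0 < r := lambda_gt0.
have [w0 prim] := dominant_word dom_w.
have allE s mu : s <> [::] -> eigenvalue (complexify (product A s)) mu ->
  cmod mu <= q ^+ size s by apply: (all_eigenvalues dom_w lead).
have [_ /bounded_products_pos [C C0 bB]] := normalised_bounded q0 irrA allE.
have [b b1 hb] := dominated_eigenvalue dom_w.
have [gamma g0 hg] := @gap R d.+1 C b b1.
have gapB s (x : 'cV[R]_d.+1) : ~ rotated_power_of w s -> gamma * `|x| <= `|product B s *m x - x|.
  move=> ns; apply: hg; first by apply: norm_le_op (ltW C0) _ => y; apply: bB.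
  have s0 : s <> [::] by move=> s0; apply: ns; exists 0%N, 0%N; rewrite s0.
  have qs : 0 < q ^+ size s by apply: exprn_gt0.
  move=> mu; rewrite product_scale => /eigenvalue_scale.
  rewrite expf_neq0 ?invr_eq0 // => /(_ isT) /(hb _ _ s0 ns).
  rewrite exprVn fmorphV invrK cmodM cmod_real gtr0_norm // ler_pM2r //.
have [T [u [c [[TM TT] dec [c0 hT] [u0 hu] ureal]]]] := spectral_split lead lambda_gt0.
have PB := normalised_product.
have PBj j : product B w ^+ j = r ^- j *: product A w ^+ j.
  by rewrite PB exprZn exprVn.
pose lam := lambda / r%:C.
have rC : r%:C != 0 :> R[i] by rewrite fmorph_eq0 gt_eqF.
have lam1 : cmod lam = 1.
  by rewrite /lam -fmorphV cmodM cmod_real gtr0_norm ?invr_gt0 // mulfV ?gt_eqF.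
have huB : u *m complexify (product B w) = lam *: u.
  rewrite PB /complexify map_mxZ /= -scalemxAr -[map_mx _ _]/(complexify (product A w)) hu.
  by rewrite scalerA /lam fmorphV mulrC.
have TB : T *m product B w = product B w *m T.
  by rewrite PB -scalemxAr TM scalemxAl.
have decB e : 0 < e -> exists J, forall j, (J <= j)%N -> forall x : 'cV[R]_d.+1,
    `|product B w ^+ j *m x - product B w ^+ j *m (T *m x)| <= e * `|x|.
  move=> e0; have [J hJ] := dec e e0; exists J => j /hJ h x.
  rewrite PBj -!scalemxAl -scalerBr normrZ ger0_norm ?invr_ge0 ?exprn_ge0 ?(ltW r0) //.
  by rewrite ler_pdivrMl ?exprn_gt0 // mulrA [_ * e]mulrC.
have sm := seminorm_modulus u.
have psiB (x : 'cV[R]_d.+1) : modulus u (product B w *m x) = modulus u x.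
  by rewrite /modulus -[product B w]expr1 (zeta_pow _ _ huB) cmodM expr1 lam1 mul1r.
have [x1 hx1] := modulus_normalised u0.
have psi0 : exists x, modulus u x <> 0 by exists x1; rewrite hx1; apply/eqP/oner_neq0.
have irrB : irreducible_family B by apply: irreducible_scale.
have real_rigid : lambda \is Num.real -> rigid B w (modulus u).
  move=> /ureal[p up] h sh _ hB; exact: real_form_rigid u0 up sh hB.
have rot_rigid : (forall n, (0 < n)%N -> lam ^+ n != 1) -> rigid B w (modulus u).
  move=> nroot h sh hP hB; exact: (rotation_rigid u0 lam1 nroot huB sh hP hB).
split.
  have alt : (exists2 n, (0 < n)%N & product B w ^+ n *m T = T) \/ rigid B w (modulus u).
    (* Either [lam] is a root of unity, as for real [lambda], and the product has finite order on
       the range of [T], or its powers are dense in the circle. *)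
    have [[n n0 hn]|no] := pselect (exists2 n, (0 < n)%N & lam ^+ n = 1).
      by left; exists n => //; apply: periodic_range TB hT huB hn.
    by right; apply: rot_rigid => n n0; apply/eqP => hn; apply: no; exists n.
  have [Ms hMs] := invariant_norm_exists prim w0 C0 bB g0 gapB TB TT decB sm psiB
    c0 hT alt irrB psi0.
  have := hMs; rewrite max_modulus_ell /=; set Es := map _ _ => hEs.
  exists Es; split.
  - move=> E0; have [[n0 _ _] _] := hEs.
    have x10 : x1 = 0 by apply: n0; rewrite /ell_max E0 big_nil.
    by move: hx1; rewrite x10 (seminorm0 sm) => /eqP; rewrite eq_sym oner_eq0.
  - exact/(scaled_invariant _ _ q0).
  - move=> /ureal[p up] E /mapP[M _ ->] /=.
    have -> : \col_i complex.Im (u ord0 i) = 0 :> 'cV[R]_d.+1.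
      by apply/matrixP => i j; rewrite up !mxE.
    by rewrite mulmx0.
move=> hl h1 h2 /(scaled_invariant _ _ q0) i1 /(scaled_invariant _ _ q0) i2.
apply: (invariant_norm_unique w0 C0 bB g0 gapB TB TT decB sm psiB c0 hT psi0 _ i1 i2).
case: hl => [/real_rigid //|[phi [lE irr]]].
apply: rot_rigid => n n0; have -> : lam = cis phi.
  by rewrite /lam lE cmodE -/r mulrAC mulfV // mul1r.
exact: irrational_not_root.
Qed.

End PositiveRadius.

Section ZeroRadius.
Variables (d m : nat) (A : 'I_m -> 'M[R]_d.+1) (w : seq 'I_m) (lambda : R[i]).
Hypothesis dom_w : unique_dominant_product A w.
Hypothesis lead : unique_simple_leading_eigenvalue (product A w) lambda.
Hypothesis lambda0 : cmod lambda = 0.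

(* All eigenvalues of the dominant product vanish, so simplicity forces [d = 1]. *)
Theorem zero_radius :
  (exists Es, [/\ Es <> [::], scaled_norm A 0 (ell_max Es) &
     forall E, E \in Es -> E.2 = 0]) /\
  (forall h1 h2, scaled_norm A 0 h1 -> scaled_norm A 0 h2 ->
   exists2 k, 0 < k & forall x, h2 x = k * h1 x).
Proof.
have d0 : d = 0%N.
  have [[_ lmax] mup1 _] := lead; have [rs [cE srs hrs]] := char_poly_roots (product A w).
  have l0 : lambda = 0 by apply: cmod_eq0.
  have all0 mu : mu \in rs -> mu = 0.
    by rewrite hrs => /lmax; rewrite l0 normr0 normr_le0 => /eqP.
  have cX : char_poly (complexify (product A w)) = ('X - 0%:P) ^+ size rs.
    rewrite cE; elim: (rs) all0 => [|mu s IH] h; first by rewrite big_nil.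
    rewrite big_cons /= exprS (h mu) ?inE ?eqxx // IH // => nu ns.
    by apply: h; rewrite inE ns orbT.
  by move: mup1; rewrite cX l0 mup_XsubCX eqxx srs => -[].
subst d; have q0 : nu A w = 0.
  have := nu_pow dom_w lead; rewrite lambda0 => /eqP.
  by rewrite expf_eq0 => /andP[_ /eqP].
(* In dimension 1 the entry of a letter is its eigenvalue, bounded by [q = 0]. *)
have A0 i : A i = 0.
  have ei : eigenvalue (complexify (product A [:: i])) ((A i ord0 ord0)%:C).
    apply/eigenvalueP; exists (const_mx 1).
      apply/matrixP => j k; rewrite !mxE big_ord1 !mxE !ord1 mul1r mulr1.
      by rewrite product_seq1.
    by apply/eqP => /matrixP/(_ ord0 ord0)/eqP; rewrite !mxE oner_eq0.
  have := all_eigenvalues dom_w lead _ ei; rewrite q0 expr0n cmod_real normr_le0.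
  by move=> /(_ _)/eqP e; apply/matrixP => j k; rewrite !ord1 e // mxE.
have hA h : is_norm h -> scaled_norm A 0 h.
  move=> nh; split=> // x; rewrite mul0r; apply/eqP; rewrite eq_le.
  apply/andP; split; last by apply/bigmax_geP; left.
  apply/bigmax_leP; split=> // i _; rewrite A0 mul0mx.
  by rewrite (seminorm0 (is_norm_seminorm nh)).
pose e1 : 'cV[R]_1 := const_mx 1.
have xE (x : 'cV[R]_1) : x = x ord0 ord0 *: e1.
  by apply/matrixP => i j; rewrite !mxE !ord1 mulr1.
split.
  exists [:: (e1, 0)]; split=> // [|E]; last by rewrite inE => /eqP ->.
  apply: hA; have fE x : ell_max [:: (e1, 0)] x = `|x ord0 ord0|.
    rewrite /ell_max big_cons big_nil max_l ?sqrtr_ge0 // /ell /= dot0l expr0n addr0.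
    by rewrite sqrtr_sqr /dot big_ord1 mxE mul1r.
  split=> [x|k x|x y]; rewrite !fE.
  - by move=> /eqP; rewrite normr_eq0 => /eqP x0; rewrite (xE x) x0 scale0r.
  - by rewrite mxE normrM.
  - by rewrite mxE ler_normD.
move=> h1 h2 [nh1 _] [nh2 _].
have hE h (x : 'cV[R]_1) : is_norm h -> h x = `|x ord0 ord0| * h e1.
  by move=> nh; rewrite {1}(xE x) (seminormZ (is_norm_seminorm nh)).
have he h : is_norm h -> 0 < h e1.
  move=> nh; rewrite lt_def (seminorm_ge0 (is_norm_seminorm nh)) andbT.
  apply/eqP => h0; case: nh => /(_ _ h0) /matrixP/(_ ord0 ord0)/eqP.
  by rewrite !mxE oner_eq0.
exists (h2 e1 / h1 e1) => [|x]; first by rewrite divr_gt0 // he.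
rewrite (hE h1 x nh1) (hE h2 x nh2) [_ * h1 e1]mulrC mulrA divfK ?gt_eqF ?(he _ nh1) //.
exact: mulrC.
Qed.

End ZeroRadius.

Theorem extremal_norms d m (A : 'I_m -> 'M[R]_d) (w : seq 'I_m) (lambda : R[i]) :
  irreducible_family A -> unique_dominant_product A w ->
  unique_simple_leading_eigenvalue (product A w) lambda ->
  [/\ exists x : 'cV[R]_d, x != 0, 0 <= nu A w,
   (exists Es, [/\ Es <> [::], scaled_norm A (nu A w) (ell_max Es) &
     lambda \is Num.real -> forall E, E \in Es -> E.2 = 0]) &
   (lambda \is Num.real \/ argument_irrational_mod_pi lambda ->
    forall h1 h2, scaled_norm A (nu A w) h1 -> scaled_norm A (nu A w) h2 ->
    exists2 k, 0 < k & forall x, h2 x = k * h1 x)].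
Proof.
case: d A => [|d] A irr dom lead.
  by case: lead => -[/eigenvalueP[v _]]; rewrite thinmx0 eqxx.
have x0 : exists x : 'cV[R]_d.+1, x != 0.
  exists (const_mx 1); apply/eqP => /matrixP/(_ ord0 ord0)/eqP.
  by rewrite !mxE oner_eq0.
have [l0|ln] := eqVneq (cmod lambda) 0.
  have [[Es [h1 h2 h3]] U] := zero_radius dom lead l0.
  have q0 : nu A w = 0.
    have := nu_pow dom lead; rewrite l0 => /eqP.
    by rewrite expf_eq0 => /andP[_ /eqP].
  rewrite q0; split=> //; exists Es; split=> // _; exact: h3.
have lp : 0 < cmod lambda by rewrite lt_def ln cmod_ge0.
have [E U] := positive_radius irr dom lead lp.
by split=> //; apply: nu_ge0.
Qed.

End ExtremalNorms.

Section InvariantBodies.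
Variables (R : realType) (d m : nat) (A : 'I_m -> 'M[R]_d).
Hypothesis m_gt0 : (0 < m)%N.
Variable q : R.
Hypothesis q_ge0 : 0 <= q.
Hypothesis d_gt0 : exists x : 'cV[R]_d, x != 0.
Hypothesis extremal : exists h, scaled_norm A q h.

Let jsrE : joint_spectral_radius A = q.
Proof. by have [h [nh hA]] := extremal; apply: joint_spectral_radius_norm nh _ _ hA. Qed.

Lemma barabanov_scaledE f : barabanov_norm A f <-> scaled_norm A q f.
Proof. by rewrite /barabanov_norm jsrE. Qed.

Lemma support_barabanov G f : support_of G f ->
  invariant_body (transpose_family A) G -> barabanov_norm A f.
Proof.
move=> sG [[vG cG iG symG] hull].
have nf := support_is_norm sG iG symG; split=> //.
move: hull; rewrite joint_spectral_radius_transpose => hull.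
by apply: (invariant_body_support _ sG (is_norm_seminorm nf) hull); rewrite jsrE.
Qed.

Lemma ellipses_invariant_body Es : Es <> [::] -> scaled_norm A q (ell_max Es) ->
  invariant_body (transpose_family A) (ellipses_hull Es).
Proof.
move=> Es0 [nh hA]; rewrite /invariant_body joint_spectral_radius_transpose jsrE.
apply: (norm_invariant_body m_gt0 q_ge0 (ellipses_hull_support Es0) _ _ nh hA).
  exact: ellipses_hull_compact.
exact: convex_hull_convex.
Qed.

Lemma convex_body_hull_neq0 (S : set 'cV[R]_d) : convex_body (convex_hull S) -> S <> set0.
Proof.
move=> [_ _ [x /interior_subset hx] _] S0; move: hx; rewrite S0 => hx.
have := @convex_hull_sub _ _ set0 set0 _ (fun _ => id) x hx; apply.
exact/convex_setP.
Qed.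

End InvariantBodies.

Theorem theorem2 (R : realType) (d m : nat) (A : 'I_m -> 'M[R]_d)
    (w : seq 'I_m) (lambda : R[i])
    (m_ge1 : (1 <= m)%N)
    (irrA : irreducible_family A)
    (dom_w : unique_dominant_product A w)
    (lead_lambda : unique_simple_leading_eigenvalue (product A w) lambda) :
  [/\
    (lambda \is Num.real ->
      (exists G : set 'cV[R]_d, invariant_polytope (transpose_family A) G) /\
      forall G : set 'cV[R]_d, invariant_polytope (transpose_family A) G ->
        exists f : 'cV[R]_d -> R,
          [/\ given_by_vertices G f, unique_barabanov_norm A f
            & piecewise_linear f]),
    (lambda \isn't Num.real ->
      (exists Es : seq ('cV[R]_d * 'cV[R]_d),
        invariant_body (transpose_family A) (ellipses_hull Es)) /\
      forall Es : seq ('cV[R]_d * 'cV[R]_d),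
        invariant_body (transpose_family A) (ellipses_hull Es) ->
        exists f : 'cV[R]_d -> R,
          [/\ given_by_ellipses Es f, barabanov_norm A f
            & piecewise_quadratic f])
  & (lambda \isn't Num.real -> argument_irrational_mod_pi lambda ->
      forall (Es : seq ('cV[R]_d * 'cV[R]_d)) (f : 'cV[R]_d -> R),
        invariant_body (transpose_family A) (ellipses_hull Es) ->
        given_by_ellipses Es f ->
        unique_barabanov_norm A f) ].
Proof.
have [d_gt0 q_ge0 [Es0 [Es0n Es0h Es0l]] uniq_h] := extremal_norms irrA dom_w lead_lambda.
have ext : exists h, scaled_norm A (nu A w) h by exists (ell_max Es0).
have barE f := barabanov_scaledE m_ge1 q_ge0 d_gt0 ext f.
have bar G f := @support_barabanov _ _ _ _ m_ge1 _ q_ge0 d_gt0 ext G f.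
have unique f : lambda \is Num.real \/ argument_irrational_mod_pi lambda ->
    barabanov_norm A f -> unique_barabanov_norm A f.
  by move=> hl bf; split=> // g /barE bg; apply: uniq_h => //; apply/barE.
have inv0 := ellipses_invariant_body m_ge1 q_ge0 d_gt0 ext Es0n Es0h.
have ell_bar Es : invariant_body (transpose_family A) (ellipses_hull Es) ->
    Es <> [::] /\ barabanov_norm A (ell_max Es).
  move=> inv; have Esn : Es <> [::].
    have [body _] := inv => Es1; apply: (convex_body_hull_neq0 body).
    by rewrite Es1; apply/seteqP; split=> // z [].
  by split=> //; apply: bar inv; apply: ellipses_hull_support.
split=> [lreal|lnreal|lnreal larg Es f inv gf].
- split.
    exists (ellipses_hull Es0); split=> //.
    by apply: degenerate_ellipses_polytope; apply: Es0l.
  (* Any invariant polytope serves: its support function is a Barabanov norm, and all of these are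
     proportional. *)
  move=> G [inv [s GE]]; move: inv; rewrite {}GE => inv.
  have [body _] := inv; have [_ _ _ symG] := body.
  have sn : s <> [::].
    by move=> s0; apply: (convex_body_hull_neq0 body); rewrite s0; apply/seteqP; split.
  have [s0 sup giv] := polytope_support symG sn.
  exists (poly_max s); split=> //; last exact: poly_max_piecewise_linear.
  by apply: unique; [left | apply: bar inv].
- split; first by exists Es0.
  move=> Es /ell_bar[Esn Esb]; exists (ell_max Es); split=> //.
    exact: ell_max_given.
  exact: ell_max_piecewise_quadratic.
- have [Esn Esb] := ell_bar Es inv.
  by rewrite (given_by_ellipsesE gf); apply: unique => //; right.
Qed.
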